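(* Let $U(\theta;x,y)\in\mathbb{R}^d$ be an estimating function satisfying $\mathbb{E}\{\delta U(\theta;x,y)\mid x\}=0$ (for each $\theta$, the expectation being under parameter $\theta$), and let $\hat\theta_u$ be the estimator obtained by solving $\sum_{i=1}^N\delta_iU(\theta;x_i,y_i)=0$ in $\theta$. Assume that the partial derivatives of $\mathbb{E}\{\delta U(\theta;x,y)\mid x\}$ with respect to $\theta$ can be passed under the integration sign, and that the regularity conditions for the following standard asymptotic expansion hold: $$\hat\theta_u=\theta-M_\theta^{-1}N^{-1}\sum_{i=1}^N\delta_iU(\theta;x_i,y_i)+o_P(N^{-1/2}),$$ where $M_\theta=\mathbb{E}\{\delta\dot U(\theta;x,y)\}$ is of full rank and $\dot U(\theta;x,y)=\partial U(\theta;x,y)/\partial\theta^{\mathrm T}$. Assume that $\mathbb{E}\{\delta U(\theta;x,y)^{\otimes2}\}$ exists, and that the matrix $\Sigma_\theta$ defined in the context is finite and positive definite. Then the asymptotic variance-covariance matrix of $\hat\theta_u$ scaled by $N$ (that is, the covariance matrix of the limiting normal distribution of $\sqrt N(\hat\theta_u-\theta)$) is $M_\theta^{-1}\,\mathbb{E}\{\delta U(\theta;x,y)^{\otimes2}\}\,(M_\theta^{-1})^{\mathrm T}$, and it satisfies $$M_\theta^{-1}\,\mathbb{E}\{\delta U(\theta;x,y)^{\otimes2}\}\,(M_\theta^{-1})^{\mathrm T}\ \ge\ \Sigma_\theta^{-1}$$ in the Loewner ordering for any $\theta$, where equality holds if $U(\theta;x,y)$ is a linear function of the sampled data conditional score function,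 namely $U(\theta;x,y)=-M_\theta\Sigma_\theta^{-1}\dot\ell_S(\theta;x,y)$.
   Context: The data $(x_i,y_i)$, $i=1,\dots,N$, are independent realizations of $(x,y)$ with joint density $f(y\mid x;\theta)f_X(x)$, $\theta\in\Theta\subset\mathbb{R}^d$, with $f_X$ unspecified; $f(y\mid x;\theta)$ is a density with respect to $\mathrm dy$ (Lebesgue measure for continuous responses, counting measure for discrete ones). $\ell(\theta;x,y)=\log f(y\mid x;\theta)$, and $\dot\ell$ is its gradient in $\theta$. $A^{\otimes2}=AA^{\mathrm T}$. $\delta_i\in\{0,1\}$ is the sampling indicator; given the data, the $\delta_i$ are independent Bernoulli with $\mathbb{P}(\delta_i=1\mid x_i,y_i)=\pi(x_i,y_i)\in(0,1]$, with $\pi$ known, so that the $(x_i,y_i,\delta_i)$ are i.i.d. copies of $(x,y,\delta)$. $\bar\pi(x;\theta)=\int f(y\mid x;\theta)\pi(x,y)\,\mathrm dy$, and $$\Sigma_\theta=\mathbb{E}\left[\dot\ell(\theta;x,y)^{\otimes 2}\,\pi(x,y)-\frac{\big(\mathbb{E}\{\dot\ell(\theta;x,y)\pi(x,y)\mid x\}\big)^{\otimes 2}}{\bar\pi(x;\theta)}\right].$$ The sampled data conditional score function is $$\dot\ell_S(\theta;x,y)=\dot\ell(\theta;x,y)-\mathbb{E}\{\dot\ell(\theta;x,y)\mid x,\delta=1\},\qquad \mathbb{E}\{\dot\ell(\theta;x,y)\mid x,\delta=1\}=\frac{\mathbb{E}\{\dot\ell(\theta;x,y)\pi(x,y)\mid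 x\}}{\bar\pi(x;\theta)}.$$ *)

(* Defs.v *)
From HB Require Import structures.
From mathcomp Require Import all_boot all_order all_algebra.
From mathcomp Require Import all_classical all_reals all_analysis.

Set Implicit Arguments.
Unset Strict Implicit.
Unset Printing Implicit Defensive.

Import Order.TTheory GRing.Theory Num.Theory.
Import numFieldNormedType.Exports.

Local Open Scope classical_set_scope.
Local Open Scope ring_scope.

Section loewner.
Context {R : realType} {d : nat}.

Definition psd (A : 'M[R]_d) : Prop :=
  A^T = A /\ forall v : 'cV[R]_d, 0 <= (v^T *m A *m v) 0 0.

Definition pos_def (A : 'M[R]_d) : Prop :=
  A^T = A /\ forall v : 'cV[R]_d, v != 0 -> 0 < (v^T *m A *m v) 0 0.

Definition loewner_ge (A B : 'M[R]_d) : Prop := psd (A - B).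

Definition outer (a : 'cV[R]_d) : 'M[R]_d := a *m a^T.

End loewner.

(* The reference measures lam and nu are arbitrary sigma-finite measures, so
   that nu may be Lebesgue or counting measure.  f theta x y stands for
   f(y | x; theta); its values for theta outside of Theta are irrelevant.
   Theta is open, so that partial derivatives in theta make sense. *)
Record model (R : realType) (d : nat) (dX dY : measure_display)
    (X : measurableType dX) (Y : measurableType dY) := Model {
  Theta : set 'cV[R]_d ;
  lam : {sigma_finite_measure set X -> \bar R} ;
  nu : {sigma_finite_measure set Y -> \bar R} ;
  fX : X -> R ;
  f : 'cV[R]_d -> X -> Y -> R ;
  samp : X -> Y -> R ; (* the sampling probability pi(x, y) *)
  open_Theta : open Theta ;
  fX_ge0 : forall x, 0 <= fX x ;
  measurable_fX : measurable_fun setT fX ;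
  integral_fX : (\int[lam]_x (fX x)%:E = 1)%E ;
  f_ge0 : forall theta x y, Theta theta -> 0 <= f theta x y ;
  measurable_f : forall theta, Theta theta ->
    measurable_fun setT (fun z : X * Y => f theta z.1 z.2) ;
  integral_f : forall theta x, Theta theta ->
    (\int[nu]_y (f theta x y)%:E = 1)%E ;
  samp_gt0 : forall x y, 0 < samp x y ;
  samp_le1 : forall x y, samp x y <= 1 ;
  measurable_samp : measurable_fun setT (fun z : X * Y => samp z.1 z.2)
}.

Section model_theory.
Context {R : realType} {d : nat} {dX dY : measure_display}.
Context {X : measurableType dX} {Y : measurableType dY}.
Variable m : model R d X Y.
Implicit Types (theta : 'cV[R]_d) (x : X) (y : Y).

(* For almost every x with respect to the law fX * lam of the covariate. *)
Definition ae_x (Q : X -> Prop) : Prop :=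
  {ae lam m, forall x, 0 < fX m x -> Q x}.

(* E(h(delta) | x, y), the law of delta given (x, y) being Bernoulli. *)
Definition mean_delta x y (h : bool -> R) : R :=
  samp m x y * h true + (1 - samp m x y) * h false.

(* E(h(y, delta) | x) and E(h(x, y, delta)) under the parameter theta, for
   real-valued h, then entrywise for matrix-valued H. *)
Definition cexp_integrand theta x (h : Y -> bool -> R) (y : Y) : R :=
  f m theta x y * mean_delta x y (h y).

Definition cexp theta x (h : Y -> bool -> R) : R :=
  \int[nu m]_y cexp_integrand theta x h y.

Definition expect_integrand theta (h : X -> Y -> bool -> R) (z : X * Y) : R :=
  fX m z.1 * cexp_integrand theta z.1 (h z.1) z.2.

Definition expect theta (h : X -> Y -> bool -> R) : R :=
  \int[(lam m \x nu m)%E]_z expect_integrand theta h z.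

Definition cexp_mx p q theta x (H : Y -> bool -> 'M[R]_(p, q)) : 'M[R]_(p, q) :=
  \matrix_(i, j) cexp theta x (fun y b => H y b i j).

Definition cexp_exists p q theta x (H : Y -> bool -> 'M[R]_(p, q)) : Prop :=
  forall i j, (nu m).-integrable setT
    (EFin \o cexp_integrand theta x (fun y b => H y b i j)).

Definition expect_mx p q theta (H : X -> Y -> bool -> 'M[R]_(p, q)) :
    'M[R]_(p, q) :=
  \matrix_(i, j) expect theta (fun x y b => H x y b i j).

Definition expect_exists p q theta (H : X -> Y -> bool -> 'M[R]_(p, q)) : Prop :=
  forall i j, (lam m \x nu m)%E.-integrable setT
    (EFin \o expect_integrand theta (fun x y b => H x y b i j)).

(* delta_mx j 0 is the j-th vector of the canonical basis. *)
Definition score theta x y : 'cV[R]_d :=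
  \col_j 'D_(delta_mx j 0) (fun t : 'cV[R]_d => ln (f m t x y)) theta.

Definition pibar theta x : R := \int[nu m]_y (f m theta x y * samp m x y).

(* E(score * pi | x) *)
Definition cscore_pi theta x : 'cV[R]_d :=
  cexp_mx theta x (fun y _ => samp m x y *: score theta x y).

(* The sampled data conditional score; the subtracted term is
   E(score | x, delta = 1). *)
Definition score_S theta x y : 'cV[R]_d :=
  score theta x y - (pibar theta x)^-1 *: cscore_pi theta x.

Definition Sigma_integrand theta x y (_ : bool) : 'M[R]_d :=
  samp m x y *: outer (score theta x y)
  - (pibar theta x)^-1 *: outer (cscore_pi theta x).

Definition Sigma theta : 'M[R]_d := expect_mx theta (Sigma_integrand theta).

Section estimating_function.
Variable U : 'cV[R]_d -> X -> Y -> 'cV[R]_d.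

Definition deltaU theta x y (b : bool) : 'cV[R]_d := b%:R *: U theta x y.

Definition deltaUU theta x y (b : bool) : 'M[R]_d :=
  b%:R *: outer (U theta x y).

(* Udot = dU / dtheta^T *)
Definition Udot theta x y : 'M[R]_d :=
  \matrix_(i, j) 'D_(delta_mx j 0) (fun t : 'cV[R]_d => U t x y i 0) theta.

Definition deltaUdot theta x y (b : bool) : 'M[R]_d := b%:R *: Udot theta x y.

Definition M_ theta : 'M[R]_d := expect_mx theta (deltaUdot theta).

Definition B_ theta : 'M[R]_d := expect_mx theta (deltaUU theta).

(* The exceptional null set of covariate values does not depend on theta:
   the identity is to be differentiated in theta at fixed x. *)
Definition unbiased : Prop :=
  ae_x (fun x => forall theta, Theta m theta ->
    cexp_exists theta x (deltaU theta x) /\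
    cexp_mx theta x (deltaU theta x) = 0).

(* The partial derivatives that define the score and Udot exist, and the
   functions of (x, y) involved are measurable. *)
Definition regular_at theta : Prop :=
  [/\ ae_x (fun x => {ae nu m, forall y, forall j : 'I_d,
         derivable (fun t : 'cV[R]_d => f m t x y) theta (delta_mx j 0) /\
         forall i : 'I_d,
           derivable (fun t : 'cV[R]_d => U t x y i 0) theta (delta_mx j 0)}),
      (forall t, Theta m t -> forall i : 'I_d,
         measurable_fun setT (fun z : X * Y => U t z.1 z.2 i 0)) &
      (forall i : 'I_d,
         measurable_fun setT (fun z : X * Y => score theta z.1 z.2 i 0))].

(* d/dtheta_j of E_theta(delta U_i(theta; x, y) | x), where theta enters both
   the conditional density and U, may be taken inside of the integral. *)
Definition derivative_under_integral theta : Prop :=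
  ae_x (fun x => forall i j : 'I_d,
    let F (y : Y) (t : 'cV[R]_d) : R :=
      cexp_integrand t x (fun y b => deltaU t x y b i 0) y in
    (nu m).-integrable setT (fun y => ('D_(delta_mx j 0) (F y) theta)%:E) /\
    is_derive theta (delta_mx j 0 : 'cV[R]_d)
      (fun t : 'cV[R]_d => cexp t x (fun y b => deltaU t x y b i 0))
      (\int[nu m]_y 'D_(delta_mx j 0) (F y) theta)).

(* U(theta; x, y) = A * score_S(theta; x, y) almost surely under theta. *)
Definition U_linear_in_score_S theta (A : 'M[R]_d) : Prop :=
  ae_x (fun x => {ae nu m, forall y, 0 < f m theta x y ->
    U theta x y = A *m score_S theta x y}).

End estimating_function.

Section sample.
Context {dO : measure_display} {Omega : measurableType dO}.
Variable P : probability Omega R.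
Variables (x_ : nat -> Omega -> X) (y_ : nat -> Omega -> Y)
  (delta_ : nat -> Omega -> bool).

Let Z_ i (w : Omega) : X * Y * bool := (x_ i w, y_ i w, delta_ i w).

(* The triples (x_i, y_i, delta_i) are independent with the law of
   (x, y, delta) under theta. *)
Definition iid_sample theta : Prop :=
  [/\ (forall i, measurable_fun setT (Z_ i)),
      (forall (n : nat) (S : nat -> set (X * Y * bool)),
         (forall i, measurable (S i)) ->
         P (\bigcap_(i in `I_n) (Z_ i @^-1` S i)) =
         (\prod_(i < n) P (Z_ i @^-1` S i))%E) &
      (forall i (S : set (X * Y * bool)), measurable S ->
         P (Z_ i @^-1` S) =
         (expect theta (fun x y b => \1_S (x, y, b)))%:E)].

Definition est_sum (U : 'cV[R]_d -> X -> Y -> 'cV[R]_d) (N : nat) theta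
    (w : Omega) : 'cV[R]_d :=
  \sum_(i < N) (delta_ i w)%:R *: U theta (x_ i w) (y_ i w).

(* With probability tending to one, thetahat solves the estimating equation. *)
Definition solves_estimating_equation (U : 'cV[R]_d -> X -> Y -> 'cV[R]_d)
    (thetahat : nat -> Omega -> 'cV[R]_d) : Prop :=
  exists A : nat -> set Omega,
    [/\ (forall N, measurable (A N)),
        (forall N w, A N w ->
           Theta m (thetahat N w) /\ est_sum U N (thetahat N w) w = 0) &
        P (A N) @[N --> \oo] --> 1%E].

End sample.

End model_theory.

Section random_vectors.
Context {R : realType} {d : nat}.

Definition random_vector {dO} {Omega : measurableType dO}
    (W : Omega -> 'cV[R]_d) : Prop :=
  forall i : 'I_d, measurable_fun setT (fun w => W w i 0).

(* W_N = o_P(r_N) *)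
Definition is_oP {dO} {Omega : measurableType dO} (P : probability Omega R)
    (r : nat -> R) (W : nat -> Omega -> 'cV[R]_d) : Prop :=
  forall eps : R, 0 < eps ->
    P [set w | eps * r N < `|W N w|] @[N --> \oo] --> 0%E.

Definition cvg_in_distribution
    {dO} {Omega : measurableType dO} (P : probability Omega R)
    (W : nat -> Omega -> 'cV[R]_d)
    {dT} {T : measurableType dT} (Q : probability T R)
    (Z : T -> 'cV[R]_d) : Prop :=
  forall g : 'cV[R]_d -> R, continuous g ->
    (exists K : R, forall v, `|g v| <= K) ->
    \int[P]_w g (W N w) @[N --> \oo] --> \int[Q]_z g (Z z).

(* Z ~ N(0, V): every linear combination t^T Z has law N(0, t^T V t).  The
   degenerate law is treated apart, since normal_prob 0 0 is not the Dirac
   mass at 0. *)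
Definition centered_normal {dT} {T : measurableType dT} (Q : probability T R)
    (Z : T -> 'cV[R]_d) (V : 'M[R]_d) : Prop :=
  [/\ psd V, random_vector Z &
      forall (t : 'cV[R]_d) (A : set R), measurable A ->
        let s2 := (t^T *m V *m t) 0 0 in
        Q [set z | A ((t^T *m Z z) 0 0)] =
        if s2 == 0 then \d_(0 : R) A else normal_prob 0 (Num.sqrt s2) A].

Definition asymptotically_normal
    {dO} {Omega : measurableType dO} (P : probability Omega R)
    (W : nat -> Omega -> 'cV[R]_d) (V : 'M[R]_d) : Prop :=
  exists (dT : measure_display) (T : measurableType dT) (Q : probability T R)
    (Z : T -> 'cV[R]_d),
    centered_normal Q Z V /\ cvg_in_distribution P W Q Z.

End random_vectors.

(* Main.v *)
Require Import Defs.
From HB Require Import structures.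
From mathcomp Require Import all_boot all_order all_algebra.
From mathcomp Require Import all_classical all_reals all_analysis.
From mathcomp Require Import measurable_realfun finmap ring lra.
Set Implicit Arguments.
Unset Strict Implicit.
Unset Printing Implicit Defensive.
Import Order.TTheory GRing.Theory Num.Theory.
Import numFieldNormedType.Exports.
Local Open Scope classical_set_scope.
Local Open Scope ring_scope.

(** With expectations under theta, let S be the conditional score [score_S].
    Differentiating E(delta U | x) = 0 under the integral sign gives
    E(delta U S^T) = - M, because E(delta U | x) = 0 kills the x-measurable
    correction in S; moreover E(delta S S^T) = Sigma.  Hence
    0 <= E(delta (u^T U + v^T S)^2) = u^T B u - 2 u^T M v + v^T Sigma v,
    and u = (M^-1)^T t, v = Sigma^-1 t yields the Loewner bound.

    Asymptotic normality is the multivariate central limit theorem for the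
    i.i.d. vectors - M^-1 delta_i U(theta; x_i, y_i), together with Slutsky's
    lemma.  It is proved by characteristic functions: by the Stone-Weierstrass
    theorem, trigonometric polynomials are dense enough for the convergence of
    E cos(t^T W) and E sin(t^T W), with tightness, to give convergence in law. *)

(** * Positive semidefinite matrices as sums of rank-one matrices *)

Section psd_factorization.
Context {R : realType} {d : nat}.
Implicit Types (A : 'M[R]_d) (u v : 'cV[R]_d).

(** The central limit theorem is proved for any positive semidefinite covariance, singular ones
    included. The limit law is therefore built from independent scalar normals along a sum of
    rank-one matrices, not from a density, and the laws of its projections are identified by
    uniqueness of characteristic functions. The latter are pairs of real integrals, of a cosine and
    of a sine. On the statistical side the delicate points are integrability and zeros. Finiteness
    of [Sigma] concerns a difference of two terms, not each of them; square integrability of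
    [score_S] comes from comparing integrals in [y] at fixed [x], and from Tonelli. The score
    differentiates [ln (f m t x y)], which says nothing where the density vanishes; there [theta] is
    an interior minimum of a nonnegative function, so [f] times the score is still the derivative of
    [f]. Conditional identities hold for almost every [x] with [0 < fX m x] and are then integrated
    against [fX m]. The sample law is given on events only; it is a mixture of a part with
    [delta = 1] and a part with [delta = 0], which reduces its integrals to integrals in
    [(x, y)]. *)

Definition bform A u v : R := (u^T *m A *m v) 0 0.

Lemma bformDl A u v w : bform A (u + v) w = bform A u w + bform A v w.
Proof. by rewrite /bform linearD !mulmxDl mxE. Qed.

Lemma bformDr A u v w : bform A w (u + v) = bform A w u + bform A w v.
Proof. by rewrite /bform mulmxDr mxE. Qed.

Lemma bformZl A a u v : bform A (a *: u) v = a * bform A u v.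
Proof. by rewrite /bform linearZ -!scalemxAl mxE. Qed.

Lemma bformZr A a u v : bform A u (a *: v) = a * bform A u v.
Proof. by rewrite /bform -scalemxAr mxE. Qed.

Lemma bformC A u v : A^T = A -> bform A u v = bform A v u.
Proof.
move=> sA; have -> : bform A u v = (u^T *m A *m v)^T 0 0 by rewrite mxE.
by rewrite !trmx_mul trmxK sA mulmxA.
Qed.

Lemma bform_delta A i j : bform A (delta_mx i 0) (delta_mx j 0) = A i j.
Proof. by rewrite /bform trmx_delta -mulmxA -colE -rowE !mxE. Qed.

Lemma bform_outer c u v : bform (outer c) u v = (u^T *m c) 0 0 * (v^T *m c) 0 0.
Proof.
rewrite /bform /outer !mulmxA -mulmxA mxE big_ord1; congr (_ * _).
have -> : (v^T *m c) 0 0 = (v^T *m c)^T 0 0 by rewrite [RHS]mxE.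
by rewrite trmx_mul trmxK.
Qed.

(** The form at [u + t *: v] is a nonnegative polynomial in [t]. If [bform A v v] vanishes it is
    affine, and the chosen [t] would give it the value -1 unless its slope is zero; otherwise its
    minimiser gives the inequality. *)
Lemma psd_cauchy_schwarz A u v : psd A ->
  bform A u v ^+ 2 <= bform A u u * bform A v v.
Proof.
move=> [sA A0].
have q0 w : 0 <= bform A w w by exact: A0.
have q t : 0 <= bform A u u + 2 * t * bform A u v + t ^+ 2 * bform A v v.
  apply: le_trans (q0 (u + t *: v)) _.
  rewrite !(bformDl, bformDr, bformZl, bformZr) (bformC v u sA); lra.
have [v0|v0] := eqVneq (bform A v v) 0.
  rewrite v0 mulr0 in q *; have := q (- (bform A u u + 1) / (2 * bform A u v)).
  have [-> |b0] := eqVneq (bform A u v) 0; first by rewrite expr0n.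
  suff -> : 2 * (- (bform A u u + 1) / (2 * bform A u v)) * bform A u v =
    - (bform A u u + 1) by rewrite mulr0 addr0 opprD addrA subrr sub0r ler0N1.
  by field.
have v1 : 0 < bform A v v by rewrite lt_neqAle eq_sym v0 q0.
have := q (- bform A u v / bform A v v).
have -> : bform A u u + 2 * (- bform A u v / bform A v v) * bform A u v +
   (- bform A u v / bform A v v) ^+ 2 * bform A v v =
   bform A u u - bform A u v ^+ 2 / bform A v v by field.
by rewrite subr_ge0 ler_pdivrMr.
Qed.

Lemma outer_sym (c : 'cV[R]_d) : (outer c)^T = outer c.
Proof. by rewrite /outer trmx_mul trmxK. Qed.

(* Symmetric elimination of one diagonal entry at a time. *)
Lemma psd_sum_outer A : psd A ->
  exists s : seq 'cV[R]_d, A = \sum_(c <- s) outer c.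
Proof.
have [n] := ubnP #|[pred i | A i i != 0]|.
elim: n A => // n IH A; rewrite ltnS => An pA.
(* By Cauchy-Schwarz a zero diagonal entry clears its whole row, so the induction on the number of
   nonzero diagonal entries ends at the zero matrix. *)
have diag0 i j : A i i = 0 -> A i j = 0.
  move=> Aii; have := @psd_cauchy_schwarz A (delta_mx i 0) (delta_mx j 0) pA.
  rewrite !bform_delta Aii mul0r => h; apply/eqP; rewrite -sqrf_eq0 eq_le h.
  exact: sqr_ge0.
have [/forallP A0|] := boolP [forall i, A i i == 0].
  exists [::]; rewrite big_nil; apply/matrixP => i j; rewrite mxE.
  exact/diag0/eqP.
rewrite negb_forall => /existsP[i Aii].
have Ai0 : 0 < A i i.
  by rewrite lt_neqAle eq_sym Aii -bform_delta; case: pA => _; exact.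
(* A Cholesky step: [outer c] has the same row and column [i] as [A]. The Schur complement
   [A - outer c] stays positive semidefinite by Cauchy-Schwarz against [delta_mx i 0]; it loses the
   diagonal entry [i] and keeps the zero ones. *)
pose c := (Num.sqrt (A i i))^-1 *: col i A.
have cE v : (v^T *m c) 0 0 = (Num.sqrt (A i i))^-1 * bform A v (delta_mx i 0).
  by rewrite /c -scalemxAr mxE colE mulmxA.
have sq : (Num.sqrt (A i i))^-1 ^+ 2 = (A i i)^-1 by rewrite exprVn sqr_sqrtr // ltW.
have pB : psd (A - outer c).
  split; first by rewrite linearB/= outer_sym; case: pA => ->.
  move=> v; rewrite mulmxBr mulmxBl mxE [X in _ + X]mxE subr_ge0.
  rewrite -/(bform (outer c) v v) -/(bform A v v) bform_outer cE -expr2 exprMn sq.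
  rewrite ler_pdivrMl// mulrC; have := psd_cauchy_schwarz v (delta_mx i 0) pA.
  by rewrite bform_delta.
have cc k : (A - outer c) k k = A k k - (A i i)^-1 * A k i ^+ 2.
  rewrite -[LHS]bform_delta /bform mulmxBr mulmxBl mxE [X in _ + X]mxE.
  rewrite -/(bform (outer c) _ _) -/(bform A _ _) bform_outer bform_delta cE.
  by rewrite bform_delta -expr2 exprMn sq.
have [|s sE] := IH (A - outer c) _ pB; last first.
  by exists (c :: s); rewrite big_cons -sE addrC subrK.
apply: leq_trans An; apply/proper_card/properP; split.
  apply/fintype.subsetP => k; rewrite !inE cc; apply: contra_neq => k0.
  by rewrite k0 (diag0 k i k0) expr0n mulr0 subr0.
exists i; rewrite inE; first exact: Aii.
by rewrite cc negbK; apply/eqP; field.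
Qed.

End psd_factorization.

(** * Lipschitz maps, and column vectors under the max norm *)

Lemma near_normB_lt {R : realType} {V : normedModType R} (x : V) (e : R) :
  0 < e -> \forall w \near x, `|x - w| < e.
Proof. by move=> e0; exact: (nbhs_ball_norm x (PosNum e0)). Qed.

Lemma lipschitz_continuous {R : realType} {V W : normedModType R} (f : V -> W)
  (C : R) : (forall x y, `|f x - f y| <= C * `|x - y|) -> continuous f.
Proof.
move=> fC v; apply/cvgrPdist_lt => e e0.
have C0 : 0 < `|C| + 1 by rewrite ltr_wpDl.
near=> w; apply: le_lt_trans (fC _ _) _.
have vw : `|v - w| < e / (`|C| + 1).
  by near: w; apply: near_normB_lt; exact: divr_gt0.
rewrite ltr_pdivlMr // mulrC in vw; apply: le_lt_trans vw.
by rewrite ler_wpM2r // (le_trans (ler_norm _)) // lerDl.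
Unshelve. all: by end_near.
Qed.

Section column_vectors.
Context {R : realType} {d : nat}.
Implicit Types (t v : 'cV[R]_d).

Definition dot t v : R := (t^T *m v) 0 0.

Lemma dotE t v : dot t v = \sum_i t i 0 * v i 0.
Proof. by rewrite /dot mxE; apply: eq_bigr => i _; rewrite mxE. Qed.

Lemma dotDl t u v : dot (t + u) v = dot t v + dot u v.
Proof. by rewrite /dot linearD/= mulmxDl mxE. Qed.

Lemma dotDr t u v : dot t (u + v) = dot t u + dot t v.
Proof. by rewrite /dot mulmxDr mxE. Qed.

Lemma dotZl a t v : dot (a *: t) v = a * dot t v.
Proof. by rewrite /dot linearZ/= -scalemxAl mxE. Qed.

Lemma dotZr a t v : dot t (a *: v) = a * dot t v.
Proof. by rewrite /dot -scalemxAr mxE. Qed.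

Lemma dotNl t v : dot (- t) v = - dot t v.
Proof. by rewrite -scaleN1r dotZl mulN1r. Qed.

Lemma dotNr t v : dot t (- v) = - dot t v.
Proof. by rewrite -scaleN1r dotZr mulN1r. Qed.

Lemma dot0r t : dot t 0 = 0.
Proof. by rewrite /dot mulmx0 mxE. Qed.

Lemma dot_delta i v : dot (delta_mx i 0) v = v i 0.
Proof. by rewrite /dot trmx_delta -rowE mxE. Qed.

Lemma cV_norm_le v (L : R) : 0 <= L -> (`|v| <= L) = [forall i, `|v i 0| <= L].
Proof.
move=> L0; rewrite {1}/Num.norm /= mx_normrE; apply/idP/forallP => [/bigmax_leP[_ h] i|h].
  exact: (h (i, 0)).
by apply/bigmax_leP; split=> // -[i j] _ /=; rewrite (ord1 j).
Qed.

Lemma coord_le_norm v i : `|v i 0| <= `|v|.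
Proof. by have := lexx `|v|; rewrite cV_norm_le // => /forallP. Qed.

Lemma dot_le t v : `|dot t v| <= (\sum_i `|t i 0|) * `|v|.
Proof.
rewrite dotE; apply: le_trans (ler_norm_sum _ _ _) _.
rewrite mulr_suml; apply: ler_sum => i _.
by rewrite normrM ler_wpM2l // coord_le_norm.
Qed.

(** For [0 <= L] the ball is the image of a product of segments of row vectors under transposition,
    which is 1-Lipschitz; otherwise it is empty. *)
Lemma compact_cball (L : R) : compact [set v : 'cV[R]_d | `|v| <= L].
Proof.
have cB : compact [set v : 'rV[R]_d | forall i, v ord0 i \in `[(- L), L]].
  apply: (@rV_compact _ _ (fun=> `[(- L), L]%classic)).
  by move=> _; exact: segment_compact.
have cT : continuous (trmx : 'rV[R]_d -> 'cV[R]_d).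
  apply: (@lipschitz_continuous R _ _ _ 1) => v w.
  rewrite mul1r -linearB/= cV_norm_le //; apply/forallP => i.
  rewrite mxE [leRHS]/Num.norm /= mx_normrE.
  by apply/bigmax_geP; right; exists (0, i).
have := continuous_compact (continuous_subspaceT cT) cB.
have [L0|L0] := leP 0 L; last first.
  move=> _; rewrite (_ : mkset _ = set0); first exact: compact0.
  by rewrite -subset0 => v /= h; have := le_lt_trans (le_trans (normr_ge0 v) h) L0; rewrite ltxx.
congr compact; apply/seteqP; split => v /=.
  move=> [w hw <-]; rewrite cV_norm_le //; apply/forallP => i.
  by rewrite mxE; have := hw i; rewrite in_itv/= ler_norml.
rewrite cV_norm_le // => /forallP h; exists v^T; last by rewrite trmxK.
by move=> i; rewrite mxE in_itv/= -ler_norml.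
Qed.

End column_vectors.

(** * From local properties to compact sets *)

Section compact_induction.
Context {T : ptopologicalType}.

(** Finitely many of the local neighbourhoods cover [K], and [P] passes to their union, then to the
    subset [K]. Both extractions of a finite subcover in the Stone-Weierstrass argument take this
    form. *)
Lemma compact_ind (P : set T -> Prop) (K : set T) : compact K ->
  P set0 -> (forall A B, P A -> P B -> P (A `|` B)) ->
  (forall A B, A `<=` B -> P B -> P A) ->
  (forall x, K x -> exists2 U, nbhs x U & P U) -> P K.
Proof.
rewrite compact_cover => cK P0 PU PS loc.
have /choice[V hV] : forall x, exists U : set T, K x -> open_nbhs x U /\ P U.
  move=> x; have [Kx|nKx] := pselect (K x); last by exists set0.
  have [U + PU'] := loc _ Kx; rewrite nbhsE => -[W oW WU].
  by exists W => _; split=> //; exact: PS WU PU'.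
have [|x Kx|D sD KD] := cK T K V; first by move=> x /hV[[]].
  by exists x => //; have [[]] := hV _ Kx.
apply: (PS _ _ KD).
have : forall x, x \in D -> P (V x) by move=> x xD; have /set_mem/hV[] := sD _ xD.
suff H (s : seq T) : (forall x, x \in s -> P (V x)) ->
    P (\bigcup_(i in [set` s]) V i) by exact: (H D).
elim: s => [|a s IH] h; first by apply: (PS _ set0) => // x [i /=]; rewrite inE.
apply: (PS _ (V a `|` \bigcup_(i in [set` s]) V i)).
  move=> x [i /=]; rewrite inE => /predU1P[->|si] Vi; first by left.
  by right; exists i.
apply: PU; first by apply: h; rewrite mem_head.
by apply: IH => x xs; apply: h; rewrite inE xs orbT.
Qed.

End compact_induction.

(** * The algebra of trigonometric polynomials *)

Section trigonometric_algebra.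
Context {R : realType} {d : nat}.
Implicit Types (t v : 'cV[R]_d) (f g : 'cV[R]_d -> R).

(** Products are left out of the constructors and recovered from the product-to-sum formulas.
    Convergence of integrals, which is linear but not multiplicative, can then be proved by
    induction on this predicate. *)
Inductive trig : ('cV[R]_d -> R) -> Prop :=
| trig_cos t : trig (fun v => cos (dot t v))
| trig_sin t : trig (fun v => sin (dot t v))
| trig_lin a b f g : trig f -> trig g -> trig (fun v => a * f v + b * g v).

Lemma eq_trig f g : trig f -> f =1 g -> trig g.
Proof. by move=> tf /funext <-. Qed.

Lemma trig_cst c : trig (fun=> c).
Proof.
apply: eq_trig (trig_lin c 0 (trig_cos 0) (trig_cos 0)) _ => v.
by rewrite mul0r addr0 /dot trmx0 mul0mx mxE cos0 mulr1.
Qed.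

Lemma trigZ c f : trig f -> trig (fun v => c * f v).
Proof.
move=> tf; apply: eq_trig (trig_lin c 0 tf tf) _ => v.
by rewrite mul0r addr0.
Qed.

Lemma trigD f g : trig f -> trig g -> trig (fun v => f v + g v).
Proof.
move=> tf tg; apply: eq_trig (trig_lin 1 1 tf tg) _ => v.
by rewrite !mul1r.
Qed.

Let trigM_basic f : trig f -> forall t,
  trig (fun v => f v * cos (dot t v)) /\ trig (fun v => f v * sin (dot t v)).
Proof.
elim=> {f} [s|s|a b f g _ IHf _ IHg] t.
- split.
  + apply: eq_trig (trig_lin 2^-1 2^-1 (trig_cos (s + t)) (trig_cos (s - t))) _ => v; rewrite !dotDl dotNl cosD cosB; by field.
  + apply: eq_trig (trig_lin 2^-1 (- 2^-1) (trig_sin (s + t)) (trig_sin (s - t))) _ => v; rewrite !dotDl dotNl sinD sinB; by field.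
- split.
  + apply: eq_trig (trig_lin 2^-1 2^-1 (trig_sin (s + t)) (trig_sin (s - t))) _ => v; rewrite !dotDl dotNl sinD sinB; by field.
  + apply: eq_trig (trig_lin (- 2^-1) 2^-1 (trig_cos (s + t)) (trig_cos (s - t))) _ => v; rewrite !dotDl dotNl cosD cosB; by field.
- have [fc fs] := IHf t; have [gc gs] := IHg t; split.
  + apply: eq_trig (trig_lin a b fc gc) _ => v; ring.
  + apply: eq_trig (trig_lin a b fs gs) _ => v; ring.
Qed.

Lemma trigM f g : trig f -> trig g -> trig (fun v => f v * g v).
Proof.
move=> tf; elim=> {g} [t|t|a b g h _ IHg _ IHh].
- exact: (trigM_basic tf t).1.
- exact: (trigM_basic tf t).2.
- apply: eq_trig (trig_lin a b IHg IHh) _ => v; ring.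
Qed.

Lemma trig_bounded f : trig f -> exists K : R, forall v, `|f v| <= K.
Proof.
elim=> {f} [t|t|a b f g _ [K fK] _ [L gL]].
- by exists 1 => v; exact: cos_max.
- by exists 1 => v; exact: sin_max.
- exists (`|a| * K + `|b| * L) => v; apply: le_trans (ler_normD _ _) _.
  by rewrite !normrM lerD // ler_wpM2l.
Qed.

End trigonometric_algebra.

(** * Mean value bounds for sine and cosine *)

Section sin_cos_bounds.
Context {R : realType}.

Lemma mean_value (f df : R -> R) (a b : R) : (forall x : R, is_derive x 1 f (df x)) ->
  exists c, f b - f a = df c * (b - a) /\ Num.min a b <= c <= Num.max a b.
Proof.
move=> Df.
have cf : forall A, {within A, continuous f}.
  by move=> A; apply: continuous_subspaceT => x; apply/differentiable_continuous/derivable1_diffP; case: (Df x).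
wlog ab : a b / a <= b.
  move=> h; have [ab|ba] := orP (le_total a b); first exact: h.
  have [c [e1 e2]] := h _ _ ba; exists c; rewrite minC maxC; split => //; lra.
have [c + ce] := MVT_segment ab (fun x _ => Df x) (cf _).
by rewrite in_itv/= => hc; exists c; rewrite ce min_l // max_r.
Qed.

Lemma abs_sin_le (x : R) : `|sin x| <= `|x|.
Proof.
have [c [+ _]] := mean_value 0 x (fun x => is_derive_sin x).
rewrite sin0 !subr0 => ->; rewrite normrM ler_piMl // cos_max //.
Qed.

Lemma sinB_le (x y : R) : `|sin x - sin y| <= `|x - y|.
Proof.
have [c [-> _]] := mean_value y x (fun x => is_derive_sin x).
by rewrite normrM ler_piMl // cos_max.
Qed.

Lemma cosB_le (x y : R) : `|cos x - cos y| <= `|x - y|.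
Proof.
have [c [-> _]] := mean_value y x (fun x => is_derive_cos x).
by rewrite normrM normrN ler_piMl // sin_max.
Qed.

End sin_cos_bounds.

(** * Uniform limits of trigonometric polynomials form a lattice *)

Section uniform_closure.
Context {R : realType} {d : nat}.
Implicit Types (t v : 'cV[R]_d) (f g h : 'cV[R]_d -> R).

Lemma trig_lipschitz f : trig f -> exists C : R, forall v w, `|f v - f w| <= C * `|v - w|.
Proof.
elim=> {f} [t|t|a b f g _ [K fK] _ [L gL]].
- exists (\sum_i `|t i 0|) => v w; apply: le_trans (cosB_le _ _) _.
  by rewrite -dotNr -dotDr dot_le.
- exists (\sum_i `|t i 0|) => v w; apply: le_trans (sinB_le _ _) _.
  by rewrite -dotNr -dotDr dot_le.
- exists (`|a| * K + `|b| * L) => v w.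
  have -> : a * f v + b * g v - (a * f w + b * g w) =
    a * (f v - f w) + b * (g v - g w) by ring.
  apply: le_trans (ler_normD _ _) _; rewrite !normrM mulrDl -!mulrA.
  by rewrite lerD // ler_wpM2l.
Qed.

Lemma trig_continuous f : trig f -> continuous f.
Proof. by move=> /trig_lipschitz[C]; exact: lipschitz_continuous. Qed.

(** These are the almost periodic functions. Uniformity over the whole space, not only over compact
    sets, keeps them bounded, which the closure under products and absolute values relies on. *)
Definition utrig f := forall e : R, 0 < e ->
  exists2 h, trig h & forall v, `|f v - h v| <= e.

Lemma eq_utrig f g : utrig f -> f =1 g -> utrig g.
Proof. by move=> tf /funext <-. Qed.

Lemma trig_utrig f : trig f -> utrig f.
Proof. by move=> tf e e0; exists f => // v; rewrite subrr normr0 ltW. Qed.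

Lemma utrig_closed f :
  (forall e : R, 0 < e -> exists2 h, utrig h & forall v, `|f v - h v| <= e) -> utrig f.
Proof.
move=> H e e0; have e2 : 0 < e / 2 by rewrite divr_gt0.
have [h uh fh] := H _ e2; have [k tk hk] := uh _ e2; exists k => // v.
by rewrite (splitr e) (le_trans (ler_distD (h v) _ _)) // lerD.
Qed.

Lemma utrig_bounded f : utrig f -> exists2 K : R, 0 < K & forall v, `|f v| <= K.
Proof.
move=> /(_ _ ltr01)[h th fh]; have [K hK] := trig_bounded th.
exists (`|K| + 1); first by rewrite ltr_wpDl.
move=> v; rewrite -[f v](subrK (h v)); apply: le_trans (ler_normD _ _) _.
by rewrite addrC lerD // (le_trans (hK v)) // ler_norm.
Qed.

Lemma utrig_continuous f : utrig f -> continuous f.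
Proof.
move=> uf v; apply/(@cvgrPdist_lt _ _ _ (nbhs v)) => e e0.
have e4 : 0 < e / 4 by rewrite divr_gt0.
have [h th fh] := uf _ e4; near=> w.
have hw : `|h v - h w| < e / 4.
  by near: w; apply: (@cvgr_dist_lt _ _ _ (nbhs v)) => //; exact: trig_continuous.
have -> : f v - f w = (f v - h v) + (h v - h w) - (f w - h w) by ring.
apply: le_lt_trans (ler_normB _ _) _; apply: le_lt_trans (lerD (ler_normD _ _) (lexx _)) _.
have := fh v; have := fh w; lra.
Unshelve. all: by end_near.
Qed.

Lemma utrigZ c f : utrig f -> utrig (fun v => c * f v).
Proof.
move=> uf e e0; have c0 : 0 < `|c| + 1 by rewrite ltr_wpDl.
have [h th fh] := uf (e / (`|c| + 1)) ltac:(exact: divr_gt0).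
exists (fun v => c * h v); first exact: trigZ.
move=> v; rewrite -mulrBr normrM; have := fh v; rewrite ler_pdivlMr // mulrC => h1.
by apply: le_trans h1; rewrite ler_wpM2r // lerDl.
Qed.

Lemma utrigD f g : utrig f -> utrig g -> utrig (fun v => f v + g v).
Proof.
move=> uf ug e e0; have e2 : 0 < e / 2 by rewrite divr_gt0.
have [h th fh] := uf _ e2; have [k tk gk] := ug _ e2.
exists (fun v => h v + k v); first exact: trigD.
move=> v; have -> : f v + g v - (h v + k v) = (f v - h v) + (g v - k v) by ring.
by rewrite (splitr e) (le_trans (ler_normD _ _)) // lerD.
Qed.

Lemma utrigM f g : utrig f -> utrig g -> utrig (fun v => f v * g v).
Proof.
move=> uf ug e e0; have [K K0 fK] := utrig_bounded uf.
have [k tk gk] := ug (e / 2 / K) ltac:(by rewrite !divr_gt0).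
have [L' kL'] := trig_bounded tk.
have L0 : 0 < `|L'| + 1 by rewrite ltr_wpDl.
have [h th fh] := uf (e / 2 / (`|L'| + 1)) ltac:(by rewrite !divr_gt0).
exists (fun v => h v * k v); first exact: trigM.
move=> v; have -> : f v * g v - h v * k v = f v * (g v - k v) + (f v - h v) * k v by ring.
rewrite (splitr e) (le_trans (ler_normD _ _)) // !normrM lerD //.
  have := gk v; rewrite ler_pdivlMr // mulrC; apply: le_trans.
  by rewrite ler_wpM2r.
have := fh v; rewrite ler_pdivlMr //; apply: le_trans.
by rewrite ler_wpM2l // (le_trans (kL' v)) // (le_trans (ler_norm _)) // lerDl.
Qed.

(* Newton-like iteration p <- p + (x^2 - p^2) / 2, which increases to |x|. *)
Fixpoint abs_approx (n : nat) (x : R) : R :=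
  if n is k.+1 then
    let p := abs_approx k x in p + (x ^+ 2 - p ^+ 2) / 2
  else 0.

(** Turns a geometric factor into a rate that is uniform down to [x = 0]: with [b] equal to half of
    [|x|], it bounds [|x| (1 - |x| / 2)^n] by [2 / (n + 1)]. *)
Lemma bernoulli_inv (b : R) n : 0 <= b <= 1 -> (1 + n%:R * b) * (1 - b) ^+ n <= 1.
Proof.
move=> /andP[b0 b1]; elim: n => [|n IH]; first by rewrite mul0r addr0 mul1r expr0.
apply: le_trans IH; rewrite exprS mulrA ler_wpM2r ?exprn_ge0 ?subr_ge0 //.
have : 0 <= n.+1%:R * b ^+ 2 by rewrite mulr_ge0 // sqr_ge0.
by rewrite -[n.+1%:R]natr1; nra.
Qed.

(** One step multiplies the error [|x| - p] by [1 - (|x| + p) / 2], which lies between 0 and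
    [1 - |x| / 2] as long as [0 <= p <= |x| <= 1]. *)
Lemma abs_approxP (x : R) n : `|x| <= 1 ->
  0 <= abs_approx n x <= `|x| /\ `|x| - abs_approx n x <= 2 / n.+1%:R.
Proof.
move=> x1; have x0 := normr_ge0 x.
suff [h1 h2] : 0 <= abs_approx n x <= `|x| /\
    `|x| - abs_approx n x <= `|x| * (1 - `|x| / 2) ^+ n.
  split=> //; apply: le_trans h2 _; rewrite ler_pdivlMr //.
  have b01 : 0 <= `|x| / 2 <= 1 by lra.
  have := bernoulli_inv n b01; have : 0 <= (1 - `|x| / 2) ^+ n.
    by rewrite exprn_ge0 // subr_ge0; case/andP: b01.
  set p := _ ^+ n => p0 h; rewrite -natr1; nra.
elim: n => [|n [/andP[p0 px] IH]] /=.
  by rewrite x0 lexx subr0 expr0 mulr1.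
set p := abs_approx n x in p0 px IH *; rewrite -(@real_normK _ x) ?num_real //.
split.
  by apply/andP; split; nra.
rewrite [(1 - _) ^+ n.+1]exprS; set q := _ ^+ n in IH *.
have -> : `|x| - (p + (`|x| ^+ 2 - p ^+ 2) / 2) = (`|x| - p) * (1 - (`|x| + p) / 2) by field.
rewrite [leLHS]mulrC [leRHS]mulrCA; apply: ler_pM => //; lra.
Qed.

Lemma utrig_abs f : utrig f -> utrig (fun v => `|f v|).
Proof.
move=> uf; have [K K0 fK] := utrig_bounded uf.
(* The iteration converges on [-1, 1], so the function is first divided by a bound. Each iterate is
   then a polynomial in it, hence still in the class. *)
suff : utrig (fun v => `|K^-1 * f v|).
  move=> /(utrigZ K) u; apply: eq_utrig u _ => v.
  by rewrite normrM (gtr0_norm (x := K^-1)) ?invr_gt0 // mulVKf // gt_eqF.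
pose g v := K^-1 * f v; have ug : utrig g := utrigZ K^-1 uf.
have gle v : `|g v| <= 1.
  by rewrite normrM (gtr0_norm (x := K^-1)) ?invr_gt0 // ler_pdivrMl // mulr1.
rewrite -[fun v => _]/(fun v => `|g v|).
move: g ug gle => g ug gle; apply: utrig_closed => e e0.
have [n ne] : exists n : nat, 2 / n.+1%:R <= e.
  exists (Num.bound (2 / e)); rewrite ler_pdivrMr // mulrC -ler_pdivrMr //.
  have /ltW/le_trans := archi_boundP (ltW (divr_gt0 (ltr0n R 2) e0)).
  by apply; rewrite ler_nat.
exists (fun v => abs_approx n (g v)); last first.
  move=> v; have [/andP[_ h1] h2] := abs_approxP n (gle v).
  by rewrite ger0_norm ?subr_ge0 // (le_trans h2).
elim: n {ne} => [|n IH] /=; first exact/trig_utrig/trig_cst.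
have u2 := utrigM ug ug; have p2 := utrigZ (-1) (utrigM IH IH).
apply: eq_utrig (utrigD IH (utrigZ 2^-1 (utrigD u2 p2))) _ => v; lra.
Qed.

Lemma utrig_max f g : utrig f -> utrig g -> utrig (fun v => Num.max (f v) (g v)).
Proof.
move=> uf ug; have ua := utrig_abs (utrigD uf (utrigZ (-1) ug)).
apply: eq_utrig (utrigZ 2^-1 (utrigD (utrigD uf ug) ua)) _ => v.
by rewrite mulN1r maxr_absE mulrC.
Qed.

Lemma utrig_min f g : utrig f -> utrig g -> utrig (fun v => Num.min (f v) (g v)).
Proof.
move=> uf ug; have ua := utrig_abs (utrigD uf (utrigZ (-1) ug)).
apply: eq_utrig (utrigZ 2^-1 (utrigD (utrigD uf ug) (utrigZ (-1) ua))) _ => v.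
by rewrite !mulN1r minr_absE mulrC.
Qed.

Lemma trig_interpolation (a b : 'cV[R]_d) (x y : R) : (a = b -> x = y) ->
  exists2 f, trig f & f a = x /\ f b = y.
Proof.
move=> xy; have [ab|ab] := eqVneq a b.
  by exists (fun=> x); [exact: trig_cst|rewrite xy].
have [i abi] : exists i, b i 0 - a i 0 != 0.
  apply/not_existsP => h; move/eqP: ab; apply; apply/colP => i.
  by apply/eqP; rewrite eq_sym -subr_eq0; apply: contraT => /h.
(* The phase of [s] is 0 at [a] and 1 at [b], so that [s] takes the values 0 and sin 1, which is
   positive since 1 lies between 0 and 2. *)
pose u := (b i 0 - a i 0)^-1; pose s v : R := sin (u * (v i 0 - a i 0)).
have ts : trig s.
  have := trigD (trigZ (cos (u * a i 0)) (trig_sin (u *: delta_mx i 0)))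
    (trigZ (- sin (u * a i 0)) (trig_cos (u *: delta_mx i 0))).
  move/eq_trig; apply=> v; rewrite dotZl dot_delta /s mulrBr sinB; ring.
have sb : s b != 0 by rewrite /s mulVf // gt_eqF // sin2_gt0 // ltr01 /= ltr1n.
have sa : s a = 0 by rewrite /s subrr mulr0 sin0.
exists (fun v => x + (y - x) / s b * s v).
  by apply: trigD; [exact: trig_cst|exact: trigZ].
by rewrite sa mulr0 addr0 divfK // addrC subrK.
Qed.

End uniform_closure.

(** * Stone-Weierstrass approximation on compact sets *)

Lemma near_lt {R : realType} {T : topologicalType} (f g : T -> R) (x : T) :
  continuous f -> continuous g -> f x < g x -> \forall v \near x, f v < g v.
Proof.
move=> cf cg fg.
have c : (fun v => f v - g v) @ x --> f x - g x by apply: cvgB; [exact: cf|exact: cg].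
have := cvgr_lt _ c 0; rewrite subr_lt0 => /(_ _ fg); apply: filterS => v.
by rewrite subr_lt0.
Qed.

Lemma continuous_addr {R : realType} {T : topologicalType} (f : T -> R) (c : R) :
  continuous f -> continuous (fun v => f v + c).
Proof. by move=> cf v; apply: cvgD; [exact: cf|exact: cvg_cst]. Qed.

Section stone_weierstrass.
Context {R : realType} {d : nat}.
Implicit Types (v : 'cV[R]_d) (f g h : 'cV[R]_d -> R).

(** For fixed [a], finite minima of functions interpolating [g] at [a] and at a second point give a
    function that stays below [g + e] on [K] and agrees with [g] at [a]. Finite maxima of these,
    over varying [a], stay below [g + e] and also exceed [g - e] on [K]. *)
Lemma stone_weierstrass g (K : set 'cV[R]_d) (e : R) : continuous g -> compact K ->
  0 < e -> exists2 f, utrig f & forall v, K v -> `|f v - g v| <= e.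
Proof.
move=> cg cK e0.
have [K0|[a0 Ka0]] : K = set0 \/ K !=set0.
  by have [->|/set0P] := eqVneq K set0; [left|right].
  by exists (fun=> 0); [exact/trig_utrig/trig_cst|rewrite K0].
have above a : exists f, [/\ utrig f, f a = g a & forall v, K v -> f v < g v + e].
  pose Q (A : set _) := exists f, [/\ utrig f, f a = g a & forall v, A v -> f v < g v + e].
  apply: (@compact_ind _ Q K cK).
  - by exists (fun=> g a); split=> //; exact/trig_utrig/trig_cst.
  - move=> A B [f [uf fa fA]] [h [uh ha hB]].
    exists (fun v => Num.min (f v) (h v)); split; first exact: utrig_min.
      by rewrite fa ha minxx.
    by move=> v [/fA|/hB] lt; rewrite gt_min lt ?orbT.
  - by move=> A B AB [f [uf fa fB]]; exists f; split=> // v /AB; exact: fB.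
  - move=> x Kx; have [f tf [fa fx]] := @trig_interpolation R d a x (g a) (g x) (@congr1 _ _ g a x).
    exists [set v | f v < g v + e]; last by exists f; split=> //; exact: trig_utrig.
    apply: (near_lt (f := f) (g := fun v => g v + e)); first exact: trig_continuous.
      exact: continuous_addr.
    by rewrite fx ltrDl.
pose Q (A : set _) := exists f, [/\ utrig f, forall v, K v -> f v < g v + e &
  forall v, A v -> g v - e < f v].
suff [f [uf f1 f2]] : Q K.
  exists f => // v Kv; rewrite ler_norml; have := f1 _ Kv; have := f2 _ Kv; lra.
apply: (@compact_ind _ Q K cK).
- by have [f [uf _ fK]] := above a0; exists f; split.
- move=> A B [f [uf fK fA]] [h [uh hK hB]].
  exists (fun v => Num.max (f v) (h v)); split; first exact: utrig_max.
    by move=> v Kv; rewrite gt_max fK // hK.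
  by move=> v [/fA|/hB] lt; rewrite lt_max lt ?orbT.
- by move=> A B AB [f [uf fa fB]]; exists f; split=> // v /AB; exact: fB.
- move=> x Kx; have [f [uf fx fK]] := above x.
  exists [set v | g v - e < f v]; last by exists f; split.
  apply: (near_lt (f := fun v => g v - e) (g := f)); [|exact: utrig_continuous|by rewrite fx ltrBlDr ltrDl].
  exact: continuous_addr.
Qed.

Lemma trig_approx g (L e : R) : continuous g -> 0 < e ->
  exists2 h, trig h & forall v, `|v| <= L -> `|h v - g v| <= e.
Proof.
move=> cg e0; have e2 : 0 < e / 2 by rewrite divr_gt0.
have [f uf fg] := stone_weierstrass cg (@compact_cball _ _ L) e2.
have [h th fh] := uf _ e2; exists h => // v vL.
have := fg _ vL; have := fh v; rewrite !ler_norml; lra.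
Qed.

(** Closeness on a ball leaves the approximant uncontrolled outside, where some probability remains.
    Clipping between [- M] and [M] stays inside the lattice; half of [e] is kept for the passage
    from the clipped function to a trigonometric polynomial. *)
Lemma trig_approx_bounded g (M L e : R) : continuous g ->
  (forall v, `|g v| <= M) -> 0 < e ->
  exists h, [/\ trig h, forall v, `|v| <= L -> `|h v - g v| <= e &
    forall v, `|h v| <= M + e].
Proof.
move=> cg gM e0; have e2 : 0 < e / 2 by rewrite divr_gt0.
have [f uf fg] := stone_weierstrass cg (@compact_cball _ _ L) e2.
have ucst c : utrig (fun _ : 'cV[R]_d => c) by exact/trig_utrig/trig_cst.
have [h th fh] := utrig_max (ucst (- M)) (utrig_min (ucst M) uf) e2.
have M0 : 0 <= M by exact: le_trans (normr_ge0 _) (gM 0).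
exists h; split=> // v => [vL|]; have := fh v; last first.
  case: (leP M (f v)) => h1; case: (leP (- M) _) => h2; rewrite !ler_norml; lra.
have := gM v; have := fg _ vL.
case: (leP M (f v)) => h1; case: (leP (- M) _) => h2; rewrite !ler_norml; lra.
Qed.

End stone_weierstrass.

(** * Measurability of functions of a random vector *)

Section measurability.
Context {R : realType} {d : nat} {dO} {Omega : measurableType dO}.
Implicit Types (W : Omega -> 'cV[R]_d).

Lemma measurable_dot W t : random_vector W ->
  measurable_fun setT (fun w => dot t (W w)).
Proof.
move=> mW; under eq_fun do rewrite dotE.
by apply: measurable_sum => i; apply: measurable_funM.
Qed.

Lemma measurable_trig W h : random_vector W -> trig h -> measurable_fun setT (h \o W).
Proof.
move=> mW; elim=> {h} [t|t|a b f g _ mf _ mg].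
- apply: (measurableT_comp (f := cos)); last exact: measurable_dot.
  by apply: continuous_measurable_fun; exact: continuous_cos.
- apply: (measurableT_comp (f := sin)); last exact: measurable_dot.
  by apply: continuous_measurable_fun; exact: continuous_sin.
- by apply: measurable_funD; apply: measurable_funM.
Qed.

(** [random_vector] speaks of coordinates only. A continuous [g] is the pointwise limit of
    trigonometric polynomials, the [n]-th one being within [1 / (n + 1)] of [g] on the ball of
    radius [n], and these are measurable through the scalar products. *)
Lemma measurable_continuous_comp W (g : 'cV[R]_d -> R) : random_vector W ->
  continuous g -> measurable_fun setT (g \o W).
Proof.
move=> mW cg.
have /choice[h hP] : forall n : nat, exists h : 'cV[R]_d -> R, trig h /\
    forall v, `|v| <= n%:R -> `|h v - g v| <= n.+1%:R^-1.
  move=> n; have [//|h th hg] := @trig_approx R d g n%:R n.+1%:R^-1 cg.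
  by exists h.
apply: (@measurable_fun_cvg _ _ _ _ (fun n => h n \o W)).
  by move=> n; apply: measurable_trig => //; exact: (hP n).1.
move=> w _; apply/cvgrPdist_lt => e e0; near=> n; rewrite distrC.
apply: le_lt_trans ((hP n).2 _ _) _; last first.
  by near: n; exact: near_infty_natSinv_lt (PosNum e0).
near: n; exact: nbhs_infty_ger.
Unshelve. all: by end_near.
Qed.

Lemma measurable_norm W : random_vector W -> measurable_fun setT (fun w => `|W w|).
Proof. by move=> mW; apply: (measurable_continuous_comp mW); exact: norm_continuous. Qed.

End measurability.

(** * Integrals and tails under a probability *)

Section probability_integrals.
Context {R : realType} {dT} {T : measurableType dT} (P : probability T R).
Implicit Types (f g : T -> R).

Lemma integrable_bounded f (K : R) : measurable_fun setT f -> (forall x, `|f x| <= K) ->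
  P.-integrable setT (EFin \o f).
Proof.
move=> mf fK; apply: measurable_bounded_integrable => //.
  exact: fin_num_fun_lty (@fin_num_measure _ _ _ P).
exists K; split; first by rewrite num_real.
by move=> M KM x _; exact: le_trans (fK x) (ltW KM).
Qed.

Lemma Rintegral_indic A : measurable A -> \int[P]_w \1_A w = fine (P A).
Proof. by move=> mA; rewrite /Rintegral integral_indic // setIT. Qed.

Lemma Rintegral_prob_cst (c : R) : \int[P]_w c = c.
Proof. by rewrite Rintegral_cst //= probability_setT mulr1. Qed.

(** The events [n < X] decrease to the empty set, and [P] is continuous from above. *)
Lemma tail_small (X : T -> R) (e : R) : measurable_fun setT X -> 0 < e ->
  exists2 L, 0 <= L & (P [set w | (L < X w)%R] <= e%:E)%E.
Proof.
move=> mX e0; pose F (n : nat) := [set w | n%:R < X w].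
have mF n : measurable (F n).
  rewrite -[F n]setTI; have -> : F n = X @^-1` `]n%:R, +oo[%classic.
    by apply/seteqP; split=> w; rewrite /F /= in_itv/= andbT.
  exact: mX.
have F0 : \bigcap_n F n = set0.
  rewrite -subset0 => w /(_ (Num.bound (X w)) I) /=.
  have := archi_boundP (normr_ge0 (X w)).
  rewrite /F /= => h1 h2.
  have [X0|X0] := leP 0 (X w).
    by have := lt_trans h2 (archi_boundP X0); rewrite ltxx.
  by have := lt_trans h2 X0; rewrite ltNge ler0n.
have : P \o F @ \oo --> P (\bigcap_n F n).
  apply: nonincreasing_cvg_mu => //.
  - by rewrite (le_lt_trans (probability_le1 _ _)) // ltry.
  - by rewrite F0.
  - move=> n k nk; apply/subsetPset => w /=; apply: le_lt_trans.
    by rewrite ler_nat.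
rewrite F0 measure0 => /fine_cvgP[_ /cvgrPdist_lt /(_ e e0)[N _ /(_ N (leqnn N))]] /= h.
exists N%:R => //; rewrite -/(F N) -[P _]fineK ?fin_num_measure // lee_fin.
by apply: le_trans (ltW h); rewrite sub0r normrN ler_norm.
Qed.

End probability_integrals.

(** * The continuity theorem for characteristic functions *)

Section convergence_in_distribution.
Context {R : realType} {d : nat}.
Implicit Types (f g h : 'cV[R]_d -> R).

Lemma measurable_tail {dT} {T : measurableType dT} (W : T -> 'cV[R]_d) (L : R) :
  random_vector W -> measurable [set w | L < `|W w|].
Proof.
move=> mW; rewrite -[X in measurable X]setTI.
have -> : [set w | L < `|W w|] = (fun w => `|W w|) @^-1` `]L, +oo[%classic.
  by apply/seteqP; split=> w; rewrite /= in_itv/= andbT.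
exact: measurable_norm.
Qed.

(** The two integrands differ by at most [e] off the tail event and by at most [2 * M + e] on it. As
    the tail has probability at most [e <= 1], the total is at most
    [e + (2 * M + e) * e <= (2 * M + 2) * e]. *)
Lemma integral_approx {dT} {T : measurableType dT} (P : probability T R)
    (W : T -> 'cV[R]_d) g h (M L e : R) : random_vector W ->
  continuous g -> trig h -> 0 <= e <= 1 ->
  (forall v, `|g v| <= M) -> (forall v, `|h v| <= M + e) ->
  (forall v, `|v| <= L -> `|h v - g v| <= e) ->
  (P [set w | (L < `|W w|)%R] <= e%:E)%E ->
  `|\int[P]_w g (W w) - \int[P]_w h (W w)| <= (2 * M + 2) * e.
Proof.
move=> mW cg th /andP[e0 e1] gM hM hg Pe.
have M0 : 0 <= M by exact: le_trans (normr_ge0 _) (gM 0).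
have mg := measurable_continuous_comp mW cg.
have mh := measurable_trig mW th.
have ig := integrable_bounded P mg (fun x => gM (W x)).
have ih := integrable_bounded P mh (fun x => hM (W x)).
rewrite -RintegralB //.
have iB := integrable_bounded P (K := M + (M + e)) (measurable_funB mg mh)
  (fun x => le_trans (ler_normB _ _) (lerD (gM _) (hM _))).
apply: le_trans (le_normr_Rintegral _ iB) _ => //.
pose A := [set w | L < `|W w|]; have mA : measurable A by exact: measurable_tail.
have m1 : measurable_fun setT (\1_A : T -> R) by exact: measurable_indic.
have i1 : P.-integrable setT (EFin \o (\1_A : T -> R)).
  by apply: (integrable_bounded _ (K := 1)) => // x; rewrite indicE; case: (_ \in _); rewrite ?normr1 ?normr0.
have i2 : P.-integrable setT (EFin \o (fun w => (2 * M + e) * (\1_A w : R))).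
  apply: (integrable_bounded _ (K := `|2 * M + e|)); first exact: measurable_funM.
  by move=> x; rewrite indicE; case: (_ \in _); rewrite ?mulr1 ?mulr0 ?normr0.
have ic : P.-integrable setT (EFin \o (fun w => e)).
  by apply: (integrable_bounded _ (K := `|e|)).
have i3 : P.-integrable setT (EFin \o (fun w => e + (2 * M + e) * (\1_A w : R))).
  exact: (integrableD measurableT ic i2).
apply: (@le_trans _ _ (\int[P]_w (e + (2 * M + e) * \1_A w))).
  apply: le_Rintegral => //.
    by have := integrable_abse iB; apply: eq_integrable.
  move=> w _; rewrite indicE; have [wA|wA] := boolP (w \in A).
    rewrite mulr1 (le_trans (ler_normB _ _)) // (le_trans (lerD (gM _) (hM _))) //.
    lra.
  rewrite mulr0 addr0 distrC hg // leNgt; apply: contra wA => wA.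
  exact: mem_set.
rewrite RintegralD // Rintegral_prob_cst RintegralZl // Rintegral_indic //.
have : fine (P A) <= e by rewrite -lee_fin fineK ?fin_num_measure.
have : 0 <= fine (P A) by rewrite fine_ge0.
set p := fine _ => p0 pe; nra.
Qed.

Context {dO} {Omega : measurableType dO} {P : probability Omega R}.
Context {dT} {T : measurableType dT} {Q : probability T R}.
Variables (W : nat -> Omega -> 'cV[R]_d) (Z : T -> 'cV[R]_d).
Hypotheses (mW : forall N, random_vector (W N)) (mZ : random_vector Z).
Hypothesis cvg_cos : forall t,
  \int[P]_w cos (dot t (W N w)) @[N --> \oo] --> \int[Q]_z cos (dot t (Z z)).
Hypothesis cvg_sin : forall t,
  \int[P]_w sin (dot t (W N w)) @[N --> \oo] --> \int[Q]_z sin (dot t (Z z)).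
Hypothesis tight : forall e : R, 0 < e ->
  exists L : R, \forall N \near \oo, (P [set w | (L < `|W N w|)%R] <= e%:E)%E.

Lemma cvg_trig h : trig h -> \int[P]_w h (W N w) @[N --> \oo] --> \int[Q]_z h (Z z).
Proof.
elim=> {h} // a b f g tf cf tg cg.
have [K fK] := trig_bounded tf; have [L gL] := trig_bounded tg.
have E dS (S : measurableType dS) (P' : probability S R) (V : S -> 'cV[R]_d) :
    random_vector V -> \int[P']_w (a * f (V w) + b * g (V w)) =
    a * (\int[P']_w f (V w)) + b * (\int[P']_w g (V w)).
  move=> mV; have mf := measurable_trig mV tf; have mg := measurable_trig mV tg.
  have if' : P'.-integrable setT (EFin \o (f \o V)) by exact: (integrable_bounded P' mf (fun x => fK (V x))).
  have ig' : P'.-integrable setT (EFin \o (g \o V)) by exact: (integrable_bounded P' mg (fun x => gL (V x))).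
  have ia : P'.-integrable setT (EFin \o (fun w => a * f (V w))).
    exact: (integrableZl measurableT a if').
  have ib : P'.-integrable setT (EFin \o (fun w => b * g (V w))).
    exact: (integrableZl measurableT b ig').
  by rewrite RintegralD // !RintegralZl.
under eq_fun do rewrite E //.
by rewrite E //; apply: cvgD; apply: cvgM => //; exact: cvg_cst.
Qed.

Theorem levy_continuity : cvg_in_distribution P W Q Z.
Proof.
move=> g cg [M0 gM0]; pose M := `|M0|.
have gM v : `|g v| <= M by exact: le_trans (gM0 v) (ler_norm _).
have M_ge0 : 0 <= M by exact: normr_ge0.
apply/cvgrPdist_lt => eps eps0.
pose C := 2 * M + 2; have C0 : 0 < C by rewrite /C; lra.
(* Replacing [g] by [h] costs [C * e <= eps / 4] under each of the two laws, and the convergence for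
   [h] costs another [eps / 4]. *)
pose e := Num.min 1 (eps / (4 * C)).
have e0 : 0 < e by rewrite lt_min ltr01 /= divr_gt0 // mulr_gt0.
have e1 : 0 <= e <= 1 by rewrite ltW //= ge_min lexx.
have eC : C * e <= eps / 4.
  have : e <= eps / (4 * C) by rewrite ge_min lexx orbT.
  rewrite ler_pdivlMr ?mulr_gt0 //; lra.
have [L1 tW] := tight e0.
have [L2 L20 tZ] := @tail_small _ _ _ Q _ e (measurable_norm mZ) e0.
pose L := Num.max L1 L2.
have [h [th hg hM]] := trig_approx_bounded L cg gM e0.
have tL dS (S : measurableType dS) (P' : probability S R) (V : S -> 'cV[R]_d) K :
  random_vector V -> K <= L -> (P' [set w | (K < `|V w|)%R] <= e%:E)%E ->
  (P' [set w | (L < `|V w|)%R] <= e%:E)%E.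
  move=> mV KL; apply: le_trans; apply: le_measure.
  - exact/mem_set/measurable_tail.
  - exact/mem_set/measurable_tail.
  - by move=> w /=; exact: le_lt_trans.
near=> N.
have hN : `|\int[Q]_z h (Z z) - \int[P]_w h (W N w)| < eps / 4.
  near: N; apply: (@cvgr_dist_lt _ _ _ _ _ _ _ (cvg_trig th)).
  by rewrite divr_gt0.
have aN := integral_approx (mW N) cg th e1 gM hM hg (tL _ _ P _ L1 (mW N) _ _).
have aZ := integral_approx mZ cg th e1 gM hM hg (tL _ _ Q _ L2 mZ _ _).
have {}aN : `|\int[P]_w g (W N w) - \int[P]_w h (W N w)| <= C * e.
  by apply: aN; [rewrite le_max lexx|near: N].
have {}aZ : `|\int[Q]_z g (Z z) - \int[Q]_z h (Z z)| <= C * e.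
  by apply: aZ; [rewrite le_max lexx orbT|].
move: aN aZ hN; rewrite !ler_norml !ltr_norml; lra.
Unshelve. all: by end_near.
Qed.

End convergence_in_distribution.

(** * Bundled measurable maps and dominated convergence *)

Definition mfun_of {d d'} {T : measurableType d} {S : measurableType d'}
  (f : T -> S) (mf : measurable_fun setT f) : {mfun T >-> S} :=
  MeasurableFun.Pack (MeasurableFun.Class (isMeasurableFun.Build _ _ _ _ f mf)).

Lemma dominated_cvg_Rintegral {R : realType} {d} {T : measurableType d}
    (mu : {measure set T -> \bar R}) (f_ : nat -> T -> R) (f g : T -> R) :
  (forall n, measurable_fun setT (f_ n)) -> mu.-integrable setT (EFin \o g) ->
  (forall x, f_ n x @[n --> \oo] --> f x) -> (forall n x, `|f_ n x| <= g x) ->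
  \int[mu]_x f_ n x @[n --> \oo] --> \int[mu]_x f x.
Proof.
move=> mf ig ff fg.
have emf n : measurable_fun setT (EFin \o f_ n) by exact/measurable_EFinP.
have mf' : measurable_fun setT f by exact: (measurable_fun_cvg (fun n => mf n)).
have [if' _ h] : [/\ mu.-integrable setT (EFin \o f),
    [sequence \int[mu]_x `|(f_ n x)%:E - (f x)%:E|]_n @ \oo --> 0%E &
    [sequence \int[mu]_x (f_ n x)%:E]_n @ \oo --> \int[mu]_x (f x)%:E]%E.
  apply: (@dominated_convergence _ _ _ mu setT measurableT _ _ (EFin \o g)) => //.
  - exact/measurable_EFinP.
  - by apply: aeW => x _; apply: cvg_EFin; [exact: nearW|exact: ff].
  - by apply: aeW => x n _; rewrite lee_fin.
by apply: fine_cvg; rewrite fineK //; exact: (integrable_fin_num measurableT if').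
Qed.

(** * Characteristic functions determine laws on the line *)

Section uniqueness.
Context {R : realType}.
Context {dO} {Omega : measurableType dO} {P : probability Omega R}.
Context {dT} {T : measurableType dT} {Q : probability T R}.
Variables (X : Omega -> R) (Y : T -> R).
Hypotheses (mX : measurable_fun setT X) (mY : measurable_fun setT Y).
Hypothesis eq_cos : forall t, \int[P]_w cos (t * X w) = \int[Q]_z cos (t * Y z).
Hypothesis eq_sin : forall t, \int[P]_w sin (t * X w) = \int[Q]_z sin (t * Y z).

Let embed (x : R) : 'cV[R]_1 := \col_i x.

Let dot_embed t x : dot t (embed x) = t 0 0 * x.
Proof. by rewrite dotE big_ord1 mxE. Qed.

(** The continuity theorem in dimension one, applied to a constant sequence: such a sequence is
    tight and converges in law both to its own value and to the other law. *)
Let eq_integral_continuous (g : R -> R) (M : R) : continuous g -> (forall x, `|g x| <= M) ->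
  \int[P]_w g (X w) = \int[Q]_z g (Y z).
Proof.
move=> cg gM.
have mX' : random_vector (embed \o X).
  by move=> i /=; under eq_fun do rewrite mxE.
have mY' : random_vector (embed \o Y).
  by move=> i /=; under eq_fun do rewrite mxE.
have tight (e : R) : 0 < e -> exists L : R, \forall N \near \oo,
    (P [set w | (L < `|(embed \o X) w|)%R] <= e%:E)%E.
  move=> e0; have [L _ LP] := @tail_small _ _ _ P _ e (measurable_norm mX') e0.
  by exists L; exact: nearW.
have cc t : \int[P]_w cos (dot t ((embed \o X) w)) @[N --> \oo] -->
    \int[Q]_z cos (dot t ((embed \o Y) z)).
  have -> : \int[P]_w cos (dot t ((embed \o X) w)) = \int[Q]_z cos (dot t ((embed \o Y) z)).
    transitivity (\int[P]_w cos (t 0 0 * X w)).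
      by apply: eq_Rintegral => w _; rewrite /= dot_embed.
    by rewrite eq_cos; apply: eq_Rintegral => z _; rewrite /= dot_embed.
  exact: cvg_cst.
have cs t : \int[P]_w sin (dot t ((embed \o X) w)) @[N --> \oo] -->
    \int[Q]_z sin (dot t ((embed \o Y) z)).
  have -> : \int[P]_w sin (dot t ((embed \o X) w)) = \int[Q]_z sin (dot t ((embed \o Y) z)).
    transitivity (\int[P]_w sin (t 0 0 * X w)).
      by apply: eq_Rintegral => w _; rewrite /= dot_embed.
    by rewrite eq_sin; apply: eq_Rintegral => z _; rewrite /= dot_embed.
  exact: cvg_cst.
have cg' : continuous (fun v : 'cV[R]_1 => g (v 0 0)).
  by move=> v; apply: continuous_comp; [exact: coord_continuous|exact: cg].
have gM' : exists K : R, forall v : 'cV[R]_1, `|g (v 0 0)| <= K by exists M.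
have h := @levy_continuity R 1 _ _ P _ _ Q (fun _ => embed \o X) (embed \o Y)
  (fun _ => mX') mY' cc cs tight _ cg' gM'.
have -> : \int[P]_w g (X w) = \int[P]_w g ((embed \o X) w 0 0).
  by apply: eq_Rintegral => w _; rewrite mxE.
have -> : \int[Q]_w g (Y w) = \int[Q]_w g ((embed \o Y) w 0 0).
  by apply: eq_Rintegral => w _; rewrite mxE.
by apply: (cvg_unique _ _ h); [exact: Rhausdorff|exact: cvg_cst].
Qed.

Lemma eq_law A : measurable A -> P (X @^-1` A) = Q (Y @^-1` A).
Proof.
move=> mA.
apply: (@measure_unique _ _ _ (@RGenOInfty.G R) (fun n => `](- n%:R), +oo[%classic)
   _ _ _ _ (distribution P (mfun_of mX)) (distribution Q (mfun_of mY))) => //.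
- exact: RGenOInfty.measurableE.
- move=> _ _ [x ->] [y ->]; exists (Num.max x y); apply/seteqP; split=> z /=;
    rewrite !in_itv/= !andbT gt_max; first by move=> [-> ->].
  by move=> /andP.
- by move=> n; exists (- n%:R).
- rewrite -subTset => x _; exists (Num.bound `|x|) => //=.
  rewrite in_itv/= andbT ltrNl; apply: le_lt_trans (archi_boundP (normr_ge0 x)).
  by rewrite -normrN ler_norm.
- move=> _ [x ->]; rewrite /pushforward /=.
  (* For [0 < n] this is a continuous ramp, 0 up to [x] and 1 from [x + 1 / n] on; the ramps
     converge pointwise to the indicator of the open half-line. *)
  pose h (n : nat) (y : R) : R := Num.min 1 (Num.max 0 (n%:R * (y - x))).
  have h01 n y : 0 <= h n y <= 1.
    by rewrite /h le_min ler01 /= le_max lexx /= ge_min lexx.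
  have hb n y : `|h n y| <= 1 by rewrite ger0_norm; case/andP: (h01 n y).
  have ch n : continuous (h n).
    move=> y; apply: (@continuous_min _ _ (fun=> 1) (fun y => Num.max 0 (n%:R * (y - x)))).
      exact: cvg_cst.
    apply: (@continuous_max _ _ (fun=> 0) (fun y => n%:R * (y - x))).
      exact: cvg_cst.
    apply: cvgM; first exact: cvg_cst.
    by apply: cvgB; [exact: cvg_id|exact: cvg_cst].
  have hcvg y : h n y @[n --> \oo] --> (\1_(`]x, +oo[%classic) y : R).
    rewrite indicE; have [xy|yx] := ltP x y.
      rewrite mem_set /= ?in_itv/= ?xy //; apply: cvg_near_cst; near=> n.
      have yx0 : 0 < y - x by rewrite subr_gt0.
      have : (y - x)^-1 <= n%:R by near: n; exact: nbhs_infty_ger.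
      rewrite -(ler_pM2r yx0) mulVf ?gt_eqF // /h => h1.
      by rewrite max_r ?min_l // (le_trans ler01).
    rewrite memNset /= ?in_itv/= ?andbT; last by apply/negP; rewrite -leNgt.
    apply: cvg_near_cst; near=> n; rewrite /h max_l ?min_r //.
    by rewrite mulr_ge0_le0 // subr_le0.
  have lim dS (S : measurableType dS) (P' : probability S R) (V : S -> R) :
      measurable_fun setT V ->
      \int[P']_s h n (V s) @[n --> \oo] --> fine (P' (V @^-1` `]x, +oo[%classic)).
    move=> mV; rewrite -Rintegral_indic; last by rewrite -[X in measurable X]setTI; exact: mV.
    apply: (@dominated_cvg_Rintegral _ _ _ P' _ _ (fun=> 1)).
    + by move=> n; apply: measurableT_comp => //; exact: continuous_measurable_fun.
    + by apply: (integrable_bounded _ (K := 1)) => // s; rewrite normr1.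
    + by move=> s; exact: hcvg.
    + by move=> n s; exact: hb.
  have := lim _ _ P X mX; under eq_fun do rewrite (eq_integral_continuous (ch _) (hb _)).
  move=> l1; have l2 := lim _ _ Q Y mY.
  have e : fine (P (X @^-1` `]x, +oo[%classic)) = fine (Q (Y @^-1` `]x, +oo[%classic)).
    by apply: (cvg_unique _ l1 l2); exact: Rhausdorff.
  have m1 : measurable (X @^-1` `]x, +oo[%classic) by rewrite -[X in measurable X]setTI; exact: mX.
  have m2 : measurable (Y @^-1` `]x, +oo[%classic) by rewrite -[X in measurable X]setTI; exact: mY.
  by move: (congr1 EFin e); rewrite !fineK //; exact: fin_num_measure.
- by move=> n; rewrite -ge0_fin_numE // fin_num_measure.
Unshelve. all: by end_near.
Qed.

End uniqueness.

Import HBNNSimple.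

(** * Integrals under a mixture of two weighted image measures *)

Section mixture_densities.
Context {R : realType} {dS dT} {S : measurableType dS} {T : measurableType dT}.
Variables (mu : {measure set S -> \bar R}) (Q : {measure set T -> \bar R}).
Variables (w1 w2 : S -> R) (p1 p2 : S -> T).
Hypotheses (mw1 : measurable_fun setT w1) (mw2 : measurable_fun setT w2).
Hypotheses (mp1 : measurable_fun setT p1) (mp2 : measurable_fun setT p2).
Hypotheses (w1_ge0 : forall s, 0 <= w1 s) (w2_ge0 : forall s, 0 <= w2 s).
Hypothesis QE : forall A, measurable A ->
  Q A = (\int[mu]_s (w1 s * \1_A (p1 s) + w2 s * \1_A (p2 s))%:E)%E.

Let mix (h : T -> R) (s : S) : R := w1 s * h (p1 s) + w2 s * h (p2 s).

Lemma measurable_mix h : measurable_fun setT h -> measurable_fun setT (mix h).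
Proof.
move=> mh; apply: measurable_funD; apply: measurable_funM => //; exact: measurableT_comp.
Qed.

Let mix_ge0 h s : (forall x, 0 <= h x) -> 0 <= mix h s.
Proof. by move=> h0; rewrite addr_ge0 // mulr_ge0. Qed.

Let integral_mix_nnsfun (h : {nnsfun T >-> R}) :
  (\int[Q]_x (h x)%:E = \int[mu]_s (mix h s)%:E)%E.
Proof.
have h0 k x : 0 <= k * (\1_(h @^-1` [set k]) x : R).
  by have := nnfun_muleindic_ge0 h k x; rewrite -EFinM lee_fin.
have mh k : measurable (h @^-1` [set k]) by exact: measurable_funPTI.
transitivity (\sum_(k \in range h) \int[Q]_x (k * \1_(h @^-1` [set k]) x)%:E)%E.
  under eq_integral do rewrite fimfunE -fsumEFin//.
  rewrite ge0_integral_fsum//; last by move=> k x _; rewrite lee_fin.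
  by move=> y; exact/measurable_EFinP/measurable_funM.
transitivity (\sum_(k \in range h)
    \int[mu]_s (mix (fun x => k * \1_(h @^-1` [set k]) x) s)%:E)%E.
  apply: eq_fsbigr => k /set_mem[x _ kE].
  have k0 : 0 <= k by rewrite -kE.
  rewrite integralZl_indic_nnsfun// integral_indic// setIT QE // -ge0_integralZl //.
  - by apply: eq_integral => s _; rewrite -EFinM /mix; congr EFin; ring.
  - apply/measurable_EFinP; apply: (@measurable_mix (\1_(h @^-1` [set k]))).
    exact: measurable_indic.
  - by move=> s _; rewrite lee_fin; apply: (@mix_ge0 (\1_(h @^-1` [set k]))).
rewrite -ge0_integral_fsum//.
- apply: eq_integral => s _; rewrite fsumEFin //; congr EFin.
  rewrite /mix !fimfunE !mulr_fsumr // -fsbig_split //=.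
- by move=> r; apply/measurable_EFinP/measurable_mix/measurable_funM => //.
- by move=> r x _; rewrite lee_fin; apply: mix_ge0.
Qed.

(** Simple functions, then monotone convergence. One change of variables serves two laws: that of
    [(x, y, delta)], where [p1] and [p2] attach the value of [delta], and the normal law, where the
    second weight is zero. *)
Lemma ge0_integral_mix (h : T -> R) : measurable_fun setT h -> (forall x, 0 <= h x) ->
  (\int[Q]_x (h x)%:E = \int[mu]_s (w1 s * h (p1 s) + w2 s * h (p2 s))%:E)%E.
Proof.
move=> mh h0; have meh : measurable_fun setT (EFin \o h) by exact/measurable_EFinP.
pose f_ := nnsfun_approx measurableT meh.
have f_cvg x : f_ n x @[n --> \oo] --> h x.
  have eh0 (t : T) : setT t -> (0 <= (EFin \o h) t)%E by move=> _; rewrite lee_fin.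
  exact: fine_cvg (cvg_nnsfun_approx measurableT meh eh0 (I : setT x)).
transitivity (limn (fun n => \int[Q]_x (f_ n x)%:E))%E.
  rewrite -monotone_convergence//.
  - apply: eq_integral => y _; apply/esym/cvg_lim => //.
    by apply: cvg_EFin; [exact: nearW|exact: f_cvg].
  - by move=> n; exact/measurable_EFinP/measurable_funP.
  - by move=> n y _; rewrite lee_fin.
  - by move=> y _ m n mn; rewrite lee_fin; exact/lefP/nd_nnsfun_approx.
under eq_fun do rewrite integral_mix_nnsfun.
rewrite -monotone_convergence//.
- apply: eq_integral => s _; apply/cvg_lim => //.
  apply: cvg_EFin; first exact: nearW.
  by apply: cvgD; apply: cvgM; (exact: cvg_cst || exact: f_cvg).
- by move=> n; apply/measurable_EFinP/measurable_mix/measurable_funP.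
- by move=> n s _; rewrite lee_fin; apply: mix_ge0.
- move=> s _ m n mn; rewrite lee_fin lerD // ler_wpM2l //; exact/lefP/nd_nnsfun_approx.
Qed.

Lemma integrable_mix (h : T -> R) : measurable_fun setT h ->
  mu.-integrable setT
    (EFin \o (fun s => w1 s * `|h (p1 s)| + w2 s * `|h (p2 s)|)) ->
  Q.-integrable setT (EFin \o h).
Proof.
move=> mh /integrableP[_ ih]; apply/integrableP; split; first exact/measurable_EFinP.
have -> : (\int[Q]_x `|(EFin \o h) x| = \int[Q]_x (`|h x|)%:E)%E by [].
rewrite (@ge0_integral_mix (fun x => `|h x|)) //; last exact: measurableT_comp.
apply: le_lt_trans ih; apply: ge0_le_integral => //.
- by move=> s _; rewrite lee_fin addr_ge0 // mulr_ge0.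
- apply/measurable_EFinP; apply: (@measurable_mix (fun x => `|h x|)).
  exact: measurableT_comp.
- apply/measurable_EFinP; apply: measurableT_comp => //.
  by apply: (@measurable_mix (fun x => `|h x|)); exact: measurableT_comp.
- by move=> s _; rewrite lee_fin ler_norm.
Qed.

Lemma Rintegral_mix (h : T -> R) : Q.-integrable setT (EFin \o h) ->
  \int[Q]_x h x = \int[mu]_s (w1 s * h (p1 s) + w2 s * h (p2 s)).
Proof.
move=> ih; have mh : measurable_fun setT h by exact/measurable_EFinP/(measurable_int Q).
pose hp x := Num.max (h x) 0; pose hn x := Num.max (- h x) 0.
have mhp : measurable_fun setT hp by apply: measurable_maxr.
have mhn : measurable_fun setT hn by apply: measurable_maxr => //; exact: measurableT_comp.
have hE x : h x = hp x - hn x.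
  by rewrite /hp /hn; case: (leP (h x) 0) => h0; case: (leP (- h x) 0) => h1; lra.
have hp0 x : 0 <= hp x by rewrite le_max lexx orbT.
have hn0 x : 0 <= hn x by rewrite le_max lexx orbT.
have bound (k : T -> R) : measurable_fun setT k -> (forall x, 0 <= k x <= `|h x|) ->
    Q.-integrable setT (EFin \o k) /\ mu.-integrable setT (EFin \o mix k).
  move=> mk kh.
  have ik : Q.-integrable setT (EFin \o k).
    apply: le_integrable ih => //; first exact/measurable_EFinP.
    by move=> x _; rewrite lee_fin ger0_norm; case/andP: (kh x).
  have k0 x : 0 <= k x by case/andP: (kh x).
  split=> //; apply/integrableP; split; first exact/measurable_EFinP/measurable_mix.
  move/integrableP: ik => [_]; congr (_ < _)%E.
  under eq_integral do rewrite /= ger0_norm //.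
  rewrite ge0_integral_mix //; apply: eq_integral => s _.
  by rewrite /= ger0_norm // mix_ge0.
have [ip1 ip2] : Q.-integrable setT (EFin \o hp) /\ mu.-integrable setT (EFin \o mix hp).
  apply: bound => // x; rewrite hp0 /=; rewrite /hp; case: (leP (h x) 0) => // _.
  exact: ler_norm.
have [in1 in2] : Q.-integrable setT (EFin \o hn) /\ mu.-integrable setT (EFin \o mix hn).
  apply: bound => // x; rewrite hn0 /=; rewrite /hn; case: (leP (- h x) 0) => // _.
  by rewrite -normrN ler_norm.
transitivity (\int[Q]_x (hp x - hn x)); first by apply: eq_Rintegral => x _.
rewrite RintegralB //; transitivity (\int[mu]_s (mix hp s - mix hn s)).
  by rewrite RintegralB // /Rintegral !ge0_integral_mix.
by apply: eq_Rintegral => s _; rewrite /mix !hE; ring.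
Qed.

End mixture_densities.

(** * The characteristic function of a centered normal law *)

Section normal_characteristic_function.
Context {R : realType} (sigma : R) (sigma0 : sigma != 0).
Local Notation mu := (@lebesgue_measure R).
Let n : R -> R := normal_pdf 0 sigma.

Let s2_gt0 : 0 < sigma ^+ 2. Proof. by rewrite exprn_even_gt0. Qed.

Let nE x : n x = normal_peak sigma * expR (- (x ^+ 2) / (sigma ^+ 2 *+ 2)).
Proof. by rewrite /n normal_pdfE // /normal_fun subr0. Qed.

Let n_ge0 x : 0 <= n x. Proof. exact: normal_pdf_ge0. Qed.

Let mn : measurable_fun setT n. Proof. exact: measurable_normal_pdf. Qed.

Let n_derive (x : R) : is_derive x 1 n (- (x / sigma ^+ 2) * n x).
Proof.
have -> : n = (fun x => normal_peak sigma * expR (- (sigma ^+ 2 *+ 2)^-1 * x ^+ 2)).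
  by apply/funext => y; rewrite nE; congr (_ * expR _); rewrite mulrC mulrN mulNr.
apply: is_derive_eq; rewrite /GRing.scale /=.
field; exact: sigma0.
Qed.

Let n_continuous : continuous n.
Proof. exact: continuous_normal_pdf. Qed.

(** Doubling the variance absorbs the factor [|x|]. In the variable [z = x / (2 sigma)] the claim is
    that [|z| exp (- 2 z^2)] is at most [exp (- z^2)], which follows from
    [|z| <= 1 + z^2 <= exp (z^2)]. *)
Let abs_pdf_le x : `|x| * n x <= 2 * `|sigma| * (Num.sqrt 2 * normal_pdf 0 (Num.sqrt 2 * sigma) x).
Proof.
have s0 : Num.sqrt 2 * sigma != 0 by rewrite mulf_neq0 // gt_eqF // sqrtr_gt0.
rewrite nE normal_pdfE //.
rewrite /normal_fun subr0 /normal_peak exprMn sqr_sqrtr //.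
set z := x / (2 * sigma).
have -> : - x ^+ 2 / (sigma ^+ 2 *+ 2) = - (z ^+ 2 *+ 2).
  by rewrite /z; field.
have -> : - x ^+ 2 / (2 * sigma ^+ 2 *+ 2) = - z ^+ 2.
  by rewrite /z; field.
have -> : Num.sqrt (2 * sigma ^+ 2 * pi *+ 2) = Num.sqrt 2 * Num.sqrt (sigma ^+ 2 * pi *+ 2).
  by rewrite -sqrtrM //; congr Num.sqrt; ring.
rewrite invfM !mulrA -[2 * `|sigma| * _ * _]mulrA divff ?gt_eqF ?sqrtr_gt0 // mulr1.
have -> : `|x| = 2 * `|sigma| * `|z|.
  rewrite /z normrM normfV normrM (gtr0_norm (x := 2)) //; field.
  by rewrite normr_eq0.
set p := (Num.sqrt _)^-1; have p0 : 0 <= p by rewrite invr_ge0 sqrtr_ge0.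
rewrite -[leLHS]mulrA -!(mulrCA p) -!(mulrA _ p) !(mulrC p) !mulrA ler_wpM2r //.
rewrite -!mulrA !ler_wpM2l //.
have -> : expR (- (z ^+ 2 *+ 2)) = expR (- z ^+ 2) * expR (- z ^+ 2).
  by rewrite -expRD mulr2n opprD.
rewrite mulrA -[leRHS]mul1r ler_wpM2r ?expR_ge0 //.
rewrite expRN -ler_pdivlMr ?invr_gt0 ?expR_gt0 // invrK mul1r.
apply: le_trans (expR_ge1Dx _).
have := sqr_ge0 (`|z| - 1 / 2); rewrite -[z ^+ 2]real_normK ?num_real //; nra.
Qed.

Let integrable_pdf : mu.-integrable setT (EFin \o n).
Proof. exact: integrable_normal_pdf. Qed.

Let integrable_abs_pdf : mu.-integrable setT (EFin \o (fun x => `|x| * n x)).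
Proof.
have i2 : mu.-integrable setT (EFin \o (fun x =>
    (2 * `|sigma| * Num.sqrt 2) * normal_pdf 0 (Num.sqrt 2 * sigma) x)).
  exact: (integrableZl measurableT _ (integrable_normal_pdf _ _)).
apply: le_integrable i2 => //.
  by apply/measurable_EFinP/measurable_funM => //; exact: measurableT_comp.
move=> x _; rewrite lee_fin ger0_norm ?mulr_ge0 // -mulrA.
exact: le_trans (abs_pdf_le x) (ler_norm _).
Qed.

Variable c : R.

Let measurable_phase (s : R) (g : R -> R) : continuous g ->
  measurable_fun setT (fun x : R => g (s * x + c)).
Proof.
move=> cg; apply: (measurableT_comp (f := g)); first exact: continuous_measurable_fun.
by apply: measurable_funD => //; exact: measurable_funM.
Qed.

Let sin_pdf (s x : R) : R := sin (s * x + c) * n x.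
Let dsin_pdf (s x : R) : R := s * cos (s * x + c) * n x - x / sigma ^+ 2 * sin (s * x + c) * n x.

Let sin_pdf_derive s (x : R) : is_derive x 1 (sin_pdf s) (dsin_pdf s x).
Proof.
have Dn := n_derive x; rewrite /sin_pdf; apply: is_derive_eq.
rewrite /GRing.scale /= /dsin_pdf; ring.
Qed.

Let dsin_pdf_bound s x : `|dsin_pdf s x| <= `|s| * n x + (sigma ^+ 2)^-1 * (`|x| * n x).
Proof.
apply: le_trans (ler_normB _ _) _; rewrite !normrM (ger0_norm (n_ge0 x)) lerD //.
  by rewrite ler_wpM2r // ler_piMr // cos_max.
have s0 : 0 <= (sigma ^+ 2)^-1 by rewrite invr_ge0 ltW.
rewrite (ger0_norm s0).
have -> : `|x| * (sigma ^+ 2)^-1 * `|sin (s * x + c)| * n x =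
  (sigma ^+ 2)^-1 * (`|x| * n x) * `|sin (s * x + c)| by ring.
by apply: ler_piMr; rewrite ?sin_max // !mulr_ge0.
Qed.

Let measurable_dsin_pdf s : measurable_fun setT (dsin_pdf s).
Proof.
apply: measurable_funB; apply: measurable_funM => //; apply: measurable_funM => //.
- exact: (measurable_phase _ (@continuous_cos R)).
- exact: measurable_funM.
- exact: (measurable_phase _ (@continuous_sin R)).
Qed.

Let integrable_bound (s : R) : mu.-integrable setT
  (EFin \o (fun x => `|s| * n x + (sigma ^+ 2)^-1 * (`|x| * n x))).
Proof.
exact: (integrableD measurableT (integrableZl measurableT _ integrable_pdf)
  (integrableZl measurableT _ integrable_abs_pdf)).
Qed.

Let n_le k : 0 < k -> n k <= normal_peak sigma * (sigma ^+ 2 *+ 2) * (k ^+ 2)^-1.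
Proof.
move=> k0; have k2 : 0 < k ^+ 2 by rewrite exprn_gt0.
rewrite nE -mulrA ler_wpM2l ?normal_peak_ge0 // mulNr expRN.
set y := k ^+ 2 / _; have y0 : 0 < y by rewrite divr_gt0 // pmulrn_lgt0.
have -> : sigma ^+ 2 *+ 2 * (k ^+ 2)^-1 = y^-1 by rewrite /y invf_div.
rewrite lef_pV2 ?posrE ?expR_gt0 //; apply: le_trans (expR_ge1Dx _); lra.
Qed.

Let n_even x : n (- x) = n x.
Proof. by rewrite !nE sqrrN. Qed.

Let dsin_continuous s : continuous (dsin_pdf s).
Proof.
move=> x; have ca : {for x, continuous (fun x : R => s * x + c)}.
  by apply: cvgD; [apply: cvgM; [exact: cvg_cst|exact: cvg_id]|exact: cvg_cst].
apply: cvgB; apply: cvgM; try exact: n_continuous; apply: cvgM.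
- exact: cvg_cst.
- by apply: (continuous_comp ca); exact: continuous_cos.
- by apply: cvgM; [exact: cvg_id|exact: cvg_cst].
- by apply: (continuous_comp ca); exact: continuous_sin.
Qed.

(** The integrand is the derivative of [sin_pdf s], so its integral over a symmetric segment is a
    boundary term, which vanishes in the limit because the density decays at least like [k^-2] by
    [n_le]. Dominated convergence passes to the whole line. *)
Let integral_dsin_pdf s : \int[mu]_x dsin_pdf s x = 0.
Proof.
pose A (k : nat) : set R := `[(- k.+1%:R), k.+1%:R]%classic.
have mA k : measurable (A k) by exact: measurable_itv.
have c1 : (fun k => \int[mu]_x (\1_(A k) x * dsin_pdf s x)) @ \oo -->
    \int[mu]_x dsin_pdf s x.
  apply: (@dominated_cvg_Rintegral _ _ _ mu _ _
    (fun x => `|s| * n x + (sigma ^+ 2)^-1 * (`|x| * n x))).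
  - move=> k; apply: measurable_funM; last exact: measurable_dsin_pdf.
    by apply: measurable_indic; exact: mA.
  - exact: integrable_bound.
  - move=> x; apply: cvg_near_cst; near=> k; rewrite indicE mem_set ?mul1r //.
    rewrite /A /= in_itv/= -ler_norml.
    have : `|x| <= k%:R by near: k; exact: nbhs_infty_ger.
    by move/le_trans; apply; rewrite ler_nat.
  - move=> k x; apply: le_trans (dsin_pdf_bound s x).
    by rewrite normrM ler_piMl // indicE; case: (_ \in _); rewrite ?normr1 ?normr0.
have E k : \int[mu]_x (\1_(A k) x * dsin_pdf s x) =
    sin_pdf s k.+1%:R - sin_pdf s (- k.+1%:R).
  transitivity (\int[mu]_(x in A k) dsin_pdf s x).
    rewrite [RHS]Rintegral_mkcond; apply: eq_Rintegral => x _.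
    by rewrite patchE indicE; case: (_ \in _); rewrite ?mul1r ?mul0r.
  have Ds := sin_pdf_derive s; have cs : continuous (sin_pdf s).
    by move=> x; apply/differentiable_continuous/derivable1_diffP; case: (Ds x).
  rewrite /Rintegral (@continuous_FTC2 _ (dsin_pdf s) (sin_pdf s)) //.
  - by rewrite -subr_gt0 opprK addr_gt0.
  - by apply: continuous_subspaceT; exact: dsin_continuous.
  - split; [by move=> x _; case: (Ds x)| |].
      by apply: cvg_at_right_filter; exact: cs.
    by apply: cvg_at_left_filter; exact: cs.
  - by move=> x _; rewrite derive1E derive_val.
have c2 : (fun k => \int[mu]_x (\1_(A k) x * dsin_pdf s x)) @ \oo --> (0 : R).
  have bnd k : `|\int[mu]_x (\1_(A k) x * dsin_pdf s x)| <=
      2 * (normal_peak sigma * (sigma ^+ 2 *+ 2)) * k.+1%:R^-1.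
    rewrite E (le_trans (ler_normB _ _)) // !normrM n_even (ger0_norm (n_ge0 _)).
    have nk := n_le (ltr0Sn R k).
    have k1 : (k.+1%:R ^+ 2 : R)^-1 <= k.+1%:R^-1.
      rewrite lef_pV2 ?posrE ?exprn_gt0 // expr2 ler_peMr //.
      by rewrite ler1n.
    have p0 : 0 <= normal_peak sigma * (sigma ^+ 2 *+ 2).
      by rewrite mulr_ge0 ?normal_peak_ge0 // pmulrn_lge0 // ltW.
    have nk1 : n k.+1%:R <= normal_peak sigma * (sigma ^+ 2 *+ 2) * k.+1%:R^-1.
      by apply: le_trans nk _; rewrite ler_wpM2l.
    rewrite -[leRHS]mulrA mulr_natl mulr2n lerD //.
      by apply: le_trans nk1; rewrite ler_piMl // sin_max.
    by apply: le_trans nk1; rewrite ler_piMl // sin_max.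
  apply: (@squeeze_cvgr _ _ _ _ (fun k => - (2 * (normal_peak sigma * (sigma ^+ 2 *+ 2)) * k.+1%:R^-1))
    (fun k => 2 * (normal_peak sigma * (sigma ^+ 2 *+ 2)) * k.+1%:R^-1)).
  - by apply: nearW => k; rewrite -ler_norml.
  - rewrite -[X in _ --> X]oppr0; apply: cvgN.
    rewrite -[X in _ --> X](mulr0 (2 * (normal_peak sigma * (sigma ^+ 2 *+ 2)))).
    by apply: cvgM; [exact: cvg_cst|exact: cvg_harmonic].
  - rewrite -[X in _ --> X](mulr0 (2 * (normal_peak sigma * (sigma ^+ 2 *+ 2)))).
    by apply: cvgM; [exact: cvg_cst|exact: cvg_harmonic].
by apply: (cvg_unique _ c1 c2); exact: Rhausdorff.
Unshelve. all: by end_near.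
Qed.

Let F (s : R) : R := \int[mu]_x (cos (s * x + c) * n x).

Let measurable_cos_pdf s : measurable_fun setT (fun x : R => cos (s * x + c) * n x).
Proof.
apply: measurable_funM; last exact: mn.
exact: (measurable_phase _ (@continuous_cos R)).
Qed.

Let integrable_cos_pdf (s : R) : mu.-integrable setT (EFin \o (fun x : R => cos (s * x + c) * n x)).
Proof.
apply: le_integrable integrable_pdf => //.
  by apply/measurable_EFinP; exact: measurable_cos_pdf.
by move=> x _; rewrite lee_fin normrM ler_piMl // cos_max.
Qed.

Let cos_pdf_derive (s x : R) :
  is_derive s 1 (fun s : R => cos (s * x + c) * n x) (- (x * sin (s * x + c) * n x)).
Proof.
apply: is_derive_eq; rewrite /GRing.scale /=; ring.
Qed.

(** Differentiation under the integral, dominated by [|x| * n x], leaves the integral of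
    [x * sin (s * x + c) * n x]. Integration by parts, in the form of [integral_dsin_pdf], turns it
    into [sigma ^+ 2 * s * F s]. *)
Let F_derive (s : R) : is_derive s 1 F (- (sigma ^+ 2 * s * F s)).
Proof.
have I0 : (`]s - 1, s + 1[%classic : set R) s by rewrite /= in_itv/=; lra.
have d1 y x : partial1of2 (fun s x : R => cos (s * x + c) * n x) y x = - (x * sin (y * x + c) * n x).
  by rewrite partial1of2E; exact: derive_val.
have bnd (y x : R) : `|partial1of2 (fun s x : R => cos (s * x + c) * n x) y x| <= `|x| * n x.
  rewrite d1 normrN !normrM (ger0_norm (n_ge0 x)) ler_wpM2r // ler_piMr // sin_max //.
have dF : derivable F s 1.
  apply: (@derivable_under_integral _ _ _ mu (fun s x : R => cos (s * x + c) * n x) setT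
    measurableT s (s - 1) (s + 1) I0 _ _ (fun x => `|x| * n x)) => // y.
  by rewrite mulr_ge0.
apply: DeriveDef => //; rewrite -derive1E.
rewrite (@differentiation_under_integral _ _ _ mu (fun s x : R => cos (s * x + c) * n x) setT
    measurableT s (s - 1) (s + 1) I0 _ _ (fun x => `|x| * n x)) //; last by move=> y; rewrite mulr_ge0.
under eq_Rintegral do rewrite d1.
have ix : mu.-integrable setT (EFin \o (fun x : R => x * sin (s * x + c) * n x)).
  apply: le_integrable integrable_abs_pdf => //.
    apply/measurable_EFinP/measurable_funM; last exact: mn.
    by apply: measurable_funM => //; exact: (measurable_phase _ (@continuous_sin R)).
  move=> x _; rewrite lee_fin !normrM (ger0_norm (n_ge0 x)) ler_wpM2r //.
  by rewrite normr_id ler_piMr // sin_max.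
have ic := integrable_cos_pdf s.
have ix' : mu.-integrable setT (EFin \o (fun x : R => - (sigma ^+ 2)^-1 * (x * sin (s * x + c) * n x))).
  exact: (integrableZl measurableT _ ix).
have ic' : mu.-integrable setT (EFin \o (fun x : R => s * (cos (s * x + c) * n x))).
  exact: (integrableZl measurableT _ ic).
have : \int[mu]_x (s * (cos (s * x + c) * n x) +
    - (sigma ^+ 2)^-1 * (x * sin (s * x + c) * n x)) = 0.
  rewrite -[RHS](integral_dsin_pdf s); apply: eq_Rintegral => x _.
  by rewrite /dsin_pdf; ring.
rewrite RintegralD // !RintegralZl // -/(F s) => h.
have -> : \int[mu]_x - (x * sin (s * x + c) * n x) =
    - \int[mu]_x (x * sin (s * x + c) * n x).
  by rewrite -mulN1r -RintegralZl //; apply: eq_Rintegral => x _; rewrite mulN1r.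
congr (- _); move/eqP: h; rewrite mulNr subr_eq0 => /eqP h.
rewrite -mulrA h mulrA divff ?mul1r // gt_eqF //.
Qed.

(** The differential equation for [F] makes [H] constant, and [F 0 = cos c] since the density
    integrates to 1. The phase [c] treats both parts of the characteristic function at once: [c = 0]
    gives the cosine and [c = - (pi / 2)] the sine. *)
Lemma normal_cos_phase (s : R) :
  \int[mu]_x (cos (s * x + c) * normal_pdf 0 sigma x) = cos c * expR (- (sigma ^+ 2 * s ^+ 2) / 2).
Proof.
rewrite -[LHS]/(F s); pose H s := F s * expR (sigma ^+ 2 * s ^+ 2 / 2).
have DH (y : R) : is_derive y 1 H 0.
  have DF := F_derive y; rewrite /H; apply: is_derive_eq.
  by rewrite /GRing.scale /=; field.
have : H s = H 0 by apply: is_derive_0_is_cst.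
rewrite /H expr0n mulr0 mul0r expR0 mulr1.
have -> : F 0 = cos c.
  rewrite /F; under eq_Rintegral do rewrite mul0r add0r.
  rewrite RintegralZl // /Rintegral integral_normal_pdf /= mulr1 //.
move=> <-; rewrite -mulrA -expRD.
by have -> : sigma ^+ 2 * s ^+ 2 / 2 + - (sigma ^+ 2 * s ^+ 2) / 2 = 0; [field|rewrite expR0 mulr1].
Qed.

End normal_characteristic_function.

(** * Cosine and sine integrals under [normal_prob] *)

Section normal_law.
Context {R : realType} (sigma : R) (sigma0 : sigma != 0).
Local Notation mu := (@lebesgue_measure R).

Lemma integral_normal_prob (g : R -> R) : measurable_fun setT g ->
  (forall x, `|g x| <= 1) ->
  \int[normal_prob 0 sigma]_x g x = \int[mu]_x (g x * normal_pdf 0 sigma x).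
Proof.
move=> mg g1; transitivity
    (\int[mu]_x (normal_pdf 0 sigma x * g (id x) + cst 0 x * g (id x))); last first.
  by apply: eq_Rintegral => x _ /=; rewrite mul0r addr0 mulrC.
apply: (@Rintegral_mix R _ _ _ _ mu (normal_prob 0 sigma) (normal_pdf 0 sigma) (cst 0) id id) => //.
- exact: measurable_normal_pdf.
- exact: normal_pdf_ge0.
- move=> A mA; rewrite [LHS](_ : _ = \int[mu]_(x in A) (normal_pdf 0 sigma x)%:E)%E //.
  rewrite [LHS]integral_mkcond; apply: eq_integral => x _.
  by rewrite patchE indicE /= mul0r addr0; case: (_ \in _); rewrite ?mulr1 ?mulr0.
- exact: (integrable_bounded (normal_prob 0 sigma) mg g1).
Qed.

Lemma normal_cos (s : R) :
  \int[normal_prob 0 sigma]_x cos (s * x) = expR (- (sigma ^+ 2 * s ^+ 2) / 2).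
Proof.
have m : measurable_fun setT (fun x : R => cos (s * x)).
  apply: (measurableT_comp (f := cos)); last exact: measurable_funM.
  by apply: continuous_measurable_fun; exact: continuous_cos.
rewrite integral_normal_prob //; last by move=> x; exact: cos_max.
have := normal_cos_phase sigma0 0 s; rewrite cos0 mul1r => <-.
by apply: eq_Rintegral => x _; rewrite addr0.
Qed.

Lemma normal_sin (s : R) : \int[normal_prob 0 sigma]_x sin (s * x) = 0.
Proof.
have m : measurable_fun setT (fun x : R => sin (s * x)).
  apply: (measurableT_comp (f := sin)); last exact: measurable_funM.
  by apply: continuous_measurable_fun; exact: continuous_sin.
rewrite integral_normal_prob //; last by move=> x; exact: sin_max.
transitivity (\int[mu]_x (cos (s * x + - (pi / 2)) * normal_pdf 0 sigma x)).
  by apply: eq_Rintegral => x _; rewrite cosB cos_pihalf sin_pihalf mulr0 add0r mulr1.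
by rewrite normal_cos_phase // cosN cos_pihalf mul0r.
Qed.

End normal_law.

(** * Products of functions of independent coordinates *)

Section product_integral.
Context {R : realType} {dS dT} {S : measurableType dS} {T : measurableType dT}.
Variables (P : probability S R) (Q : probability T R).

Lemma Rintegral_prodM (f : S -> R) (g : T -> R) (K L : R) :
  measurable_fun setT f -> measurable_fun setT g ->
  (forall x, `|f x| <= K) -> (forall y, `|g y| <= L) ->
  \int[(P \x Q)%E]_z (f z.1 * g z.2) = (\int[P]_x f x) * (\int[Q]_y g y).
Proof.
move=> mf mg fK gL.
have mfg : measurable_fun setT (fun z : S * T => f z.1 * g z.2).
  by apply: measurable_funM; [apply: (measurableT_comp mf)|apply: (measurableT_comp mg)].
have b z : `|f z.1 * g z.2| <= K * L by rewrite normrM ler_pM.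
have ifg := integrable_bounded (P \x Q)%E mfg b.
have if_ := integrable_bounded P mf fK; have ig := integrable_bounded Q mg gL.
rewrite {1}/Rintegral -integral12_prod_meas1 //=.
transitivity (fine (\int[P]_x ((f x)%:E * (\int[Q]_y g y)%:E)))%E.
  congr fine; apply: eq_integral => x _; rewrite /fubini_F /=.
  under eq_integral do rewrite EFinM.
  by rewrite integralZl // fineK //; exact: (integrable_fin_num measurableT ig).
by rewrite integralZr // fineM //; exact: (integrable_fin_num measurableT if_).
Qed.

End product_integral.

(** * Gaussian vectors with a prescribed covariance *)

Section gaussian_vectors.
Context {R : realType} {d : nat}.

Lemma measurable_cos_comp {dT} {T : measurableType dT} (X : T -> R) :
  measurable_fun setT X -> measurable_fun setT (fun w => cos (X w)).
Proof.
move=> mX; apply: (measurableT_comp (f := cos)) => //.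
by apply: continuous_measurable_fun; exact: continuous_cos.
Qed.

Lemma measurable_sin_comp {dT} {T : measurableType dT} (X : T -> R) :
  measurable_fun setT X -> measurable_fun setT (fun w => sin (X w)).
Proof.
move=> mX; apply: (measurableT_comp (f := sin)) => //.
by apply: continuous_measurable_fun; exact: continuous_sin.
Qed.

(** Multiplicativity of characteristic functions over independent sums, written out in real and
    imaginary parts by the addition formulas. *)
Lemma integral_cosD {dS dT} {S : measurableType dS} {T : measurableType dT}
    (P : probability S R) (Q : probability T R) (X : S -> R) (Y : T -> R) :
  measurable_fun setT X -> measurable_fun setT Y ->
  \int[(P \x Q)%E]_z cos (X z.1 + Y z.2) =
    (\int[P]_x cos (X x)) * (\int[Q]_y cos (Y y)) -
    (\int[P]_x sin (X x)) * (\int[Q]_y sin (Y y)) /\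
  \int[(P \x Q)%E]_z sin (X z.1 + Y z.2) =
    (\int[P]_x sin (X x)) * (\int[Q]_y cos (Y y)) +
    (\int[P]_x cos (X x)) * (\int[Q]_y sin (Y y)).
Proof.
move=> mX mY.
have mcX := measurable_cos_comp mX; have msX := measurable_sin_comp mX.
have mcY := measurable_cos_comp mY; have msY := measurable_sin_comp mY.
have i (f : S -> R) (g : T -> R) : measurable_fun setT f -> measurable_fun setT g ->
    (forall x, `|f x| <= 1) -> (forall y, `|g y| <= 1) ->
    (P \x Q)%E.-integrable setT (EFin \o (fun z : S * T => f z.1 * g z.2)).
  move=> mf mg f1 g1; apply: (integrable_bounded (P \x Q)%E (K := 1 * 1)).
    by apply: measurable_funM; [apply: (measurableT_comp mf)|apply: (measurableT_comp mg)].
  by move=> z; rewrite normrM ler_pM.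
have cX x := cos_max (X x); have sX x := sin_max (X x).
have cY y := cos_max (Y y); have sY y := sin_max (Y y).
split.
- rewrite -(Rintegral_prodM _ _ mcX mcY cX cY) -(Rintegral_prodM _ _ msX msY sX sY).
  rewrite -RintegralB //; [|exact: (i _ _ mcX mcY cX cY)|exact: (i _ _ msX msY sX sY)].
  by apply: eq_Rintegral => z _; rewrite cosD.
- rewrite -(Rintegral_prodM _ _ msX mcY sX cY) -(Rintegral_prodM _ _ mcX msY cX sY).
  rewrite -RintegralD //; [|exact: (i _ _ msX mcY sX cY)|exact: (i _ _ mcX msY cX sY)].
  by apply: eq_Rintegral => z _; rewrite sinD.
Qed.

(** The vector is the sum, over [c] in [s], of [c] times independent standard normal variables. Each
    element of [s] adds one factor to the product space, which is why the space is quantified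
    existentially. *)
Lemma gaussian_combination (s : seq 'cV[R]_d) :
  exists (dT : measure_display) (T : measurableType dT) (Q : probability T R)
    (Z : T -> 'cV[R]_d), random_vector Z /\ forall t,
    \int[Q]_z cos (dot t (Z z)) = expR (- (\sum_(c <- s) dot t c ^+ 2) / 2) /\
    \int[Q]_z sin (dot t (Z z)) = 0.
Proof.
elim: s => [|c s [dT [T [Q [Z [mZ QZ]]]]]].
  exists _, _, (normal_prob (0 : R) 1), (fun=> 0); split=> [i|t].
    exact: measurable_cst.
  split.
    under eq_Rintegral do rewrite dot0r cos0.
    by rewrite Rintegral_prob_cst big_nil oppr0 mul0r expR0.
  by under eq_Rintegral do rewrite dot0r sin0; rewrite Rintegral_prob_cst.
exists _, _, (Q \x normal_prob (0 : R) 1)%E, (fun z => Z z.1 + z.2 *: c); split.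
  move=> i; under eq_fun do rewrite !mxE.
  apply: measurable_funD; first by apply: (measurableT_comp (mZ i)).
  exact: measurable_funM.
move=> t; have mX := measurable_dot t mZ.
have mY : measurable_fun setT (fun x : R => dot t c * x) by exact: measurable_funM.
have [hc hs] := integral_cosD Q (normal_prob 0 1) mX mY.
have [QZc QZs] := QZ t.
rewrite normal_sin ?oner_eq0 // normal_cos ?oner_eq0 // in hc hs.
have E z : dot t (Z z.1 + z.2 *: c) = dot t (Z z.1) + dot t c * z.2.
  by rewrite dotDr dotZr [_ * z.2]mulrC.
split.
  under eq_Rintegral do rewrite E.
  by rewrite hc QZc QZs mul0r subr0 -expRD big_cons; congr expR; field.
by under eq_Rintegral do rewrite E; rewrite hs QZs mulr0 mul0r addr0.
Qed.

(** A singular [V] has no density, but it is a sum of matrices [outer c], whose vectors [c] feed the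
    linear combination. Evaluation at [u *: t] gives the characteristic function of the real
    variable [dot t (Z z)], and [eq_law] recognises it as normal, or as a Dirac mass when the
    variance is zero. *)
Theorem gaussian_exists (V : 'M[R]_d) : psd V ->
  exists (dT : measure_display) (T : measurableType dT) (Q : probability T R)
    (Z : T -> 'cV[R]_d), centered_normal Q Z V /\ forall t,
    \int[Q]_z cos (dot t (Z z)) = expR (- bform V t t / 2) /\
    \int[Q]_z sin (dot t (Z z)) = 0.
Proof.
move=> pV; have [s sE] := psd_sum_outer pV.
have [dT [T [Q [Z [mZ QZ]]]]] := gaussian_combination s.
have VE t : \sum_(c <- s) dot t c ^+ 2 = bform V t t.
  rewrite sE /bform; elim: s {sE QZ} => [|c s IH].
    by rewrite !big_nil mulmx0 mul0mx mxE.
  by rewrite !big_cons mulmxDr mulmxDl mxE -IH -/(bform _ _ _) bform_outer expr2.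
have QE t : \int[Q]_z cos (dot t (Z z)) = expR (- bform V t t / 2) /\
    \int[Q]_z sin (dot t (Z z)) = 0 by rewrite -VE; exact: QZ.
exists dT, T, Q, Z; split => //; split => // t A mA /=; rewrite -/(bform V t t).
have Qu u : \int[Q]_z cos (u * dot t (Z z)) = expR (- (bform V t t * u ^+ 2) / 2) /\
    \int[Q]_z sin (u * dot t (Z z)) = 0.
  have := QE (u *: t); rewrite bformZl bformZr mulrA -expr2 (mulrC (u ^+ 2)) => -[hc hs].
  split; first by rewrite -hc; apply: eq_Rintegral => z _; rewrite dotZl.
  by rewrite -hs; apply: eq_Rintegral => z _; rewrite dotZl.
have mX := measurable_dot t mZ.
have [V0|V0] := eqVneq (bform V t t) 0.
  apply: (@eq_law R _ _ Q _ _ (\d_(0 : R)) _ id mX _ _ _ A mA) => // u.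
  - rewrite (Qu u).1 V0 mul0r oppr0 mul0r expR0 /Rintegral integral_dirac //.
      by rewrite diracT mul1e /= mulr0 cos0.
    by apply/measurable_EFinP/measurable_cos_comp; exact: measurable_funM.
  - rewrite (Qu u).2 /Rintegral integral_dirac //.
      by rewrite diracT mul1e /= mulr0 sin0.
    by apply/measurable_EFinP/measurable_sin_comp; exact: measurable_funM.
have V1 : 0 < bform V t t by rewrite lt_neqAle eq_sym V0; case: pV => _; exact.
have sV : Num.sqrt (bform V t t) != 0 by rewrite gt_eqF // sqrtr_gt0.
apply: (@eq_law R _ _ Q _ _ (normal_prob 0 (Num.sqrt (bform V t t))) _ id mX _ _ _ A mA) => // u.
- by rewrite (Qu u).1 normal_cos // sqr_sqrtr // ltW.
- by rewrite (Qu u).2 normal_sin.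
Qed.

End gaussian_vectors.

(** * Independent pairs and partial sums of independent variables *)

Section independence.
Context {R : realType} {dO} {Omega : measurableType dO} (P : probability Omega R).

Lemma measurable_preimage {d} {T : measurableType d} (X : Omega -> T) A :
  measurable_fun setT X -> measurable A -> measurable (X @^-1` A).
Proof. by move=> mX mA; rewrite -[X in measurable X]setTI; exact: mX. Qed.

Section pairs.
Context {d1 d2} {T1 : measurableType d1} {T2 : measurableType d2}.
Variables (X : Omega -> T1) (Y : Omega -> T2).
Hypotheses (mX : measurable_fun setT X) (mY : measurable_fun setT Y).

Lemma measurable_pair : measurable_fun setT (fun w => (X w, Y w)).
Proof. exact: measurable_fun_pair. Qed.

(** Rectangles are stable under intersection and generate the product sigma-algebra. General
    measures are allowed because the lemma will compare a law restricted to an event with a scaled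
    law. *)
Lemma pair_law_unique (m1 m2 : {measure set (T1 * T2) -> \bar R}) :
  (m1 setT < +oo)%E ->
  (forall A B, measurable A -> measurable B -> m1 (A `*` B) = m2 (A `*` B)) ->
  forall C, measurable C -> m1 C = m2 C.
Proof.
move=> m1oo m12 C mC.
apply: (@measure_unique _ _ _ [set A `*` B | A in measurable & B in measurable]
  (fun=> setT) _ _ _ _ m1 m2) => //.
- by rewrite measurable_prod_measurableType.
- move=> _ _ [A mA [B mB <-]] [A' mA' [B' mB' <-]].
  exists (A `&` A'); first exact: measurableI.
  by exists (B `&` B'); [exact: measurableI|rewrite setXI].
- by move=> _; exists setT => //; exists setT => //; rewrite setXTT.
- by rewrite bigcup_const //; exists 0%N.
- by move=> _ [A mA [B mB <-]]; exact: m12.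
Qed.

Hypothesis XY : forall A B, measurable A -> measurable B ->
  P (X @^-1` A `&` Y @^-1` B) = (P (X @^-1` A) * P (Y @^-1` B))%E.

Let lawX := distribution P (mfun_of mX).
Let lawY := distribution P (mfun_of mY).
Let lawXY := distribution P (mfun_of measurable_pair).

Let lawXYE C : measurable C -> (lawX \x lawY)%E C = lawXY C.
Proof.
apply: product_measure_unique => A B mA mB.
by rewrite -[RHS](XY mA mB).
Qed.

Lemma ge0_integral_indep (h : T1 * T2 -> \bar R) : measurable_fun setT h ->
  (forall z, 0 <= h z)%E -> (\int[P]_w h (X w, Y w) = \int[lawX \x lawY]_z h z)%E.
Proof.
move=> mh h0; rewrite -(@ge0_integral_distribution _ _ _ _ _ P (mfun_of measurable_pair)) //.
by apply: eq_measure_integral => A mA _; apply: esym; exact: lawXYE.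
Qed.

Lemma Rintegral_indep (h : T1 * T2 -> R) (K : R) : measurable_fun setT h ->
  (forall z, `|h z| <= K) -> \int[P]_w h (X w, Y w) = \int[(lawX \x lawY)%E]_z h z.
Proof.
move=> mh hK; rewrite /Rintegral; congr fine.
have mhX : measurable_fun setT (fun w => h (X w, Y w)).
  exact: (measurableT_comp mh measurable_pair).
rewrite -(@integral_distribution _ _ _ _ _ P (mfun_of measurable_pair) (EFin \o h)) //.
- by apply: eq_measure_integral => A mA _; apply: esym; exact: lawXYE.
- exact/measurable_EFinP.
- exact: (integrable_bounded P mhX (fun w => hK _)).
Qed.

End pairs.

Lemma Rintegral_distribution {d} {T : measurableType d} (X : Omega -> T)
    (mX : measurable_fun setT X) (f : T -> R) : measurable_fun setT f ->
  P.-integrable setT (EFin \o (f \o X)) ->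
  \int[distribution P (mfun_of mX)]_y f y = \int[P]_w f (X w).
Proof.
move=> mf fi; rewrite /Rintegral; congr fine.
by rewrite (@integral_distribution _ _ _ _ _ P (mfun_of mX) (EFin \o f)) //; exact/measurable_EFinP.
Qed.

Variable V : nat -> Omega -> R.
Hypothesis mV : forall n, measurable_fun setT (V n).
Hypothesis indep : forall n (S : nat -> set R), (forall i, measurable (S i)) ->
  P (\bigcap_(i in `I_n) (V i @^-1` S i)) = (\prod_(i < n) P (V i @^-1` S i))%E.

Definition partial_sum n w : R := \sum_(i < n) V i w.

Lemma measurable_partial_sum n : measurable_fun setT (partial_sum n).
Proof. by apply: measurable_sum => i. Qed.

Let measurable_cap (n m : nat) (S : nat -> set R) : (forall i, measurable (S i)) ->
  measurable (\bigcap_(j in `I_m) (V (n + j)%N @^-1` S j)).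
Proof.
move=> mS; apply: bigcap_measurableType => j _; exact: measurable_preimage.
Qed.

(** The induction needs a whole block of later variables, not only the next one: to pass from [n] to
    [n.+1], the variable [V n] is moved from the block into the sum. With the later event [E] fixed,
    the joint law of [partial_sum V n] and [V n] factors on rectangles, hence on the event that
    their sum lies in [A]. *)
Let partial_sum_indep_future n A m (S : nat -> set R) : measurable A ->
  (forall i, measurable (S i)) ->
  P (partial_sum n @^-1` A `&` \bigcap_(j in `I_m) (V (n + j)%N @^-1` S j)) =
  (P (partial_sum n @^-1` A) * \prod_(j < m) P (V (n + j)%N @^-1` S j))%E.
Proof.
elim: n A m S => [|n IH] A m S mA mS.
  have E w : partial_sum 0 w = 0 by rewrite /partial_sum big_ord0.
  have [A0|A0] := pselect (A 0).
    have -> : partial_sum 0 @^-1` A = setT.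
      by apply/seteqP; split=> // w _ /=; rewrite E.
    by rewrite setTI probability_setT mul1e indep.
  have -> : partial_sum 0 @^-1` A = set0.
    by rewrite -subset0 => w /=; rewrite E.
  by rewrite set0I measure0 mul0e.
set E := \bigcap_(j in `I_m) _; have mE : measurable E by exact: measurable_cap.
have next B : measurable B -> forall A', measurable A' ->
    P (partial_sum n @^-1` A' `&` V n @^-1` B `&` E) =
    (P (partial_sum n @^-1` A') * P (V n @^-1` B) * \prod_(j < m) P (V (n.+1 + j)%N @^-1` S j))%E.
  (* The induction hypothesis is applied to the family [B], [S 0], [S 1], ..., one longer than the
     original block. *)
  move=> mB A' mA'; have := IH A' m.+1 (fun j => if j is k.+1 then S k else B) mA'.
  rewrite big_ord_recl /= addn0 muleA.
  under eq_bigr do rewrite /bump /= addnS.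
  move=> <-; last by case.
  congr (P _); rewrite -setIA; congr (_ `&` _); apply/seteqP; split=> w /=.
    by move=> [Bw Ew] [|j] /= jm; rewrite ?addn0 // addnS -addSn; exact: Ew.
  move=> h; split; first by have := h 0%N erefl; rewrite addn0.
  by move=> j jm; have := h j.+1 jm; rewrite /= addnS.
have next1 B A' : measurable B -> measurable A' ->
    P (partial_sum n @^-1` A' `&` V n @^-1` B) =
    (P (partial_sum n @^-1` A') * P (V n @^-1` B))%E.
  move=> mB mA'; have := IH A' 1%N (fun=> B) mA' (fun=> mB).
  rewrite big_ord1 addn0 => <-; congr (P (_ `&` _)).
  have -> : `I_1 = [set 0%N].
    by apply/seteqP; split=> j /=; [rewrite ltnS leqn0 => /eqP|move=> ->].
  by rewrite bigcap_set1 addn0.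
pose p := fine (\prod_(j < m) P (V (n.+1 + j)%N @^-1` S j))%E.
have pE : (\prod_(j < m) P (V (n.+1 + j)%N @^-1` S j) = p%:E)%E.
  rewrite fineK //; elim/big_ind: _ => // [x y|j _]; first exact: fin_numM.
  by apply: fin_num_measure; exact: measurable_preimage.
have p0 : 0 <= p.
  by rewrite fine_ge0 // prode_ge0.
have mS_ := measurable_partial_sum n.
(* [m1] is the joint law of [partial_sum V n] and [V n] restricted to [E], and [m2] is their joint
   law times the number [p], the product of the probabilities that define [E]. *)
pose m1 := pushforward (mrestr P mE) (mfun_of (measurable_pair mS_ (mV n))).
pose m2 := mscale (NngNum p0) (distribution P (mfun_of (measurable_pair mS_ (mV n)))).
have addA : measurable [set z : R * R | A (z.1 + z.2)].
  have -> : [set z : R * R | A (z.1 + z.2)] = (fun z => z.1 + z.2) @^-1` A by [].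
  rewrite -[X in measurable X]setTI.
  by apply: (measurable_funD measurable_fst measurable_snd).
have m12 : m1 [set z : R * R | A (z.1 + z.2)] = m2 [set z : R * R | A (z.1 + z.2)].
  apply: (@pair_law_unique _ _ R R m1 m2) => //.
    have mX := measurable_preimage (measurable_pair mS_ (mV n)) measurableT.
    exact: le_lt_trans (probability_le1 P (measurableI _ _ mX mE)) (ltry _).
  move=> A' B mA' mB; transitivity (P (partial_sum n @^-1` A' `&` V n @^-1` B `&` E)) => //.
  rewrite next // -(next1 _ _ mB mA') pE muleC.
  by rewrite /m2 /mscale /=.
transitivity (P (partial_sum n.+1 @^-1` A) * p%:E)%E; last by rewrite -pE.
have SE w : partial_sum n.+1 w = partial_sum n w + V n w by rewrite /partial_sum big_ord_recr.
have -> : partial_sum n.+1 @^-1` A = [set w | A (partial_sum n w + V n w)].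
  by apply/seteqP; split=> w /=; rewrite SE.
by rewrite muleC; exact: m12.
Qed.

Lemma partial_sum_indep n A B : measurable A -> measurable B ->
  P (partial_sum n @^-1` A `&` V n @^-1` B) =
  (P (partial_sum n @^-1` A) * P (V n @^-1` B))%E.
Proof.
move=> mA mB; have := partial_sum_indep_future n 1 mA (fun=> mB).
rewrite big_ord1 addn0 => <-; congr (P (_ `&` _)).
have -> : `I_1 = [set 0%N].
  by apply/seteqP; split=> j /=; [rewrite ltnS leqn0 => /eqP|move=> ->].
by rewrite bigcap_set1 addn0.
Qed.

End independence.

(** * Taylor remainders of cosine, sine and exponential *)

Section taylor_bounds.
Context {R : realType}.
Implicit Type x : R.

Lemma cosB1_le x : `|cos x - 1| <= x ^+ 2 /\ `|cos x - 1| <= `|x|.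
Proof.
have [c [+ hc]] := mean_value 0 x (fun x => is_derive_cos x).
rewrite cos0 subr0 => ->; have cx : `|c| <= `|x|.
  by move: hc; case: (leP 0 x) => x0 /andP[h1 h2]; rewrite ?(ger0_norm h1) ?(ger0_norm x0) ?(ler0_norm h2) ?(ltr0_norm x0) ?lerN2.
rewrite normrM normrN; split; last by rewrite ler_piMl // sin_max.
by rewrite -[x ^+ 2]real_normK ?num_real // expr2 ler_wpM2r // (le_trans (abs_sin_le _)).
Qed.

Lemma sinB_id_le x : `|sin x - x| <= x ^+ 2 /\ `|sin x - x| <= `|x| ^+ 3.
Proof.
have D (y : R) : is_derive y 1 (fun y : R => sin y - y) (cos y - 1).
  by apply: is_derive_eq; rewrite /GRing.scale /=; ring.
have [c [+ hc]] := mean_value 0 x D.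
rewrite sin0 !subr0 => ->; have cx : `|c| <= `|x|.
  by move: hc; case: (leP 0 x) => x0 /andP[h1 h2]; rewrite ?(ger0_norm h1) ?(ger0_norm x0) ?(ler0_norm h2) ?(ltr0_norm x0) ?lerN2.
have [c1 c2] := cosB1_le c; rewrite normrM; split.
  by rewrite -[x ^+ 2]real_normK ?num_real // expr2 ler_wpM2r // (le_trans c2).
rewrite exprSr ler_wpM2r // (le_trans c1) // -[c ^+ 2]real_normK ?num_real //.
by rewrite lerXn2r ?nnegrE.
Qed.

(** The quadratic bound lets the second moment dominate the remainder; the cubic one makes it vanish
    pointwise after rescaling. Using each for its own purpose avoids any third moment. Each bound
    follows from the mean value theorem and the bound one order lower. *)
Lemma cos_taylor2_le x : `|cos x - 1 + x ^+ 2 / 2| <= 2 * x ^+ 2 /\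
  `|cos x - 1 + x ^+ 2 / 2| <= `|x| ^+ 3.
Proof.
have [c1 _] := cosB1_le x; split.
  apply: le_trans (ler_normD _ _) _.
  rewrite [X in _ + X]ger0_norm ?divr_ge0 ?sqr_ge0 //.
  have := sqr_ge0 x; lra.
have D (y : R) : is_derive y 1 (fun y : R => cos y - 1 + y ^+ 2 / 2) (- sin y + y).
  by apply: is_derive_eq; rewrite /GRing.scale /=; field.
have [c [+ hc]] := mean_value 0 x D.
rewrite cos0 subrr expr0n mul0r addr0 !subr0 => ->; have cx : `|c| <= `|x|.
  by move: hc; case: (leP 0 x) => x0 /andP[h1 h2]; rewrite ?(ger0_norm h1) ?(ger0_norm x0) ?(ler0_norm h2) ?(ltr0_norm x0) ?lerN2.
rewrite normrM exprSr ler_wpM2r // addrC distrC.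
have [s1 _] := sinB_id_le c; apply: le_trans s1 _.
by rewrite -[c ^+ 2]real_normK ?num_real // lerXn2r ?nnegrE.
Qed.

(** From [exp x >= 1 + x] one gets [exp (- x) (1 + x) <= 1], so the left side is at most
    [x^2 / (1 + x)]. *)
Lemma expRN_taylor1 x : 0 <= x -> `|expR (- x) - 1 + x| <= x ^+ 2.
Proof.
move=> x0; have h1 := expR_ge1Dx (- x); have h2 := expR_ge1Dx x.
have e0 := expR_gt0 (- x); have : expR (- x) * expR x = 1 by rewrite mulrC expRxMexpNx_1.
rewrite ger0_norm; last lra.
move=> e; have : expR (- x) * (1 + x) <= 1 by rewrite -[leRHS]e ler_wpM2l // ltW.
nra.
Qed.

End taylor_bounds.

(** * The scalar central limit theorem for characteristic functions *)

Section scalar_clt.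
Context {R : realType} {dO} {Omega : measurableType dO} (P : probability Omega R).
Variable V : nat -> Omega -> R.
Hypothesis mV : forall n, measurable_fun setT (V n).
Hypothesis indep : forall n (S : nat -> set R), (forall i, measurable (S i)) ->
  P (\bigcap_(i in `I_n) (V i @^-1` S i)) = (\prod_(i < n) P (V i @^-1` S i))%E.
Hypothesis ident : forall n A, measurable A -> P (V n @^-1` A) = P (V 0%N @^-1` A).
Hypothesis iV : P.-integrable setT (EFin \o V 0%N).
Hypothesis iV2 : P.-integrable setT (EFin \o (fun w => V 0%N w ^+ 2)).
Hypothesis V0 : \int[P]_w V 0%N w = 0.
Let s2 : R := \int[P]_w V 0%N w ^+ 2.

Local Notation law n := (distribution P (mfun_of (mV n))).

Let lawE n (h : R -> \bar R) : (\int[law n]_x h x = \int[law 0%N]_x h x)%E.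
Proof. by apply: eq_measure_integral => A mA _; exact: ident. Qed.

Let charstep (u : R) n :
  \int[P]_w cos (u * partial_sum V n.+1 w) =
    (\int[P]_w cos (u * partial_sum V n w)) * (\int[P]_w cos (u * V 0%N w)) -
    (\int[P]_w sin (u * partial_sum V n w)) * (\int[P]_w sin (u * V 0%N w)) /\
  \int[P]_w sin (u * partial_sum V n.+1 w) =
    (\int[P]_w sin (u * partial_sum V n w)) * (\int[P]_w cos (u * V 0%N w)) +
    (\int[P]_w cos (u * partial_sum V n w)) * (\int[P]_w sin (u * V 0%N w)).
Proof.
have mS := measurable_partial_sum mV n.
have mu_ : measurable_fun setT (fun x : R => u * x) by exact: measurable_funM.
have mc := measurable_cos_comp mu_; have ms := measurable_sin_comp mu_.
have m12 : measurable_fun setT (fun z : R * R => u * z.1 + u * z.2).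
  by apply: measurable_funD; apply: measurable_funM => //.
have [hc hs] := integral_cosD (distribution P (mfun_of mS)) (law n) mu_ mu_.
have ind := partial_sum_indep mV indep n.
have Rc := Rintegral_indep mS (mV n) ind (measurable_cos_comp m12) (fun z => cos_max _).
have Rs := Rintegral_indep mS (mV n) ind (measurable_sin_comp m12) (fun z => sin_max _).
have tr (X : Omega -> R) (mX : measurable_fun setT X) (g : R -> R) :
    measurable_fun setT g -> (forall x, `|g x| <= 1) ->
    \int[distribution P (mfun_of mX)]_x g x = \int[P]_w g (X w).
  move=> mg g1; apply: Rintegral_distribution => //.
  exact: (integrable_bounded P (measurableT_comp mg mX) (fun w => g1 (X w))).
have law0 (g : R -> R) : \int[law n]_x g x = \int[law 0%N]_x g x.
  by rewrite /Rintegral lawE.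
rewrite !law0 !tr // in hc hs; try by move=> x; rewrite ?cos_max ?sin_max.
have SE w : u * partial_sum V n.+1 w = u * partial_sum V n w + u * V n w.
  by rewrite /partial_sum big_ord_recr /= mulrDr.
split.
  by under eq_Rintegral do rewrite SE; rewrite -hc -Rc.
by under eq_Rintegral do rewrite SE; rewrite -hs -Rs.
Qed.

(** Under the product law of [partial_sum V n] and [V n], the cross term vanishes since the
    variables are centered. Its use is the tightness of the normalized sums. *)
Lemma second_moment_partial_sum n :
  (\int[P]_w (partial_sum V n w ^+ 2)%:E = (n%:R * \int[P]_w V 0%N w ^+ 2)%:E)%E.
Proof.
rewrite -/s2.
elim: n => [|n IH].
  under eq_integral do rewrite /partial_sum big_ord0 expr0n.
  by rewrite integral0 mul0r.
have mS := measurable_partial_sum mV n.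
have ind := partial_sum_indep mV indep n.
have mh : measurable_fun setT (fun z : R * R => (z.1 + z.2) ^+ 2).
  by apply: measurable_funX; exact: (measurable_funD measurable_fst measurable_snd).
have meh : measurable_fun setT (fun z : R * R => ((z.1 + z.2) ^+ 2)%:E).
  exact/measurable_EFinP.
have h0 (z : R * R) : (0 <= ((z.1 + z.2) ^+ 2)%:E)%E by rewrite lee_fin sqr_ge0.
transitivity (\int[P]_w ((partial_sum V n w + V n w) ^+ 2)%:E)%E.
  by apply: eq_integral => w _; rewrite /partial_sum big_ord_recr.
rewrite (ge0_integral_indep mS (mV n) ind meh h0) fubini_tonelli1 //=.
have i0 (f : R -> R) : measurable_fun setT f -> P.-integrable setT (EFin \o (f \o V 0%N)) ->
    (law 0%N).-integrable setT (EFin \o f).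
  move=> mf jf; have emf : measurable_fun setT (EFin \o f) by exact/measurable_EFinP.
  exact: (integrable_pushforward (mV 0%N) emf (D := setT) jf measurableT).
have iid_ : (law 0%N).-integrable setT (EFin \o (fun x : R => x)) by exact: i0.
have isq : (law 0%N).-integrable setT (EFin \o (fun x : R => x ^+ 2)).
  by apply: i0.
have ist (a : R) : (law 0%N).-integrable setT (EFin \o (fun x : R => a)).
  by apply: (integrable_bounded (law 0%N) (K := `|a|)).
have inner (x : R) : (\int[law n]_y ((x + y) ^+ 2)%:E = (x ^+ 2 + s2)%:E)%E.
  rewrite lawE.
  have i2 : (law 0%N).-integrable setT (EFin \o (fun y : R => 2 * x * y)).
    exact: (integrableZl measurableT _ iid_).
  have i3 : (law 0%N).-integrable setT (EFin \o (fun y : R => 2 * x * y + y ^+ 2)).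
    exact: (integrableD measurableT i2 isq).
  have i4 : (law 0%N).-integrable setT (EFin \o (fun y : R => x ^+ 2 + (2 * x * y + y ^+ 2))).
    exact: (integrableD measurableT (ist _) i3).
  have e y : (x + y) ^+ 2 = x ^+ 2 + (2 * x * y + y ^+ 2) by ring.
  under eq_integral do rewrite e.
  rewrite -[LHS]fineK; last exact: (integrable_fin_num measurableT i4).
  congr EFin; rewrite -/(Rintegral _ _ _) RintegralD // RintegralD // RintegralZl //.
  rewrite Rintegral_prob_cst !Rintegral_distribution //.
  by rewrite V0 mulr0 add0r.
under eq_integral do rewrite /fubini_F /= inner.
have msq : measurable_fun setT (fun x : R => x ^+ 2) by exact: measurable_funX.
have s20 : 0 <= s2 by apply: Rintegral_ge0 => w _; exact: sqr_ge0.
under eq_integral do rewrite EFinD.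
rewrite ge0_integralD //=.
- rewrite (@ge0_integral_distribution _ _ _ _ _ P (mfun_of mS) (fun x => (x ^+ 2)%:E)) //.
  + rewrite /= IH integral_cst //= probability_setT mule1 -EFinD -natr1; congr EFin; ring.
  + exact/measurable_EFinP.
  + by move=> y; rewrite lee_fin sqr_ge0.
- by move=> x _; rewrite lee_fin sqr_ge0.
- exact/measurable_EFinP.
Qed.

Let integral_le1 (X : Omega -> R) (g : R -> R) : measurable_fun setT X ->
  measurable_fun setT (fun w => g (X w)) -> (forall x, `|g x| <= 1) ->
  `|\int[P]_w g (X w)| <= 1.
Proof.
move=> mX mg g1; have ig := integrable_bounded P mg (fun w => g1 (X w)).
apply: le_trans (le_normr_Rintegral measurableT ig) _.
rewrite -[leRHS](Rintegral_prob_cst P 1); apply: le_Rintegral => //.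
- by apply: (integrable_bounded P (K := 1)); [exact: measurableT_comp|move=> w; rewrite normr_id].
- by apply: (integrable_bounded P (K := 1)) => // w; rewrite normr1.
Qed.

(** The complex inequality [|phi^n - q^n| <= n |phi - q|] in real coordinates. All factors are
    bounded by 1, so each step of the recursion [charstep] adds at most one [e] to either error. *)
Let char_power (u q : R) n : 0 <= q <= 1 ->
  let e := `|\int[P]_w cos (u * V 0%N w) - q| + `|\int[P]_w sin (u * V 0%N w)| in
  `|\int[P]_w cos (u * partial_sum V n w) - q ^+ n| <= n%:R * e /\
  `|\int[P]_w sin (u * partial_sum V n w)| <= n%:R * e.
Proof.
move=> /andP[q0 q1] e; elim: n => [|n [IHc IHs]].
  have E0 w : u * partial_sum V 0 w = 0 by rewrite /partial_sum big_ord0 mulr0.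
  under eq_Rintegral do rewrite E0 cos0; under [X in _ /\ `|X| <= _]eq_Rintegral do rewrite E0 sin0.
  by rewrite !Rintegral_prob_cst expr0 subrr normr0 mul0r.
have [-> ->] := charstep u n.
have mu_ : measurable_fun setT (fun w => u * partial_sum V n w).
  by apply: measurable_funM => //; exact: measurable_partial_sum.
have cS := integral_le1 mu_ (measurable_cos_comp mu_) (@cos_max R).
have sS := integral_le1 mu_ (measurable_sin_comp mu_) (@sin_max R).
move: IHc IHs cS sS; rewrite {}/e.
set C := \int[P]_w cos (u * partial_sum V n w); set S := \int[P]_w sin (u * partial_sum V n w).
set c := \int[P]_w _; set s := \int[P]_w _ => IHc IHs cS sS.
have qm (x y : R) : `|x| <= y -> `|x * q| <= y.
  by move=> xy; rewrite normrM (ger0_norm q0); apply: le_trans xy; rewrite ler_piMr.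
have m1 (x y : R) : `|x| <= 1 -> `|x * y| <= `|y|.
  by move=> x1; rewrite normrM ler_piMl.
rewrite -natr1 mulrDl mul1r; split.
- have -> : C * c - S * s - q ^+ n.+1 = (C - q ^+ n) * q + (C * (c - q) - S * s).
    by rewrite exprSr; ring.
  apply: le_trans (ler_normD _ _) _; rewrite lerD ?qm //.
  by apply: le_trans (ler_normB _ _) _; rewrite lerD ?m1.
- have -> : S * c + C * s = S * q + (S * (c - q) + C * s) by ring.
  apply: le_trans (ler_normD _ _) _; rewrite lerD ?qm //.
  by apply: le_trans (ler_normD _ _) _; rewrite lerD ?m1.
Qed.

Let r N : R := (Num.sqrt N%:R)^-1.

Let r_ge0 N : 0 <= r N. Proof. by rewrite invr_ge0. Qed.

Let r_sqr N : r N ^+ 2 = N%:R^-1.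
Proof. by rewrite exprVn sqr_sqrtr. Qed.

Let r_cvg0 : r N @[N --> \oo] --> 0.
Proof.
apply/cvgrPdist_lt => e e0; near=> N.
have N0 : (0 : R) < N%:R by near: N; exact: nbhs_infty_gtr.
rewrite sub0r normrN ger0_norm // /r invf_plt ?posrE ?sqrtr_gt0 //.
have -> : e^-1 = Num.sqrt (e^-1 ^+ 2).
  by rewrite sqrtr_sqr ger0_norm // invr_ge0 ltW.
rewrite ltr_sqrt //.
by near: N; exact: nbhs_infty_gtr.
Unshelve. all: by end_near.
Qed.

(** At [N = 0] the left side is 0; for every other [N] it is 1. *)
Let Nr2 N : N%:R * r N ^+ 2 <= 1.
Proof.
rewrite r_sqr; have [->|N0] := eqVneq N 0%N; first by rewrite mul0r.
by rewrite mulfV // pnatr_eq0.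
Qed.

(* Dominated convergence for a second-order Taylor remainder [g]. *)
Let remainder_cvg0 (g : R -> R) : measurable_fun setT g ->
  (forall x, `|g x| <= 2 * x ^+ 2 /\ `|g x| <= `|x| ^+ 3) ->
  \int[P]_w (N%:R * g (r N * V 0%N w)) @[N --> \oo] --> 0.
Proof.
move=> mg gb; rewrite -[X in _ --> X](Rintegral_prob_cst P 0).
apply: (@dominated_cvg_Rintegral _ _ _ P _ _ (fun w => 2 * V 0%N w ^+ 2)).
- move=> N; apply: measurable_funM => //; apply: (measurableT_comp mg).
  exact: measurable_funM.
- exact: (integrableZl measurableT 2 iV2).
- move=> w; apply: (@squeeze_cvgr _ _ _ _ (fun N => - (r N * `|V 0%N w| ^+ 3))
      (fun N => r N * `|V 0%N w| ^+ 3)).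
  + apply: nearW => N; rewrite -ler_norml normrM ger0_norm //.
    apply: le_trans (ler_wpM2l _ (gb _).2) _ => //.
    rewrite normrM (ger0_norm (r_ge0 N)).
    have -> : N%:R * (r N * `|V 0%N w|) ^+ 3 =
      r N * `|V 0%N w| ^+ 3 * (N%:R * r N ^+ 2) by ring.
    by rewrite ler_piMr // mulr_ge0 // exprn_ge0.
  + rewrite -[X in _ --> X]oppr0; apply: cvgN; rewrite -[X in _ --> X](mul0r (`|V 0%N w| ^+ 3)).
    by apply: cvgM; [exact: r_cvg0|exact: cvg_cst].
  + rewrite -[X in _ --> X](mul0r (`|V 0%N w| ^+ 3)).
    by apply: cvgM; [exact: r_cvg0|exact: cvg_cst].
- move=> N w; rewrite normrM ger0_norm //.
  apply: le_trans (ler_wpM2l _ (gb _).1) _ => //.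
  by rewrite exprMn mulrCA ler_wpM2l // mulrA -[leRHS]mul1r ler_wpM2r ?sqr_ge0.
Qed.

Theorem scalar_clt :
  \int[P]_w cos ((Num.sqrt N%:R)^-1 * partial_sum V N w) @[N --> \oo] -->
    expR (- (\int[P]_w V 0%N w ^+ 2) / 2) /\
  \int[P]_w sin ((Num.sqrt N%:R)^-1 * partial_sum V N w) @[N --> \oo] --> 0.
Proof.
suff : \int[P]_w cos (r N * partial_sum V N w) @[N --> \oo] --> expR (- s2 / 2) /\
  \int[P]_w sin (r N * partial_sum V N w) @[N --> \oo] --> 0 by [].
have s20 : 0 <= s2 by apply: Rintegral_ge0 => w _; exact: sqr_ge0.
(* The value at [r N] of the characteristic function of a centered normal variable with variance
   [s2]. For [0 < N] its power [q N ^+ N] is exactly the limit, so it remains to see that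
   [N%:R * e N] tends to 0. *)
pose q N := expR (- (s2 / 2 * r N ^+ 2)).
have a0 N : 0 <= s2 / 2 * r N ^+ 2 by rewrite mulr_ge0 ?sqr_ge0 // divr_ge0.
have q01 N : 0 <= q N <= 1 by rewrite /q expR_ge0 /= -[leRHS]expR0 ler_expR oppr_le0 a0.
have mr N : measurable_fun setT (fun w => r N * V 0%N w) by exact: measurable_funM.
have ir N : P.-integrable setT (EFin \o (fun w => r N * V 0%N w)).
  exact: (integrableZl measurableT _ iV).
have ir2 N : P.-integrable setT (EFin \o (fun w => (r N * V 0%N w) ^+ 2 / 2)).
  have := integrableZl measurableT (r N ^+ 2 / 2) iV2.
  by apply: eq_integrable => // w _ /=; rewrite -EFinM; congr EFin; field.
have ic N := integrable_bounded P (measurable_cos_comp (mr N)) (fun w => cos_max _).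
have is_ N := integrable_bounded P (measurable_sin_comp (mr N)) (fun w => sin_max _).
have mc2 : measurable_fun setT (fun x : R => cos x - 1 + x ^+ 2 / 2).
  apply: measurable_funD; first by apply: measurable_funB => //; exact: measurable_cos_comp.
  by apply: measurable_funM => //; exact: measurable_funX.
have ms1 : measurable_fun setT (fun x : R => sin x - x).
  by apply: measurable_funB => //; exact: measurable_sin_comp.
have lc := remainder_cvg0 mc2 (@cos_taylor2_le R).
have sb (x : R) : `|sin x - x| <= 2 * x ^+ 2 /\ `|sin x - x| <= `|x| ^+ 3.
  have [h1 h2] := sinB_id_le x; split=> //; apply: le_trans h1 _.
  by rewrite mulr_natl mulr2n lerDl sqr_ge0.
have ls := remainder_cvg0 ms1 sb.
have i1 : P.-integrable setT (EFin \o (fun w => 1 : R)).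
  by apply: (integrable_bounded P (K := 1)) => // w; rewrite normr1.
have cE N : \int[P]_w (N%:R * (cos (r N * V 0%N w) - 1 + (r N * V 0%N w) ^+ 2 / 2)) =
    N%:R * (\int[P]_w cos (r N * V 0%N w) - 1 + s2 / 2 * r N ^+ 2).
  have j1 : P.-integrable setT (EFin \o (fun w => cos (r N * V 0%N w) - 1)).
    exact: (integrableB measurableT (ic N) i1).
  have j2 : P.-integrable setT (EFin \o (fun w => cos (r N * V 0%N w) - 1 + (r N * V 0%N w) ^+ 2 / 2)).
    exact: (integrableD measurableT j1 (ir2 N)).
  rewrite RintegralZl // RintegralD // RintegralB // Rintegral_prob_cst.
  congr (_ * (_ + _)).
  transitivity (\int[P]_w (r N ^+ 2 / 2 * V 0%N w ^+ 2)).
    by apply: eq_Rintegral => w _; field.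
  by rewrite RintegralZl // -/s2; field.
have sE N : \int[P]_w (N%:R * (sin (r N * V 0%N w) - r N * V 0%N w)) =
    N%:R * \int[P]_w sin (r N * V 0%N w).
  have j1 : P.-integrable setT (EFin \o (fun w => sin (r N * V 0%N w) - r N * V 0%N w)).
    exact: (integrableB measurableT (is_ N) (ir N)).
  by rewrite RintegralZl // RintegralB // RintegralZl // V0 mulr0 subr0.
pose e N := `|\int[P]_w cos (r N * V 0%N w) - q N| + `|\int[P]_w sin (r N * V 0%N w)|.
(* Three contributions: the second-order remainder of the cosine, the first-order remainder of the
   exponential in [q N], and the sine, whose linear term has zero integral. *)
have eE N : N%:R * e N <= `|N%:R * (\int[P]_w cos (r N * V 0%N w) - 1 + s2 / 2 * r N ^+ 2)| +
    (s2 / 2) ^+ 2 * r N ^+ 2 + `|N%:R * \int[P]_w sin (r N * V 0%N w)|.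
  rewrite mulrDr [in leRHS]normrM (ger0_norm (x := N%:R)) // normrM (ger0_norm (x := N%:R)) //.
  rewrite lerD //.
  have -> : \int[P]_w cos (r N * V 0%N w) - q N =
    (\int[P]_w cos (r N * V 0%N w) - 1 + s2 / 2 * r N ^+ 2) - (q N - 1 + s2 / 2 * r N ^+ 2) by ring.
  apply: le_trans (ler_wpM2l _ (ler_normB _ _)) _ => //; rewrite mulrDr lerD //.
  apply: le_trans (ler_wpM2l _ (expRN_taylor1 (a0 N))) _ => //.
  have -> : N%:R * (s2 / 2 * r N ^+ 2) ^+ 2 = (s2 / 2) ^+ 2 * r N ^+ 2 * (N%:R * r N ^+ 2) by ring.
  by rewrite ler_piMr // mulr_ge0 ?sqr_ge0.
have e_cvg : N%:R * e N @[N --> \oo] --> 0.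
  apply: (@squeeze_cvgr _ _ _ _ (fun=> 0) (fun N =>
    `|N%:R * (\int[P]_w cos (r N * V 0%N w) - 1 + s2 / 2 * r N ^+ 2)| +
    (s2 / 2) ^+ 2 * r N ^+ 2 + `|N%:R * \int[P]_w sin (r N * V 0%N w)|)).
  - by apply: nearW => N; rewrite eE andbT mulr_ge0 // addr_ge0.
  - exact: cvg_cst.
  - rewrite -[X in _ --> X](addr0 0) -{1}(addr0 (0 : R)) -(normr0 R).
    apply: cvgD; first apply: cvgD.
    + by apply: cvg_norm; under eq_fun do rewrite -cE; exact: lc.
    + rewrite normr0 -(mulr0 ((s2 / 2) ^+ 2)); apply: cvgM; first exact: cvg_cst.
      by rewrite -[X in _ --> X](mul0r 0); apply: cvgM; exact: r_cvg0.
    + by apply: cvg_norm; under eq_fun do rewrite -sE; exact: ls.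
have e_near (eps : R) : 0 < eps -> \forall N \near \oo, `|0 - N%:R * e N| <= eps.
  by move: eps; apply/cvgrPdist_le.
have qE N : (0 < N)%N -> q N ^+ N = expR (- s2 / 2).
  move=> N0; rewrite /q -expRM_natl; congr expR.
  by rewrite r_sqr; field; rewrite pnatr_eq0 -lt0n.
split.
- apply/cvgrPdist_le => eps eps0; near=> N.
  have N0 : (0 < N)%N by near: N; exact: nbhs_infty_gt.
  have [h _] := char_power (r N) N (q01 N).
  rewrite -(qE N N0) distrC; apply: le_trans h _.
  rewrite -/(e N); apply: le_trans (ler_norm _) _; rewrite -normrN -sub0r.
  by near: N; exact: e_near.
- apply/cvgrPdist_le => eps eps0; near=> N.
  have [_ h] := char_power (r N) N (q01 N).
  rewrite sub0r normrN; apply: le_trans h _.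
  rewrite -/(e N); apply: le_trans (ler_norm _) _; rewrite -normrN -sub0r.
  by near: N; exact: e_near.
Unshelve. all: by end_near.
Qed.

End scalar_clt.

(** * The multivariate central limit theorem with a negligible remainder *)

Section vector_clt.
Context {R : realType} {d : nat} {dO} {Omega : measurableType dO}.
Variable P : probability Omega R.
Implicit Types (t : 'cV[R]_d) (W : Omega -> 'cV[R]_d).

Lemma random_vectorB W1 W2 : random_vector W1 -> random_vector W2 ->
  random_vector (fun w => W1 w - W2 w).
Proof.
by move=> m1 m2 i; under eq_fun do rewrite !mxE; apply: measurable_funB.
Qed.

Lemma random_vectorZ (a : R) W : random_vector W -> random_vector (fun w => a *: W w).
Proof. by move=> mW i; under eq_fun do rewrite !mxE; apply: measurable_funM. Qed.

Lemma random_vector_sum (X : nat -> Omega -> 'cV[R]_d) n :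
  (forall i, random_vector (X i)) -> random_vector (fun w => \sum_(i < n) X i w).
Proof.
move=> mX i; under eq_fun do rewrite summxE.
by apply: measurable_sum => j; exact: mX.
Qed.

Lemma dot_sum t (X : nat -> Omega -> 'cV[R]_d) n w :
  dot t (\sum_(i < n) X i w) = partial_sum (fun i w => dot t (X i w)) n w.
Proof.
rewrite /partial_sum; elim: n => [|n IH]; first by rewrite !big_ord0 dot0r.
by rewrite !big_ord_recr /= dotDr IH.
Qed.

(** Off the event, the 1-Lipschitz [g] changes by at most the first term; on it, the bound by 1 on
    [g] costs at most 2. With [g] a cosine or a sine this is Slutsky's lemma for characteristic
    functions. *)
Lemma integral_lipschitz_diff (g : R -> R) W1 W2 t (e : R) : continuous g ->
  (forall x, `|g x| <= 1) -> (forall x y, `|g x - g y| <= `|x - y|) ->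
  random_vector W1 -> random_vector W2 -> 0 <= e ->
  `|\int[P]_w g (dot t (W1 w)) - \int[P]_w g (dot t (W2 w))| <=
  (\sum_i `|t i 0|) * e + 2 * fine (P [set w | e < `|W1 w - W2 w|]).
Proof.
move=> cg g1 glip m1 m2 e0.
have mg := continuous_measurable_fun cg.
have mg1 : measurable_fun setT (fun w => g (dot t (W1 w))).
  by apply: (measurableT_comp mg); exact: measurable_dot.
have mg2 : measurable_fun setT (fun w => g (dot t (W2 w))).
  by apply: (measurableT_comp mg); exact: measurable_dot.
have i1 := integrable_bounded P mg1 (fun w => g1 _).
have i2 := integrable_bounded P mg2 (fun w => g1 _).
rewrite -RintegralB //.
have iB := integrable_bounded P (measurable_funB mg1 mg2) (K := 1 + 1)
  (fun w => le_trans (ler_normB _ _) (lerD (g1 _) (g1 _))).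
apply: le_trans (le_normr_Rintegral measurableT iB) _.
set A := [set w | e < `|W1 w - W2 w|].
have mA : measurable A by apply: measurable_tail; exact: random_vectorB.
set C := \sum_i _; have C0 : 0 <= C by exact: sumr_ge0.
have j1 : P.-integrable setT (EFin \o (fun w => C * e)).
  by apply: (integrable_bounded _ (K := `|C * e|)).
have j2 : P.-integrable setT (EFin \o (\1_A : Omega -> R)).
  apply: (integrable_bounded _ (K := 1)); first exact: measurable_indic.
  by move=> w; rewrite indicE; case: (_ \in _); rewrite ?normr1 ?normr0.
have j3 : P.-integrable setT (EFin \o (fun w => 2 * (\1_A w : R))).
  exact: (integrableZl measurableT 2 j2).
have j4 : P.-integrable setT (EFin \o (fun w => C * e + 2 * (\1_A w : R))).
  exact: (integrableD measurableT j1 j3).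
rewrite -(Rintegral_indic P mA) -RintegralZl // -[X in X + _](Rintegral_prob_cst P).
rewrite -RintegralD //; apply: le_Rintegral => //; first exact: (integrable_norm iB).
move=> w _ /=; rewrite indicE; have [wA|wA] := boolP (w \in A).
  rewrite mulr1 (le_trans (ler_normB _ _)) // (le_trans (lerD (g1 _) (g1 _))) //.
  by rewrite -[leLHS]add0r lerD ?mulr_ge0 // (natrD _ 1 1).
rewrite mulr0 addr0 (le_trans (glip _ _)) // -dotNr -dotDr (le_trans (dot_le _ _)) //.
rewrite ler_wpM2l // leNgt; apply: contra wA => h; exact: mem_set.
Qed.

(** If the max norm exceeds [L], so does some coordinate in absolute value, and the sum of the [d]
    squares exceeds [L ^+ 2]. *)
Lemma markov_second_moment W (L K : R) : random_vector W -> 0 < L ->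
  (forall i, \int[P]_w (W w i 0 ^+ 2)%:E <= K%:E)%E ->
  (P [set w | (L < `|W w|)%R] <= (d%:R * K / L ^+ 2)%:E)%E.
Proof.
move=> mW L0 hK; have mA := measurable_tail L mW; set A := [set w | _] in mA *.
have L2 : 0 < L ^+ 2 by rewrite exprn_gt0.
have mW2 i : measurable_fun setT (fun w => (W w i 0 ^+ 2)%:E).
  by apply/measurable_EFinP; apply: measurable_funX; exact: mW.
have : ((L ^+ 2)%:E * P A <= \sum_(i < d) \int[P]_w (W w i 0 ^+ 2)%:E)%E.
  rewrite -ge0_integral_sum //; last by move=> i w _; rewrite lee_fin sqr_ge0.
  have -> : ((L ^+ 2)%:E * P A = \int[P]_w ((L ^+ 2)%:E * (\1_A w)%:E))%E.
    rewrite ge0_integralZl //; [by rewrite integral_indic // setIT| |].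
    - by apply/measurable_EFinP; exact: measurable_indic.
    - by rewrite lee_fin ltW.
  apply: ge0_le_integral => //.
  - by move=> w _; rewrite -EFinM lee_fin mulr_ge0 // ltW.
  - by apply/measurable_EFinP; apply: measurable_funM => //; exact: measurable_indic.
  - by apply: emeasurable_sum => i; exact: mW2.
  move=> w _; rewrite -EFinM sumEFin lee_fin indicE; have [wA|wA] := boolP (w \in A); last first.
    by rewrite mulr0 sumr_ge0 // => i _; exact: sqr_ge0.
  have : L < `|W w| by exact: (set_mem wA).
  rewrite mulr1 ltNge (cV_norm_le _ (ltW L0)).
  rewrite negb_forall => /existsP[i]; rewrite -ltNge => /ltW h.
  rewrite (bigD1 i) //= -[leLHS]addr0 lerD //; last by apply: sumr_ge0 => j _; exact: sqr_ge0.
  by rewrite -[leRHS]real_normK ?num_real // lerXn2r // nnegrE ltW.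
have -> : P A = (fine (P A))%:E by rewrite fineK // fin_num_measure.
rewrite -EFinM => h; rewrite lee_fin ler_pdivlMr // mulrC -lee_fin; apply: le_trans h _.
apply: (@le_trans _ _ (\sum_(i < d) K%:E)%E); first by apply: lee_sum => i _; exact: hK.
by rewrite sumEFin sumr_const card_ord mulr_natl.
Qed.

Variables (X : nat -> Omega -> 'cV[R]_d) (W : nat -> Omega -> 'cV[R]_d) (V : 'M[R]_d).
Hypothesis mX : forall i, random_vector (X i).
Hypothesis mW : forall N, random_vector (W N).
Hypothesis pV : psd V.
Hypothesis indep : forall t n (S : nat -> set R), (forall i, measurable (S i)) ->
  P (\bigcap_(i in `I_n) ((fun w => dot t (X i w)) @^-1` S i)) =
  (\prod_(i < n) P ((fun w => dot t (X i w)) @^-1` S i))%E.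
Hypothesis ident : forall t n A, measurable A ->
  P ((fun w => dot t (X n w)) @^-1` A) = P ((fun w => dot t (X 0%N w)) @^-1` A).
Hypothesis iX : forall t, P.-integrable setT (EFin \o (fun w => dot t (X 0%N w))).
Hypothesis iX2 : forall t, P.-integrable setT (EFin \o (fun w => dot t (X 0%N w) ^+ 2)).
Hypothesis X_mean : forall t, \int[P]_w dot t (X 0%N w) = 0.
Hypothesis X_var : forall t, \int[P]_w dot t (X 0%N w) ^+ 2 = bform V t t.
Hypothesis W_oP : is_oP P (fun=> 1)
  (fun N w => W N w - (Num.sqrt N%:R)^-1 *: \sum_(i < N) X i w).

Let T N w := (Num.sqrt N%:R : R)^-1 *: \sum_(i < N) X i w.

Let mT N : random_vector (T N).
Proof. by apply: random_vectorZ; exact: random_vector_sum. Qed.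

Let mdot t i : measurable_fun setT (fun w => dot t (X i w)).
Proof. exact: measurable_dot. Qed.

Let dotT t N w : dot t (T N w) =
  (Num.sqrt N%:R)^-1 * partial_sum (fun i w => dot t (X i w)) N w.
Proof. by rewrite /T dotZr dot_sum. Qed.

Let T_second_moment N i : (\int[P]_w (T N w i 0 ^+ 2)%:E <= (V i i)%:E)%E.
Proof.
have m := second_moment_partial_sum (mdot (delta_mx i 0)) (indep (delta_mx i 0))
  (ident (delta_mx i 0)) (iX _) (iX2 _) (X_mean _) N.
have mS := measurable_partial_sum (mdot (delta_mx i 0)) N.
have -> : (\int[P]_w (T N w i 0 ^+ 2)%:E = ((Num.sqrt N%:R : R)^-1 ^+ 2)%:E *
   \int[P]_w (partial_sum (fun i0 w => dot (delta_mx i 0) (X i0 w)) N w ^+ 2)%:E)%E.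
  rewrite -ge0_integralZl //.
  - by apply: eq_integral => w _; rewrite -EFinM -exprMn -dotT dot_delta.
  - by apply/measurable_EFinP; apply: measurable_funX.
  - by move=> w _; rewrite lee_fin sqr_ge0.
rewrite m X_var bform_delta -EFinM lee_fin exprVn sqr_sqrtr // mulrA.
have V0 : 0 <= V i i by rewrite -bform_delta; case: pV => _; exact.
have [->|N0] := eqVneq N 0%N; first by rewrite mulr0 mul0r.
by rewrite mulVf ?pnatr_eq0 // mul1r.
Qed.

Let tail_cvg0 (e : R) : 0 < e ->
  fine (P [set w | e < `|W N w - T N w|]) @[N --> \oo] --> 0.
Proof.
move=> e0; have := W_oP e0; rewrite -[0%E]/(0%:E : \bar R) => /fine_cvg.
by under eq_fun do rewrite mulr1.
Qed.

Let slutsky (g : R -> R) t (l : R) : continuous g ->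
  (forall x, `|g x| <= 1) -> (forall x y, `|g x - g y| <= `|x - y|) ->
  \int[P]_w g (dot t (T N w)) @[N --> \oo] --> l ->
  \int[P]_w g (dot t (W N w)) @[N --> \oo] --> l.
Proof.
move=> cg g1 glip cT; apply/cvgrPdist_le => eps eps0.
set C := \sum_i `|t i 0|; have C0 : 0 <= C by exact: sumr_ge0.
(* The budget is [eps / 3] for the normalized sums, [eps / 3] for the Lipschitz part and twice
   [eps / 6] for the exceptional event. *)
pose e := eps / 3 / (C + 1).
have e0 : 0 < e by rewrite !divr_gt0 // ltr_wpDl.
have Ce : C * e <= eps / 3.
  rewrite /e mulrCA; apply: ler_piMr; first by rewrite divr_ge0 // ltW.
  by rewrite ler_pdivrMr ?mul1r ?lerDl // ltr_wpDl.
near=> N.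
have h1 : `|l - \int[P]_w g (dot t (T N w))| <= eps / 3.
  by near: N; move: (eps / 3) (divr_gt0 eps0 (ltr0n R 3)); apply/cvgrPdist_le.
have h2 : `|0 - fine (P [set w | e < `|W N w - T N w|])| <= eps / 6.
  near: N; move: (eps / 6) (divr_gt0 eps0 (ltr0n R 6)); apply/cvgrPdist_le.
  exact: tail_cvg0.
have h3 := integral_lipschitz_diff t cg g1 glip (mW N) (mT N) (ltW e0).
rewrite -/C in h3; move: h1 h2 h3; rewrite !ler_norml; lra.
Unshelve. all: by end_near.
Qed.

Let W_tight (e : R) : 0 < e ->
  exists L : R, \forall N \near \oo, (P [set w | (L < `|W N w|)%R] <= e%:E)%E.
Proof.
move=> e0; pose K := \sum_i V i i.
have V0 i : 0 <= V i i by rewrite -bform_delta; case: pV => _; exact.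
have K0 : 0 <= K by exact: sumr_ge0.
(* Chosen so that [e * L >= 2 * (d%:R * K)] and [L >= 1]: then [e * L ^+ 2] is at least as large,
   and the Markov bound is at most [e / 2]. The other half of [e] is for the event that the
   remainder exceeds 1. *)
pose L := 2 * (d%:R * K) / e + 1.
have L1 : 1 <= L.
  by rewrite lerDr; apply: divr_ge0; [rewrite !mulr_ge0|exact: ltW].
have L0 : 0 < L by exact: lt_le_trans L1.
have PT N : (P [set w | (L < `|T N w|)%R] <= (e / 2)%:E)%E.
  apply: le_trans (markov_second_moment (K := K) (mT N) L0 _) _.
    move=> i; apply: le_trans (T_second_moment N i) _.
    by rewrite lee_fin /K (bigD1 i) //= lerDl sumr_ge0.
  rewrite lee_fin ler_pdivrMr ?exprn_gt0 //.
  have h : 2 * (d%:R * K) <= e * L.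
    have -> : e * L = 2 * (d%:R * K) + e by rewrite /L; field; rewrite gt_eqF.
    by rewrite lerDl ltW.
  have : e * L <= e * L ^+ 2.
    apply: ler_wpM2l; first exact: ltW.
    by rewrite expr2; apply: ler_peMr => //; exact: ltW.
  lra.
exists (L + 1); near=> N.
have h2 : `|0 - fine (P [set w | 1 < `|W N w - T N w|])| <= e / 2.
  near: N; move: (e / 2) (divr_gt0 e0 (ltr0n R 2)); apply/cvgrPdist_le.
  exact: tail_cvg0.
have m1 : measurable [set w | L < `|T N w|] by exact: measurable_tail.
have m2 : measurable [set w | 1 < `|W N w - T N w|].
  by apply: measurable_tail; exact: random_vectorB.
apply: (@le_trans _ _ (P ([set w | L < `|T N w|] `|` [set w | 1 < `|W N w - T N w|]))).
  apply: le_measure; [exact/mem_set/measurable_tail|exact/mem_set/measurableU|].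
  move=> w /= hw; apply/orP; apply: contraT; rewrite negb_or -!leNgt => /andP[h3 h4].
  suff : `|W N w| <= L + 1 by rewrite leNgt hw.
  by rewrite -[W N w](subrK (T N w)) addrC (le_trans (ler_normD _ _)) // lerD.
apply: le_trans (measureU2 P m1 m2) _; rewrite (splitr e) EFinD; apply: leeD; first exact: PT.
rewrite -[leLHS]fineK ?fin_num_measure // lee_fin.
by rewrite sub0r normrN in h2; exact: le_trans (ler_norm _) h2.
Unshelve. all: by end_near.
Qed.

(** The Cramer-Wold reduction: for each [t] the scalar theorem applies to [dot t (X i w)], and its
    limit is the characteristic function at [t] of the Gaussian vector with covariance [V]. *)
Theorem vector_clt : asymptotically_normal P W V.
Proof.
have [dT [S [Q [Z [NZ QZ]]]]] := gaussian_exists pV.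
exists dT, S, Q, Z; split => //; have [_ mZ _] := NZ.
have c t := scalar_clt (mdot t) (indep t) (ident t) (iX t) (iX2 t) (X_mean t).
apply: (levy_continuity mW mZ _ _ W_tight) => t.
- apply: slutsky; [exact: continuous_cos|exact: cos_max|exact: cosB_le|].
  rewrite (QZ t).1 -X_var; under eq_fun do under eq_Rintegral do rewrite dotT.
  exact: (c t).1.
- apply: slutsky; [exact: continuous_sin|exact: sin_max|exact: sinB_le|].
  rewrite (QZ t).2; under eq_fun do under eq_Rintegral do rewrite dotT.
  exact: (c t).2.
Qed.

End vector_clt.

(** * Domination, sections and iterated real integrals *)

Section integral_lemmas.
Context {R : realType}.

Lemma ae_eq_Rintegral {d} {T : measurableType d} (mu : {measure set T -> \bar R})
    (f g : T -> R) : measurable_fun setT f -> measurable_fun setT g ->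
  {ae mu, forall x, f x = g x} -> \int[mu]_x f x = \int[mu]_x g x.
Proof.
move=> mf mg fg; rewrite /Rintegral; congr fine; apply: ae_eq_integral => //.
- exact/measurable_EFinP.
- exact/measurable_EFinP.
- by apply: filterS fg => x -> _.
Qed.

(* [w * a * b] is dominated by [w * a^2 + w * b^2]. *)
Lemma integrable_weighted_mul {d} {T : measurableType d} (mu : {measure set T -> \bar R})
    (w a b : T -> R) : measurable_fun setT w -> measurable_fun setT a ->
  measurable_fun setT b -> (forall x, 0 <= w x) ->
  mu.-integrable setT (EFin \o (fun x => w x * a x ^+ 2)) ->
  mu.-integrable setT (EFin \o (fun x => w x * b x ^+ 2)) ->
  mu.-integrable setT (EFin \o (fun x => w x * (a x * b x))).
Proof.
move=> mw ma mb w0 ia ib.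
have iab : mu.-integrable setT (EFin \o (fun x => w x * a x ^+ 2 + w x * b x ^+ 2)).
  exact: (integrableD measurableT ia ib).
apply: le_integrable iab => //.
  by apply/measurable_EFinP; apply: measurable_funM => //; exact: measurable_funM.
move=> x _; rewrite lee_fin [leRHS]ger0_norm; last first.
  by rewrite addr_ge0 // mulr_ge0 // sqr_ge0.
rewrite -mulrDr normrM (ger0_norm (w0 x)) ler_wpM2l //.
rewrite ler_norml; have := sqr_ge0 (a x); have := sqr_ge0 (b x).
have := sqr_ge0 (a x + b x); have := sqr_ge0 (a x - b x); nra.
Qed.

Context {dX dY} {X : measurableType dX} {Y : measurableType dY}.
Variables (lam : {sigma_finite_measure set X -> \bar R}).
Variables (nu : {sigma_finite_measure set Y -> \bar R}).

Lemma measurable_section (g : X -> Y -> R) x :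
  measurable_fun setT (fun z : X * Y => g z.1 z.2) -> measurable_fun setT (g x).
Proof. by move=> mg; exact: (measurable_fun_pair2 x mg). Qed.

Lemma measurable_Rintegral (g : X -> Y -> R) :
  measurable_fun setT (fun z : X * Y => g z.1 z.2) ->
  measurable_fun setT (fun x => \int[nu]_y g x y).
Proof.
move=> mg; have meg : measurable_fun setT (fun z : X * Y => (g z.1 z.2)%:E).
  exact/measurable_EFinP.
apply: (measurableT_comp (f := fine)); first exact: fine_measurable.
pose G (z : X * Y) := (g z.1 z.2)%:E.
have -> : (fun x => \int[nu]_y (g x y)%:E)%E = (fubini_F nu G^\+ \- fubini_F nu G^\-)%E.
  apply/funext => x; rewrite [LHS]integralE /fubini_F.
  have -> : (fun y => (g x y)%:E) = G \o (fun y => (x, y)) by [].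
  by rewrite funepos_comp funeneg_comp.
apply: emeasurable_funB; apply: measurable_fun_fubini_tonelli_F => //; last first.
- exact: measurable_funeneg.
- exact: measurable_funepos.
Qed.

(** The real inner integral has only a default value where a section is not integrable; by Fubini
    such [x] form a null set. *)
Lemma Rintegral_product (g : X -> Y -> R) :
  (lam \x nu)%E.-integrable setT (fun z => (g z.1 z.2)%:E) ->
  \int[(lam \x nu)%E]_z g z.1 z.2 = \int[lam]_x \int[nu]_y g x y.
Proof.
move=> ig; rewrite {1}/Rintegral -(integral12_prod_meas1 ig) /Rintegral; congr fine.
have mg : measurable_fun setT (fun z : X * Y => g z.1 z.2).
  by apply/measurable_EFinP; exact: (measurable_int _ ig).
apply: ae_eq_integral => //.
- exact: (measurable_int lam (integrable_fubini_F ig)).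
- by apply/measurable_EFinP; exact: measurable_Rintegral.
- have := ae_integrable1 ig; apply: filterS => x ix _.
  by rewrite /fubini_F /= fineK //; exact: (integrable_fin_num measurableT ix).
Qed.

End integral_lemmas.

(** * Directional derivatives of a logarithm and at a minimum *)

Section directional_derivatives.
Context {R : realType} {V : normedModType R}.
Implicit Types (f : V -> R) (a v : V).

(** A directional derivative does not entail differentiability, so the chain rule for the logarithm
    is applied to the restriction of [f] to a line, a function of one real variable. *)
Lemma derive_line f a v : let phi (h : R) : R := f (h *: v + a) in
  (derivable f a v -> derivable phi 0 1) /\ 'D_v f a = 'D_1 phi 0.
Proof.
move=> phi.
have E : (fun h : R => h^-1 *: ((f \o shift a) (h *: v) - f a)) =
    (fun h : R => h^-1 *: ((phi \o shift 0) (h *: 1) - phi 0)).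
  apply/funext => h; rewrite /phi /= scale0r add0r addr0.
  by rewrite [h *: 1]mulr1.
by split; [rewrite /derivable E|rewrite /derive E].
Qed.

Lemma derive_ln f a v : derivable f a v -> 0 < f a ->
  'D_v (fun t => ln (f t)) a = 'D_v f a / f a.
Proof.
move=> df fa; have [dphi ->] := derive_line f a v.
have [_ ->] := derive_line (fun t => ln (f t)) a v.
set phi := fun h : R => f (h *: v + a) in dphi *.
have phi0 : phi 0 = f a by rewrite /phi scale0r add0r.
have dln : is_derive (phi 0) 1 (@ln R) (phi 0)^-1 by apply: is_derive1_ln; rewrite phi0.
rewrite -[LHS]derive1E (derive1_comp (f := phi) (g := @ln R)) //; last exact: dphi.
by rewrite !derive1E derive_val phi0 mulrC.
Qed.

(** The difference quotients at [h] and [- h] have opposite signs and both come close to the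
    derivative. This settles the points where a density vanishes, at which the derivative of its
    logarithm gives no information. *)
Lemma derive_at_zero_min f a v : derivable f a v -> f a = 0 ->
  (\forall t \near a, 0 <= f t) -> 'D_v f a = 0.
Proof.
move=> df fa f0.
have c : (fun h : R => h *: v + a) @ (0 : R) --> a.
  rewrite -[X in _ --> X]add0r -(scale0r v); apply: cvgD; last exact: cvg_cst.
  by apply: cvgZr_tmp; exact: cvg_id.
have nf : \forall h \near (0 : R), 0 <= f (h *: v + a) by exact: (c _ f0).
have nf' : \forall h \near (0 : R)^', 0 <= f (h *: v + a).
  exact: (cvg_within _ nf).
have df' := df; move: df' => /cvg_ex[/= l lP].
have -> : 'D_v f a = l by exact: cvg_lim.
apply/eqP; rewrite -normr_le0; apply/ler_addgt0Pl => e e0; rewrite addr0.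
move/cvgrPdist_lt : lP => /(_ e e0) lP.
have [d0 /= d0_gt0 hd] : exists2 d0 : R, 0 < d0 & forall h, `|h| < d0 -> h != 0 ->
    0 <= f (h *: v + a) /\ `|l - h^-1 * f (h *: v + a)| < e.
  have [d0 /= d0_gt0 hd] := filterI nf' lP.
  exists d0 => // h hd0 h0.
  have [] := hd h; first by rewrite /ball /= sub0r normrN.
    exact: h0.
  by move=> h1; rewrite fa subr0.
pose h := d0 / 2; have h0 : 0 < h by rewrite divr_gt0.
have hlt : `|h| < d0 by rewrite ger0_norm ?ltW // /h; lra.
have [h1 h2] := hd h hlt (lt0r_neq0 h0).
have [] := hd (- h); rewrite ?normrN ?oppr_eq0 ?lt0r_neq0 // => h3 h4.
have h5 : 0 <= h^-1 * f (h *: v + a) by rewrite mulr_ge0 // invr_ge0 ltW.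
have h6 : 0 <= h^-1 * f (- h *: v + a) by rewrite mulr_ge0 // invr_ge0 ltW.
move: h2 h4; rewrite invrN mulNr opprK !ltr_norml ler_norml; lra.
Qed.

End directional_derivatives.

(** * From integrals of the sample to integrals of the sampled density *)

Section sampled_data.
Context {R : realType} {d : nat} {dX dY : measure_display}.
Context {X : measurableType dX} {Y : measurableType dY}.
Variables (m : model R d X Y) (theta : 'cV[R]_d).
Hypothesis theta_in : Theta m theta.
Local Notation mu := (lam m \x nu m)%E.

Definition full_density x y : R := fX m x * f m theta x y.

(* The joint density of (x, y) restricted to delta = 1. *)
Definition sampled_density x y : R := fX m x * (f m theta x y * samp m x y).

Lemma full_density_ge0 x y : 0 <= full_density x y.
Proof. by rewrite mulr_ge0 ?fX_ge0 ?f_ge0. Qed.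

Lemma sampled_density_ge0 x y : 0 <= sampled_density x y.
Proof. by rewrite !mulr_ge0 ?fX_ge0 ?f_ge0 // ltW ?samp_gt0. Qed.

Lemma measurable_full_density :
  measurable_fun setT (fun z : X * Y => full_density z.1 z.2).
Proof.
apply: measurable_funM; last exact: measurable_f.
by apply: (measurableT_comp (measurable_fX m)).
Qed.

Lemma measurable_sampled_density :
  measurable_fun setT (fun z : X * Y => sampled_density z.1 z.2).
Proof.
apply: measurable_funM; first by apply: (measurableT_comp (measurable_fX m)).
by apply: measurable_funM; [exact: measurable_f|exact: measurable_samp].
Qed.

Lemma integrable_full_density :
  mu.-integrable setT (fun z => (full_density z.1 z.2)%:E).
Proof.
have mf : measurable_fun setT (fun z : X * Y => (full_density z.1 z.2)%:E).
  by apply/measurable_EFinP; exact: measurable_full_density.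
apply/(integrable12ltyP _ _ mf).
have -> : (\int[lam m]_x \int[nu m]_y `|(full_density (x, y).1 (x, y).2)%:E| =
    \int[lam m]_x (fX m x)%:E)%E.
  apply: eq_integral => x _; rewrite -[RHS]mule1 -(integral_f x theta_in).
  rewrite -ge0_integralZl //.
  - by apply: eq_integral => y _; rewrite /= -EFinM ger0_norm // full_density_ge0.
  - by apply/measurable_EFinP; exact: (measurable_section x (measurable_f theta_in)).
  - by move=> y _; rewrite lee_fin f_ge0.
  - by rewrite lee_fin fX_ge0.
by rewrite integral_fX ltry.
Qed.

Context {dO : measure_display} {Omega : measurableType dO}.
Variable P : probability Omega R.
Variables (x_ : nat -> Omega -> X) (y_ : nat -> Omega -> Y).
Variable delta_ : nat -> Omega -> bool.
Hypothesis sample : iid_sample m P x_ y_ delta_ theta.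

Lemma measurable_natr_bool : measurable_fun setT (fun b : bool => b%:R : R).
Proof. by move=> _ B _; rewrite setTI. Qed.

Lemma measurable_delta_mul (h : X -> Y -> R) :
  measurable_fun setT (fun z : X * Y => h z.1 z.2) ->
  measurable_fun setT (fun t : X * Y * bool => t.2%:R * h t.1.1 t.1.2).
Proof.
move=> mh; apply: measurable_funM; first exact: (measurableT_comp measurable_natr_bool).
exact: (measurableT_comp mh measurable_fst).
Qed.

(** The law of a triple is known on events, where it is a mixture of a part with [delta = 1] and a
    part with [delta = 0]; the mixture formula extends this to integrals, and the factor [delta]
    removes the second part. *)
Lemma integral_sample i (h : X -> Y -> R) :
  measurable_fun setT (fun z : X * Y => h z.1 z.2) ->
  mu.-integrable setT (fun z => (sampled_density z.1 z.2 * h z.1 z.2)%:E) ->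
  P.-integrable setT (EFin \o (fun w => (delta_ i w)%:R * h (x_ i w) (y_ i w))) /\
  \int[P]_w ((delta_ i w)%:R * h (x_ i w) (y_ i w)) =
    \int[mu]_z (sampled_density z.1 z.2 * h z.1 z.2).
Proof.
move=> mh ih; have [mZ _ ZE] := sample.
pose H (t : X * Y * bool) : R := t.2%:R * h t.1.1 t.1.2.
have mH : measurable_fun setT H by exact: measurable_delta_mul.
pose Q := distribution P (mfun_of (mZ i)).
pose w2 (z : X * Y) := full_density z.1 z.2 * (1 - samp m z.1 z.2).
have w2_ge0 z : 0 <= w2 z by rewrite mulr_ge0 ?full_density_ge0 // subr_ge0 samp_le1.
have mw2 : measurable_fun setT w2.
  apply: measurable_funM; first exact: measurable_full_density.
  by apply: measurable_funB => //; exact: measurable_samp.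
have mp (b : bool) : measurable_fun setT (fun z : X * Y => (z, b)).
  exact: measurable_fun_pair.
have QE (A : set (X * Y * bool)) : measurable A -> Q A =
    (\int[mu]_z (sampled_density z.1 z.2 * \1_A (z, true) + w2 z * \1_A (z, false))%:E)%E.
  move=> mA; have -> : Q A = (expect m theta (fun x y b => \1_A (x, y, b)))%:E.
    exact: (ZE i A mA).
  (* [expect] is a real number, so it yields the measure of [A] only once the integral is known to
     be finite. The integrable full density dominates it. *)
  rewrite /expect /Rintegral fineK.
    apply: eq_integral => -[x y] _; congr EFin.
    by rewrite /expect_integrand /cexp_integrand /mean_delta /sampled_density /w2 /full_density /=; ring.
  apply: integrable_fin_num => //; apply: le_integrable integrable_full_density => //.
    have mi b : measurable_fun setT (fun z : X * Y => \1_A (z, b) : R).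
      by apply: (measurableT_comp (measurable_indic mA)).
    apply/measurable_EFinP; apply: measurable_funM.
      by apply: (measurableT_comp (measurable_fX m)).
    apply: measurable_funM; first exact: measurable_f.
    apply: measurable_funD; apply: measurable_funM.
    - exact: measurable_samp.
    - by have := mi true; congr measurable_fun; apply/funext => -[].
    - by apply: measurable_funB => //; exact: measurable_samp.
    - by have := mi false; congr measurable_fun; apply/funext => -[].
  move=> [x y] _; rewrite lee_fin /expect_integrand /cexp_integrand /mean_delta /=.
  rewrite /full_density !mulrA normrM [leRHS]ger0_norm ?full_density_ge0 //.
  rewrite ger0_norm ?full_density_ge0 // ler_piMr ?full_density_ge0 //.
  have s0 := samp_gt0 m x y; have s1 := samp_le1 m x y.
  by rewrite !indicE; do 2 case: (_ \in _); rewrite /= ?mulr1 ?mulr0 ler_norml; lra.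
have iQ : Q.-integrable setT (EFin \o H).
  apply: (@integrable_mix R _ _ _ _ mu Q (fun z => sampled_density z.1 z.2) w2
      (fun z => (z, true)) (fun z => (z, false))) => //.
  - exact: measurable_sampled_density.
  - by move=> z; exact: sampled_density_ge0.
  have := integrable_norm ih; apply: eq_integrable => // z _ /=.
  by rewrite /H /= mul1r mul0r normr0 mulr0 addr0 normrM (ger0_norm (sampled_density_ge0 _ _)).
have iP : P.-integrable setT (EFin \o (fun w => (delta_ i w)%:R * h (x_ i w) (y_ i w))).
  apply/integrableP; split.
    by apply/measurable_EFinP; exact: (measurableT_comp mH (mZ i)).
  move/integrableP: iQ => [_].
  by rewrite (@ge0_integral_distribution _ _ _ _ _ P (mfun_of (mZ i)) (fun t => `|(H t)%:E|)%E) //;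
    apply/measurable_EFinP; exact: measurableT_comp.
split=> //; rewrite -(@Rintegral_distribution _ _ _ _ _ _ _ (mZ i) H mH iP).
rewrite (@Rintegral_mix R _ _ _ _ mu Q (fun z => sampled_density z.1 z.2) w2
      (fun z => (z, true)) (fun z => (z, false))) //.
- by apply: eq_Rintegral => z _; rewrite /H /= mul1r mul0r mulr0 addr0.
- exact: measurable_sampled_density.
- by move=> z; exact: sampled_density_ge0.
Qed.

End sampled_data.

(** * Identities that hold for almost every covariate value *)

Section conditional_integrals.
Context {R : realType} {d : nat} {dX dY : measure_display}.
Context {X : measurableType dX} {Y : measurableType dY}.
Variables (m : model R d X Y).
Local Notation mu := (lam m \x nu m)%E.

Lemma ae_x_section (g : X -> Y -> R) :
  mu.-integrable setT (fun z => (fX m z.1 * g z.1 z.2)%:E) ->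
  ae_x m (fun x => (nu m).-integrable setT (EFin \o g x)).
Proof.
move=> ig; have := ae_integrable1 ig; apply: filterS => x ix fx0.
have := integrableZl measurableT (fX m x)^-1 ix; apply: eq_integrable => // y _ /=.
by rewrite -EFinM mulKf // gt_eqF.
Qed.

(** Where [fX m x] is zero both integrands vanish, and where it is positive it factors out of the
    inner integrals; an identity in the sense of [ae_x] is therefore enough. *)
Lemma eq_Rintegral_ae_x (g h : X -> Y -> R) :
  mu.-integrable setT (fun z => (fX m z.1 * g z.1 z.2)%:E) ->
  mu.-integrable setT (fun z => (fX m z.1 * h z.1 z.2)%:E) ->
  ae_x m (fun x => \int[nu m]_y g x y = \int[nu m]_y h x y) ->
  \int[mu]_z (fX m z.1 * g z.1 z.2) = \int[mu]_z (fX m z.1 * h z.1 z.2).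
Proof.
move=> ig ih gh.
have mg (k : X -> Y -> R) : mu.-integrable setT (fun z => (fX m z.1 * k z.1 z.2)%:E) ->
    measurable_fun setT (fun x => \int[nu m]_y (fX m x * k x y)).
  move=> ik; apply: (@measurable_Rintegral _ _ _ _ _ (nu m) (fun x y => fX m x * k x y)).
  by apply/measurable_EFinP; exact: (measurable_int _ ik).
rewrite (@Rintegral_product _ _ _ _ _ (lam m) (nu m) (fun x y => fX m x * g x y)) //.
rewrite (@Rintegral_product _ _ _ _ _ (lam m) (nu m) (fun x y => fX m x * h x y)) //.
apply: ae_eq_Rintegral; [exact: mg|exact: mg|].
move: (ae_x_section ig) (ae_x_section ih) gh; rewrite /ae_x.
apply: filterS3 => x gx hx ghx.
have := fX_ge0 m x; rewrite le_eqVlt => /predU1P[fx0|fx0].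
  by apply: eq_Rintegral => y _; rewrite -fx0 !mul0r.
have jg := gx fx0; have jh := hx fx0.
by rewrite !RintegralZl // ghx.
Qed.

End conditional_integrals.

(** * Second moments of the sampled data conditional score *)

Lemma outerE {R : realType} {d : nat} (a : 'cV[R]_d) i j : outer a i j = a i 0 * a j 0.
Proof. by rewrite /outer mxE big_ord1 mxE. Qed.

Lemma scale_subE {R : realType} {p q : nat} (a b : R) (A B : 'M[R]_(p, q)) i j :
  (a *: A - b *: B) i j = a * A i j - b * B i j.
Proof. by rewrite !mxE. Qed.

Definition Sigma_density {R : realType} {d : nat} {dX dY} {X : measurableType dX}
    {Y : measurableType dY} (m : model R d X Y) (theta : 'cV[R]_d) i j x y : R :=
  samp m x y * (score m theta x y i 0 * score m theta x y j 0) -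
  (pibar m theta x)^-1 * (cscore_pi m theta x i 0 * cscore_pi m theta x j 0).

Section score_moments.
Context {R : realType} {d : nat} {dX dY : measure_display}.
Context {X : measurableType dX} {Y : measurableType dY}.
Variables (m : model R d X Y) (theta : 'cV[R]_d).
Hypothesis theta_in : Theta m theta.
Hypothesis measurable_score : forall i : 'I_d,
  measurable_fun setT (fun z : X * Y => score m theta z.1 z.2 i 0).
Hypothesis Sigma_finite : expect_exists m theta (Sigma_integrand m theta).
Local Notation mu := (lam m \x nu m)%E.
Local Notation s i x y := (score m theta x y i 0).
Local Notation c i x := (cscore_pi m theta x i 0).
Local Notation sS i x y := (score_S m theta x y i 0).
Local Notation ip x := ((pibar m theta x)^-1).
Let p x y := f m theta x y * samp m x y.
Local Notation sigma := (Sigma_density m theta).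

Let p_ge0 x y : 0 <= p x y.
Proof. by rewrite mulr_ge0 ?f_ge0 // ltW ?samp_gt0. Qed.

Let measurable_p : measurable_fun setT (fun z : X * Y => p z.1 z.2).
Proof. by apply: measurable_funM; [exact: measurable_f|exact: measurable_samp]. Qed.

Lemma cscore_piE i x : c i x = \int[nu m]_y (p x y * s i x y).
Proof.
rewrite /cscore_pi mxE; apply: eq_Rintegral => y _.
by rewrite /cexp_integrand /mean_delta !mxE /p; ring.
Qed.

Lemma score_SE i x y : sS i x y = s i x y - ip x * c i x.
Proof. by rewrite /score_S !mxE. Qed.

Let Sigma_integrandE i j x y b : Sigma_integrand m theta x y b i j = sigma i j x y.
Proof. by rewrite /Sigma_integrand scale_subE !outerE. Qed.

Let measurable_pibar : measurable_fun setT (fun x => pibar m theta x).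
Proof. exact: (@measurable_Rintegral _ _ _ _ _ (nu m) p measurable_p). Qed.

Let measurable_cscore i : measurable_fun setT (fun x => c i x).
Proof.
under eq_fun do rewrite cscore_piE.
apply: (@measurable_Rintegral _ _ _ _ _ (nu m) (fun x y => p x y * s i x y)).
by apply: measurable_funM; [exact: measurable_p|exact: measurable_score].
Qed.

(** [pibar] is nonnegative and [0^-1 = 0], so the inverse is the measurable function [expR (- ln p)]
    cut off outside of the positive half-line. *)
Let measurable_ip : measurable_fun setT (fun x => ip x).
Proof.
have -> : (fun x => ip x) =
    (fun x => expR (- ln (pibar m theta x)) * \1_(`]0%R, +oo[%classic) (pibar m theta x)).
  apply/funext => x; rewrite indicE.
  have : 0 <= pibar m theta x by apply: Rintegral_ge0 => y _; exact: p_ge0.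
  rewrite le_eqVlt => /predU1P[<-|x0].
    by rewrite invr0 memNset ?mulr0 //= in_itv/= ltxx.
  by rewrite mem_set /= ?in_itv/= ?x0 // mulr1 expRN lnK.
apply: measurable_funM.
  apply: (measurableT_comp (f := @expR R)) => //.
  by apply: measurable_funN; exact: (measurableT_comp (f := @ln R)).
have mi : measurable_fun setT (\1_(`]0%R, +oo[%classic) : R -> R).
  by apply: measurable_indic; exact: measurable_itv.
exact: (measurableT_comp mi measurable_pibar).
Qed.

Lemma measurable_score_S i : measurable_fun setT (fun z : X * Y => sS i z.1 z.2).
Proof.
under eq_fun do rewrite score_SE.
apply: measurable_funB; first exact: measurable_score.
apply: (@measurableT_comp _ _ _ _ _ _ (fun x => ip x * c i x) _ fst) => //.
by apply: measurable_funM; [exact: measurable_ip|exact: measurable_cscore].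
Qed.

Lemma integrable_Sigma_density i j :
  mu.-integrable setT (fun z => (fX m z.1 * (f m theta z.1 z.2 * sigma i j z.1 z.2))%:E).
Proof.
have := Sigma_finite i j; apply: eq_integrable => // z _ /=.
rewrite /expect_integrand /cexp_integrand /mean_delta !Sigma_integrandE.
by congr (_%:E); ring.
Qed.

Lemma SigmaE i j : Sigma m theta i j =
  \int[mu]_z (fX m z.1 * (f m theta z.1 z.2 * sigma i j z.1 z.2)).
Proof.
rewrite /Sigma mxE; apply: eq_Rintegral => z _.
by rewrite /expect_integrand /cexp_integrand /mean_delta !Sigma_integrandE; ring.
Qed.

Section section_moments.
Variable x : X.
Hypothesis sigma_section : forall i,
  (nu m).-integrable setT (EFin \o (fun y => f m theta x y * sigma i i x y)).

Let mp : measurable_fun setT (p x).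
Proof. exact: (measurable_section x measurable_p). Qed.

Let ms i : measurable_fun setT (fun y => s i x y).
Proof. exact: (@measurable_section R _ _ X Y (fun x y => s i x y) x (measurable_score i)). Qed.

Let integrable_f : (nu m).-integrable setT (EFin \o f m theta x).
Proof.
apply/integrableP; split.
  by apply/measurable_EFinP; exact: (measurable_section x (measurable_f theta_in)).
under eq_integral do rewrite /= ger0_norm ?f_ge0 //.
by rewrite integral_f // ltry.
Qed.

Let integrable_p : (nu m).-integrable setT (EFin \o p x).
Proof.
apply: le_integrable integrable_f => //; first exact/measurable_EFinP.
move=> y _; rewrite lee_fin ger0_norm // [leRHS]ger0_norm ?f_ge0 //.
by rewrite ler_piMr ?f_ge0 // samp_le1.
Qed.

(** Only the difference defining [Sigma_density] is assumed integrable. At fixed [x] the subtracted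
    term is a constant times the density in [y], which is integrable, so it can be added back. *)
Let integrable_ps2 i : (nu m).-integrable setT (EFin \o (fun y => p x y * s i x y ^+ 2)).
Proof.
have := integrableD measurableT (sigma_section i)
  (integrableZl measurableT (ip x * (c i x * c i x)) integrable_f).
apply: eq_integrable => // y _ /=; rewrite -EFinM -EFinD /p /Sigma_density; congr (_%:E).
ring.
Qed.

Let integrable_pss i j :
  (nu m).-integrable setT (EFin \o (fun y => p x y * (s i x y * s j x y))).
Proof. exact: integrable_weighted_mul. Qed.

Let integrable_ps i : (nu m).-integrable setT (EFin \o (fun y => p x y * s i x y)).
Proof.
have := @integrable_weighted_mul _ _ _ (nu m) (p x) (fun y => s i x y) (fun=> 1)
  mp (ms i) (measurable_cst _) (p_ge0 x) (integrable_ps2 i).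
have -> : (fun y => p x y * 1 ^+ 2) = p x by apply/funext => y; rewrite expr1n mulr1.
by move=> /(_ integrable_p); apply: eq_integrable => // y _ /=; rewrite mulr1.
Qed.

Lemma integrable_p_score_S2 i :
  (nu m).-integrable setT (EFin \o (fun y => p x y * (sS i x y * sS i x y))).
Proof.
have h1 := integrableZl measurableT (- 2 * ip x * c i x) (integrable_ps i).
have h2 := integrableZl measurableT ((ip x * c i x) ^+ 2) integrable_p.
have := integrableD measurableT (integrable_ps2 i) (integrableD measurableT h1 h2).
apply: eq_integrable => // y _ /=; rewrite -!EFinM -!EFinD score_SE; congr (_%:E).
ring.
Qed.

(** Expanding the product gives two cross terms, each [- c_i c_j / pibar], and a square term
    [c_i c_j / pibar], so one negative term remains. On the right the same term is integrated
    against a density of mass 1. *)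
Lemma Rintegral_p_score_S2 i j :
  \int[nu m]_y (p x y * (sS i x y * sS j x y)) =
  \int[nu m]_y (f m theta x y * sigma i j x y).
Proof.
have j1 : (nu m).-integrable setT (EFin \o (fun y => - (ip x * c j x) * (p x y * s i x y))).
  exact: (integrableZl measurableT _ (integrable_ps i)).
have j2 : (nu m).-integrable setT (EFin \o (fun y => - (ip x * c i x) * (p x y * s j x y))).
  exact: (integrableZl measurableT _ (integrable_ps j)).
have j3 : (nu m).-integrable setT (EFin \o (fun y => (ip x * c i x) * (ip x * c j x) * p x y)).
  exact: (integrableZl measurableT _ integrable_p).
have j4 : (nu m).-integrable setT (EFin \o (fun y => - (ip x * (c i x * c j x)) * f m theta x y)).
  exact: (integrableZl measurableT _ integrable_f).
have j23 : (nu m).-integrable setT (EFin \o (fun y => - (ip x * c i x) * (p x y * s j x y) +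
    (ip x * c i x) * (ip x * c j x) * p x y)).
  exact: (integrableD measurableT j2 j3).
have j123 : (nu m).-integrable setT (EFin \o (fun y => - (ip x * c j x) * (p x y * s i x y) +
    (- (ip x * c i x) * (p x y * s j x y) + (ip x * c i x) * (ip x * c j x) * p x y))).
  exact: (integrableD measurableT j1 j23).
transitivity (\int[nu m]_y (p x y * (s i x y * s j x y) +
    (- (ip x * c j x) * (p x y * s i x y) +
    (- (ip x * c i x) * (p x y * s j x y) + (ip x * c i x) * (ip x * c j x) * p x y)))).
  by apply: eq_Rintegral => y _; rewrite !score_SE; ring.
have int_f : \int[nu m]_y f m theta x y = 1 by rewrite /Rintegral integral_f.
transitivity (\int[nu m]_y (p x y * (s i x y * s j x y) +
    - (ip x * (c i x * c j x)) * f m theta x y)); last first.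
  by apply: eq_Rintegral => y _; rewrite /Sigma_density /p; ring.
rewrite !RintegralD // !RintegralZl // int_f -!cscore_piE -/(pibar m theta x).
congr (_ + _).
(* If pibar = 0, then pibar^-2 pibar = pibar^-1 by the convention 0^-1 = 0. *)
have [->|pi0] := eqVneq (pibar m theta x) 0; first by rewrite invr0; ring.
by field.
Qed.

Lemma Rintegral_p_mul_score_S (u : Y -> R) j : measurable_fun setT u ->
  (nu m).-integrable setT (EFin \o (fun y => p x y * u y ^+ 2)) ->
  \int[nu m]_y (p x y * u y) = 0 ->
  \int[nu m]_y (p x y * (u y * sS j x y)) = \int[nu m]_y (p x y * (u y * s j x y)).
Proof.
move=> mu_ iu2 u0.
have iu : (nu m).-integrable setT (EFin \o (fun y => p x y * u y)).
  have := @integrable_weighted_mul _ _ _ (nu m) (p x) u (fun=> 1)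
    mp mu_ (measurable_cst _) (p_ge0 x) iu2.
  have -> : (fun y => p x y * 1 ^+ 2) = p x by apply/funext => y; rewrite expr1n mulr1.
  by move=> /(_ integrable_p); apply: eq_integrable => // y _ /=; rewrite mulr1.
have j1 : (nu m).-integrable setT (EFin \o (fun y => p x y * (u y * s j x y))).
  exact: integrable_weighted_mul.
have j2 : (nu m).-integrable setT (EFin \o (fun y => (ip x * c j x) * (p x y * u y))).
  exact: (integrableZl measurableT _ iu).
transitivity (\int[nu m]_y (p x y * (u y * s j x y) - (ip x * c j x) * (p x y * u y))).
  by apply: eq_Rintegral => y _; rewrite score_SE; ring.
by rewrite RintegralB // RintegralZl // u0 mulr0 subr0.
Qed.

End section_moments.

End score_moments.

(** * Cross moments of the estimating function and the conditional score *)

Section information_inequality.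
Context {R : realType} {d : nat} {dX dY : measure_display}.
Context {X : measurableType dX} {Y : measurableType dY}.
Variables (m : model R d X Y) (U : 'cV[R]_d -> X -> Y -> 'cV[R]_d).
Variable theta : 'cV[R]_d.
Hypothesis theta_in : Theta m theta.
Hypothesis U_regular : regular_at m U theta.
Hypothesis U_unbiased : unbiased m U.
Hypothesis U_interchange : derivative_under_integral m U theta.
Hypothesis M_exists : expect_exists m theta (deltaUdot U theta).
Hypothesis B_exists : expect_exists m theta (deltaUU U theta).
Hypothesis Sigma_finite : expect_exists m theta (Sigma_integrand m theta).
Local Notation mu := (lam m \x nu m)%E.
Local Notation u i x y := (U theta x y i 0).
Local Notation s i x y := (score m theta x y i 0).
Local Notation sS i x y := (score_S m theta x y i 0).
Local Notation p x y := (f m theta x y * samp m x y).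

Lemma ae_x_forall (Q : 'I_d -> X -> Prop) :
  (forall i, ae_x m (Q i)) -> ae_x m (fun x => forall i, Q i x).
Proof.
move=> h; rewrite /ae_x.
have : {ae lam m, forall x, forall i, 0 < fX m x -> Q i x} by apply: filter_forall.
by apply: filterS => x Qx fx i; exact: Qx.
Qed.

Let measurable_score i : measurable_fun setT (fun z : X * Y => s i z.1 z.2).
Proof. by case: U_regular. Qed.

Lemma measurable_U i : measurable_fun setT (fun z : X * Y => u i z.1 z.2).
Proof. by case: U_regular => _ h _; exact: h. Qed.

Let measurable_p x : measurable_fun setT (fun y => p x y).
Proof.
apply: (@measurable_section R _ _ X Y (fun x y => p x y) x).
by apply: measurable_funM; [exact: measurable_f|exact: measurable_samp].
Qed.

Let p_ge0 x y : 0 <= p x y.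
Proof. by rewrite mulr_ge0 ?f_ge0 // ltW ?samp_gt0. Qed.

Let integrable_dens (H : X -> Y -> bool -> 'M[R]_d) (h : X -> Y -> R) i j :
  expect_exists m theta H -> (forall x y b, H x y b i j = b%:R * h x y) ->
  mu.-integrable setT (fun z => (fX m z.1 * (p z.1 z.2 * h z.1 z.2))%:E).
Proof.
move=> eH HE; have := eH i j; apply: eq_integrable => // z _ /=; congr (_%:E).
by rewrite /expect_integrand /cexp_integrand /mean_delta !HE /=; ring.
Qed.

Let expect_dens (H : X -> Y -> bool -> 'M[R]_d) (h : X -> Y -> R) i j :
  (forall x y b, H x y b i j = b%:R * h x y) ->
  expect_mx m theta H i j = \int[mu]_z (fX m z.1 * (p z.1 z.2 * h z.1 z.2)).
Proof.
move=> HE; rewrite /expect_mx mxE; apply: eq_Rintegral => z _.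
by rewrite /expect_integrand /cexp_integrand /mean_delta !HE /=; ring.
Qed.

Let deltaUUE i j x y b : deltaUU U theta x y b i j = b%:R * (u i x y * u j x y).
Proof. by rewrite /deltaUU mxE outerE. Qed.

Let deltaUdotE i j x y b : deltaUdot U theta x y b i j = b%:R * Udot U theta x y i j.
Proof. by rewrite /deltaUdot [LHS]mxE. Qed.

Lemma integrable_UU i j :
  mu.-integrable setT (fun z => (fX m z.1 * (p z.1 z.2 * (u i z.1 z.2 * u j z.1 z.2)))%:E).
Proof. exact: (integrable_dens B_exists (deltaUUE i j)). Qed.

Lemma B_E i j : B_ m U theta i j =
  \int[mu]_z (fX m z.1 * (p z.1 z.2 * (u i z.1 z.2 * u j z.1 z.2))).
Proof. exact: (expect_dens (deltaUUE i j)). Qed.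

Let integrable_Udot i j :
  mu.-integrable setT (fun z => (fX m z.1 * (p z.1 z.2 * Udot U theta z.1 z.2 i j))%:E).
Proof. exact: (integrable_dens M_exists (deltaUdotE i j)). Qed.

Let M_E i j : M_ m U theta i j =
  \int[mu]_z (fX m z.1 * (p z.1 z.2 * Udot U theta z.1 z.2 i j)).
Proof. exact: (expect_dens (deltaUdotE i j)). Qed.

Local Notation sigma := (Sigma_density m theta).

Let sigma_section : ae_x m (fun x => forall i,
  (nu m).-integrable setT (EFin \o (fun y => f m theta x y * sigma i i x y))).
Proof.
apply: ae_x_forall => i; apply: (@ae_x_section _ _ _ _ _ _ m
  (fun x y => f m theta x y * sigma i i x y)).
exact: integrable_Sigma_density.
Qed.

(** [Sigma_density] may be negative at some points and does not dominate this integrand pointwise,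
    but both have the same integral in [y] for almost every [x] with [0 < fX m x]. The integrand
    being nonnegative, Tonelli turns this into integrability. *)
Lemma integrable_score_S2 i :
  mu.-integrable setT (fun z => (fX m z.1 * (p z.1 z.2 * (sS i z.1 z.2 * sS i z.1 z.2)))%:E).
Proof.
have mS := measurable_score_S theta_in measurable_score i.
have mg : measurable_fun setT (fun z : X * Y =>
    (fX m z.1 * (p z.1 z.2 * (sS i z.1 z.2 * sS i z.1 z.2)))%:E).
  apply/measurable_EFinP; apply: measurable_funM.
    by apply: (measurableT_comp (measurable_fX m)).
  apply: measurable_funM; last exact: measurable_funM.
  by apply: measurable_funM; [exact: measurable_f|exact: measurable_samp].
have iS := integrable_Sigma_density Sigma_finite i i.
apply/(integrable12ltyP _ _ mg).
apply: le_lt_trans (integrable_lty measurableT (integrable_fubini_F iS)).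
rewrite le_eqVlt; apply/orP; left; apply/eqP; apply: ae_eq_integral => //.
- apply: (@measurable_fun_fubini_tonelli_F _ _ X Y R (nu m)
    (fun z => `|(fX m z.1 * (p z.1 z.2 * (sS i z.1 z.2 * sS i z.1 z.2)))%:E|)%E) => //.
  exact: measurableT_comp.
- exact: (measurable_int (lam m) (integrable_fubini_F iS)).
move: sigma_section; rewrite /ae_x; apply: filterS => x sx _; rewrite /fubini_F /=.
have := fX_ge0 m x; rewrite le_eqVlt => /predU1P[fx0|fx0].
  by apply: eq_integral => y _; rewrite -fx0 !mul0r normr0.
have {}sx := sx fx0.
have i1 := integrable_p_score_S2 theta_in measurable_score sx i.
have e1 := Rintegral_p_score_S2 theta_in measurable_score sx i i.
transitivity (\int[nu m]_y ((fX m x)%:E * (p x y * (sS i x y * sS i x y))%:E))%E.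
  apply: eq_integral => y _; rewrite -EFinM ger0_norm //.
  apply: mulr_ge0; first exact: ltW.
  by apply: mulr_ge0; [exact: p_ge0|rewrite -expr2 sqr_ge0].
transitivity (\int[nu m]_y ((fX m x)%:E * (f m theta x y * sigma i i x y)%:E))%E; last first.
  by apply: eq_integral => y _; rewrite -EFinM.
rewrite (integralZl measurableT i1) (integralZl measurableT (sx i)); congr (_ * _)%E.
rewrite -[LHS]fineK; last exact: (integrable_fin_num measurableT i1).
rewrite -[RHS]fineK; last exact: (integrable_fin_num measurableT (sx i)).
by congr (_%:E); exact: e1.
Qed.

Let measurable_fX1 : measurable_fun setT (fun z : X * Y => fX m z.1).
Proof. by apply: (measurableT_comp (measurable_fX m)). Qed.

Let integrable_dens_mul (a b : X -> Y -> R) :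
  measurable_fun setT (fun z : X * Y => a z.1 z.2) ->
  measurable_fun setT (fun z : X * Y => b z.1 z.2) ->
  mu.-integrable setT (fun z => (fX m z.1 * (p z.1 z.2 * (a z.1 z.2 * a z.1 z.2)))%:E) ->
  mu.-integrable setT (fun z => (fX m z.1 * (p z.1 z.2 * (b z.1 z.2 * b z.1 z.2)))%:E) ->
  mu.-integrable setT (fun z => (fX m z.1 * (p z.1 z.2 * (a z.1 z.2 * b z.1 z.2)))%:E).
Proof.
move=> ma mb ia ib.
have mw : measurable_fun setT (fun z : X * Y => fX m z.1 * p z.1 z.2).
  apply: measurable_funM => //.
  by apply: measurable_funM; [exact: measurable_f|exact: measurable_samp].
have h := @integrable_weighted_mul _ _ _ mu (fun z => fX m z.1 * p z.1 z.2)
  (fun z => a z.1 z.2) (fun z => b z.1 z.2) mw ma mb.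
have := h (fun z => mulr_ge0 (fX_ge0 m z.1) (p_ge0 z.1 z.2)).
have ia' : mu.-integrable setT (EFin \o (fun z => fX m z.1 * p z.1 z.2 * a z.1 z.2 ^+ 2)).
  by apply: eq_integrable ia => // z _ /=; rewrite expr2 mulrA.
have ib' : mu.-integrable setT (EFin \o (fun z => fX m z.1 * p z.1 z.2 * b z.1 z.2 ^+ 2)).
  by apply: eq_integrable ib => // z _ /=; rewrite expr2 mulrA.
by move=> /(_ ia' ib'); apply: eq_integrable => // z _ /=; congr (_%:E); ring.
Qed.

Lemma integrable_score_S i j :
  mu.-integrable setT (fun z => (fX m z.1 * (p z.1 z.2 * (sS i z.1 z.2 * sS j z.1 z.2)))%:E).
Proof.
apply: (integrable_dens_mul (a := fun x y => sS i x y) (b := fun x y => sS j x y)).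
- exact: measurable_score_S.
- exact: measurable_score_S.
- exact: integrable_score_S2.
- exact: integrable_score_S2.
Qed.

Lemma integrable_U_score_S i j :
  mu.-integrable setT (fun z => (fX m z.1 * (p z.1 z.2 * (u i z.1 z.2 * sS j z.1 z.2)))%:E).
Proof.
apply: (integrable_dens_mul (a := fun x y => u i x y) (b := fun x y => sS j x y)).
- exact: measurable_U.
- exact: measurable_score_S.
- exact: integrable_UU.
- exact: integrable_score_S2.
Qed.

Lemma score_S_moment i j :
  \int[mu]_z (fX m z.1 * (p z.1 z.2 * (sS i z.1 z.2 * sS j z.1 z.2))) = Sigma m theta i j.
Proof.
rewrite SigmaE; apply: (@eq_Rintegral_ae_x _ _ _ _ _ _ m
  (fun x y => p x y * (sS i x y * sS j x y)) (fun x y => f m theta x y * sigma i j x y)).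
- exact: integrable_score_S.
- exact: integrable_Sigma_density.
- move: sigma_section; rewrite /ae_x; apply: filterS => x sx fx0.
  exact: (Rintegral_p_score_S2 theta_in measurable_score (sx fx0)).
Qed.

(** Where [f] is positive this is the derivative of a logarithm. Where it is zero, [Theta] being
    open makes [f] nonnegative around [theta], so the derivative is zero, as is the right side
    whatever the score is. *)
Let f_derive x y j : derivable (fun t => f m t x y) theta (delta_mx j 0 : 'cV[R]_d) ->
  'D_(delta_mx j 0 : 'cV[R]_d) (fun t => f m t x y) theta = f m theta x y * s j x y.
Proof.
move=> df; rewrite /score mxE.
have := f_ge0 x y theta_in; rewrite le_eqVlt => /predU1P[f0|f0].
  rewrite -f0 mul0r; apply: derive_at_zero_min => //.
  have : \forall t \near theta, Theta m t 
    by apply: open_nbhs_nbhs; split; [exact: open_Theta|exact: theta_in].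
  by apply: filterS => t; exact: f_ge0.
by rewrite derive_ln // mulrC divfK // gt_eqF.
Qed.

Let Udot_section : ae_x m (fun x => forall i j,
  (nu m).-integrable setT (EFin \o (fun y => p x y * Udot U theta x y i j))).
Proof.
apply: ae_x_forall => i; apply: ae_x_forall => j; apply: (@ae_x_section _ _ _ _ _ _ m
  (fun x y => p x y * Udot U theta x y i j)).
exact: integrable_Udot.
Qed.

(** At fixed [x] the conditional mean vanishes on the open set [Theta], hence on a neighbourhood of
    [theta], where it has the derivative of the constant 0. *)
Let cexp_zero x i j : (forall t, Theta m t ->
    cexp_exists m t x (deltaU U t x) /\ cexp_mx m t x (deltaU U t x) = 0) -> forall D : R,
  is_derive theta (delta_mx j 0 : 'cV[R]_d)
    (fun t : 'cV[R]_d => cexp m t x (fun y b => deltaU U t x y b i 0)) D -> D = 0.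
Proof.
move=> h D hD.
have z : \forall t \near theta, cst (0 : R) t = cexp m t x (fun y b => deltaU U t x y b i 0).
  have : \forall t \near theta, Theta m t.
    by apply: open_nbhs_nbhs; split; [exact: open_Theta|exact: theta_in].
  apply: filterS => t /h[_ /matrixP/(_ i 0)]; rewrite !mxE => <- //.
have := near_eq_is_derive z (is_derive_cst (0 : R) theta (delta_mx j 0 : 'cV[R]_d)).
by move=> h0; rewrite -(@derive_val _ _ _ _ _ _ _ hD) (@derive_val _ _ _ _ _ _ _ h0).
Qed.

Let cross_section : ae_x m (fun x => forall i j,
  \int[nu m]_y (p x y * (u i x y * s j x y)) =
  \int[nu m]_y (p x y * - Udot U theta x y i j)).
Proof.
have [reg _ _] := U_regular.
have A : ae_x m (fun x => [/\ {ae nu m, forall y, forall j : 'I_d,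
         derivable (fun t : 'cV[R]_d => f m t x y) theta (delta_mx j 0) /\
         forall i : 'I_d,
           derivable (fun t : 'cV[R]_d => U t x y i 0) theta (delta_mx j 0)},
    forall t, Theta m t ->
      cexp_exists m t x (deltaU U t x) /\ cexp_mx m t x (deltaU U t x) = 0 &
    forall i j, (nu m).-integrable setT (EFin \o (fun y => p x y * Udot U theta x y i j))]).
  move: reg U_unbiased Udot_section; rewrite /unbiased /ae_x.
  by apply: filterS3 => x h1 h2 h3 fx0; split; [exact: h1|exact: h2|exact: h3].
move: A U_interchange; rewrite /derivative_under_integral /ae_x.
apply: filterS2 => x h1 h2 fx0 i j.
have {h1}[dr unb iU] := h1 fx0; have {h2}[iD hD] := h2 fx0 i j.
have D0 := cexp_zero unb hD.
set F := fun (y : Y) (t : 'cV[R]_d) =>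
  cexp_integrand m t x (fun y b => deltaU U t x y b i 0) y in iD D0.
(* Product rule in [theta]: the sampling probability is constant, and the derivative of the density
   is the density times the score. *)
have DE : {ae nu m, forall y, 'D_(delta_mx j 0 : 'cV[R]_d) (F y) theta =
    p x y * (u i x y * s j x y) + p x y * Udot U theta x y i j}.
  apply: filterS dr => y /(_ j)[df /(_ i) dU].
  have D1 := @is_deriveM _ _ _ _ _ _ _ _ (derivableP df) (derivableP dU).
  have D2 := @is_deriveZ _ _ _ _ (samp m x y) _ _ _ D1.
  have FE : F y = fun t => samp m x y * (f m t x y * U t x y i 0).
    apply/funext => t; rewrite /F /cexp_integrand /mean_delta /deltaU !mxE /=.
    by ring.
  rewrite FE; have := @derive_val _ _ _ _ _ _ _ D2; rewrite /GRing.scale /= => D3.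
  rewrite [LHS]D3 f_derive // [Udot U theta x y i j]mxE.
  by ring.
have mD : measurable_fun setT (fun y => 'D_(delta_mx j 0 : 'cV[R]_d) (F y) theta).
  by apply/measurable_EFinP; exact: (measurable_int _ iD).
have mU' : measurable_fun setT (fun y => p x y * Udot U theta x y i j).
  by apply/measurable_EFinP; exact: (measurable_int _ (iU i j)).
have mus : measurable_fun setT (fun y => p x y * (u i x y * s j x y)).
  apply: measurable_funM => //; apply: measurable_funM.
    exact: (@measurable_section R _ _ X Y (fun x y => u i x y) x (measurable_U i)).
  exact: (@measurable_section R _ _ X Y (fun x y => s j x y) x (measurable_score j)).
have ius : (nu m).-integrable setT (EFin \o (fun y =>
    'D_(delta_mx j 0 : 'cV[R]_d) (F y) theta - p x y * Udot U theta x y i j)).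
  exact: (integrableB measurableT iD (iU i j)).
transitivity (\int[nu m]_y ('D_(delta_mx j 0 : 'cV[R]_d) (F y) theta -
    p x y * Udot U theta x y i j)).
  apply: ae_eq_Rintegral => //; first exact: measurable_funB.
  by apply: filterS DE => y ->; rewrite addrK.
rewrite (RintegralB measurableT iD (iU i j)).
rewrite D0 sub0r -mulN1r -(RintegralZl (-1) measurableT (iU i j)).
by apply: eq_Rintegral => y _; ring.
Qed.

Let U_section : ae_x m (fun x => forall i,
  (nu m).-integrable setT (EFin \o (fun y => p x y * u i x y ^+ 2))).
Proof.
apply: ae_x_forall => i; apply: (@ae_x_section _ _ _ _ _ _ m
  (fun x y => p x y * u i x y ^+ 2)).
by have := integrable_UU i i; apply: eq_integrable => // z _ /=; rewrite expr2.
Qed.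

Let U_mean_section : ae_x m (fun x => forall i, \int[nu m]_y (p x y * u i x y) = 0).
Proof.
move: U_unbiased; rewrite /unbiased /ae_x; apply: filterS => x h fx0 i.
have [_ /matrixP/(_ i 0)] := h fx0 _ theta_in; rewrite !mxE => <-.
apply: eq_Rintegral => y _.
by rewrite /cexp_integrand /mean_delta /deltaU !mxE /=; ring.
Qed.

Lemma cross_moment i j :
  \int[mu]_z (fX m z.1 * (p z.1 z.2 * (u i z.1 z.2 * sS j z.1 z.2))) = - M_ m U theta i j.
Proof.
have iM : mu.-integrable setT
    (fun z => (fX m z.1 * (p z.1 z.2 * - Udot U theta z.1 z.2 i j))%:E).
  have := integrableZl measurableT (-1) (integrable_Udot i j).
  by apply: eq_integrable => // z _ /=; rewrite -EFinM; congr (_%:E); ring.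
rewrite M_E.
have -> : - (\int[mu]_z (fX m z.1 * (p z.1 z.2 * Udot U theta z.1 z.2 i j))) =
    \int[mu]_z (fX m z.1 * (p z.1 z.2 * - Udot U theta z.1 z.2 i j)).
  rewrite -mulN1r -RintegralZl //; last exact: integrable_Udot.
  by apply: eq_Rintegral => z _; ring.
apply: (@eq_Rintegral_ae_x _ _ _ _ _ _ m
  (fun x y => p x y * (u i x y * sS j x y)) (fun x y => p x y * - Udot U theta x y i j)
  (integrable_U_score_S i j) iM).
have A : ae_x m (fun x => [/\ forall i,
    (nu m).-integrable setT (EFin \o (fun y => f m theta x y * sigma i i x y)),
    forall i, (nu m).-integrable setT (EFin \o (fun y => p x y * u i x y ^+ 2)) &
    forall i, \int[nu m]_y (p x y * u i x y) = 0]).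
  move: sigma_section U_section U_mean_section; rewrite /ae_x.
  by apply: filterS3 => x h1 h2 h3 fx0; split; [exact: h1|exact: h2|exact: h3].
move: A cross_section; rewrite /ae_x; apply: filterS2 => x h1 h2 fx0.
have [s1 s2 s3] := h1 fx0; rewrite -(h2 fx0).
apply: (Rintegral_p_mul_score_S theta_in measurable_score s1) => //.
exact: (@measurable_section R _ _ X Y (fun x y => u i x y) x (measurable_U i)).
Qed.

(** The product of [U] and the constant 1 is dominated by the sum of their squares, and the sampled
    density has finite mass. *)
Lemma integrable_U_density i :
  mu.-integrable setT (fun z => (fX m z.1 * (p z.1 z.2 * u i z.1 z.2))%:E).
Proof.
have := @integrable_dens_mul (fun x y => u i x y) (fun _ _ => 1) (measurable_U i)
  (measurable_cst _) (integrable_UU i i).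
have i1 : mu.-integrable setT (fun z => (fX m z.1 * (p z.1 z.2 * (1 * 1)))%:E).
  apply: le_integrable (integrable_full_density theta_in) => //.
    apply/measurable_EFinP; apply: measurable_funM => //; apply: measurable_funM => //.
    by apply: measurable_funM; [exact: measurable_f|exact: measurable_samp].
  move=> z _; rewrite lee_fin !mulr1 ger0_norm; last by rewrite mulr_ge0 ?fX_ge0 ?p_ge0.
  rewrite ger0_norm ?full_density_ge0 // /full_density ler_wpM2l ?fX_ge0 //.
  by rewrite ler_piMr ?f_ge0 // samp_le1.
by move=> /(_ i1); apply: eq_integrable => // z _ /=; rewrite mulr1.
Qed.

Lemma U_mean i : \int[mu]_z (fX m z.1 * (p z.1 z.2 * u i z.1 z.2)) = 0.
Proof.
transitivity (\int[mu]_z (fX m z.1 * cst 0 z.2)).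
  apply: (@eq_Rintegral_ae_x _ _ _ _ _ _ m (fun x y => p x y * u i x y) (fun x => cst 0)).
  - exact: integrable_U_density.
  - by apply: (eq_integrable _ (cst 0%E)) => //; [move=> z _ /=; rewrite mulr0|exact: integrable0].
  - move: U_mean_section; rewrite /ae_x; apply: filterS => x h fx0.
    by rewrite h // /Rintegral integral0.
rewrite /Rintegral; under eq_integral do rewrite mulr0.
by rewrite integral0.
Qed.

End information_inequality.

(** * Quadratic forms of moment matrices and the Loewner order *)

Lemma Rintegral_sum {d} {T : measurableType d} {R : realType}
    (mu : {measure set T -> \bar R}) (I : Type) (s : seq I) (h : I -> T -> R) :
  (forall i, mu.-integrable setT (EFin \o h i)) ->
  mu.-integrable setT (EFin \o (fun x => \sum_(i <- s) h i x)) /\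
  \int[mu]_x (\sum_(i <- s) h i x) = \sum_(i <- s) \int[mu]_x h i x.
Proof.
move=> ih; elim: s => [|i s [IH1 IH2]].
  split; last by rewrite big_nil; under eq_Rintegral do rewrite big_nil; rewrite /Rintegral integral0.
  by apply: (eq_integrable _ (cst 0%E)) => //; [move=> x _; rewrite /= big_nil|exact: integrable0].
split; last by rewrite big_cons -IH2 -RintegralD //; apply: eq_Rintegral => x _; rewrite big_cons.
have := integrableD measurableT (ih i) IH1.
by apply: eq_integrable => // x _; rewrite /= big_cons.
Qed.

Section bilinear_moments.
Context {R : realType} {d : nat} {dT} {T : measurableType dT}.
Variable mu : {measure set T -> \bar R}.
Implicit Types (A B M S : 'M[R]_d) (u v : 'cV[R]_d).

Lemma bformE A u v : bform A u v = \sum_i \sum_j u i 0 * v j 0 * A i j.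
Proof.
rewrite /bform -mulmxA mxE; apply: eq_bigr => i _.
rewrite !mxE mulr_sumr; apply: eq_bigr => j _; ring.
Qed.

Lemma Rintegral_bform (w : T -> R) (a b : T -> 'cV[R]_d) A u v :
  (forall i j, mu.-integrable setT (EFin \o (fun z => w z * (a z i 0 * b z j 0)))) ->
  (forall i j, \int[mu]_z (w z * (a z i 0 * b z j 0)) = A i j) ->
  mu.-integrable setT (EFin \o (fun z => w z * (dot u (a z) * dot v (b z)))) /\
  \int[mu]_z (w z * (dot u (a z) * dot v (b z))) = bform A u v.
Proof.
move=> ih hA.
have E : (fun z => w z * (dot u (a z) * dot v (b z))) =
    (fun z => \sum_i \sum_j u i 0 * v j 0 * (w z * (a z i 0 * b z j 0))).
  apply/funext => z; rewrite !dotE mulr_suml mulr_sumr; apply: eq_bigr => i _.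
  rewrite !mulr_sumr; apply: eq_bigr => j _; ring.
have iij i j : mu.-integrable setT
    (EFin \o (fun z => u i 0 * v j 0 * (w z * (a z i 0 * b z j 0)))).
  exact: (integrableZl measurableT (u i 0 * v j 0) (ih i j)).
have ii i := Rintegral_sum (index_enum 'I_d) (iij i).
have [h1 h2] := Rintegral_sum (index_enum 'I_d) (fun i => (ii i).1).
rewrite E; split; first exact: h1.
rewrite h2 bformE; apply: eq_bigr => i _; rewrite (ii i).2; apply: eq_bigr => j _.
by rewrite -hA RintegralZl.
Qed.

Lemma bformNm A u v : bform (- A) u v = - bform A u v.
Proof. by rewrite /bform mulmxN mulNmx mxE. Qed.

Lemma bformBm A B u v : bform (A - B) u v = bform A u v - bform B u v.
Proof. by rewrite /bform mulmxBr mulmxBl !mxE. Qed.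

Lemma bform_congr C A u v : bform (C *m A *m C^T) u v = bform A (C^T *m u) (C^T *m v).
Proof. by rewrite /bform trmx_mul trmxK !mulmxA. Qed.

Lemma matrix_bformP A B : (forall u v, bform A u v = bform B u v) -> A = B.
Proof. by move=> h; apply/matrixP => i j; rewrite -!bform_delta h. Qed.

(** A nonzero row [k] of the kernel would satisfy [k *m S *m k^T = 0], against positivity. *)
Lemma pos_def_unitmx S : pos_def S -> S \in unitmx.
Proof.
move=> [sS pS]; rewrite -row_free_unit -kermx_eq0; apply/eqP/row_matrixP => i; rewrite row0.
apply/eqP; apply: contraT => k0.
have : (row i (kermx S))^T != 0 by apply: contra_neq k0 => e; rewrite -[LHS]trmxK e trmx0.
move=> /pS; rewrite trmxK.
have -> : row i (kermx S) *m S = 0 by apply/sub_kermxP; exact: row_sub.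
by rewrite mul0mx mxE ltxx.
Qed.

(* Take u = (M^-1)^T t and v = S^-1 t in the hypothesis. *)
Lemma loewner_ge_of_moments A M S : A^T = A -> pos_def S -> M \in unitmx ->
  (forall u v, 0 <= bform A u u - 2 * bform M u v + bform S v v) ->
  loewner_ge (invmx M *m A *m (invmx M)^T) (invmx S).
Proof.
move=> sA pS uM h; have uS := pos_def_unitmx pS; have [sS _] := pS.
have sS' : (invmx S)^T = invmx S by rewrite trmx_inv sS.
split; first by rewrite linearB /= !trmx_mul trmxK sA sS' mulmxA.
move=> t; rewrite -/(bform _ t t) bformBm bform_congr.
have := h ((invmx M)^T *m t) (invmx S *m t); set b := bform A _ _.
(* With this choice of vectors the [M] term and the [S] term both become [q], the value of
   [bform (invmx S) t t], so the hypothesis reads [0 <= b - 2 q + q]. *)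
have -> : bform M ((invmx M)^T *m t) (invmx S *m t) = bform (invmx S) t t.
  by rewrite /bform trmx_mul trmxK -!mulmxA (mulmxA M) ?mulmxA mulmxKV.
have -> : bform S (invmx S *m t) (invmx S *m t) = bform (invmx S) t t.
  by rewrite /bform trmx_mul sS' -!mulmxA mulKVmx // mulmxA.
by lra.
Qed.

End bilinear_moments.

(** * The variance bound and its attainment *)

Section loewner_bound.
Context {R : realType} {d : nat} {dX dY : measure_display}.
Context {X : measurableType dX} {Y : measurableType dY}.
Variables (m : model R d X Y) (U : 'cV[R]_d -> X -> Y -> 'cV[R]_d).
Variable theta : 'cV[R]_d.
Hypothesis theta_in : Theta m theta.
Hypothesis U_regular : regular_at m U theta.
Hypothesis U_unbiased : unbiased m U.
Hypothesis U_interchange : derivative_under_integral m U theta.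
Hypothesis M_exists : expect_exists m theta (deltaUdot U theta).
Hypothesis B_exists : expect_exists m theta (deltaUU U theta).
Hypothesis Sigma_finite : expect_exists m theta (Sigma_integrand m theta).
Hypothesis Sigma_pd : pos_def (Sigma m theta).
Local Notation mu := (lam m \x nu m)%E.
Local Notation g z := (sampled_density m theta z.1 z.2).
Local Notation M := (M_ m U theta).
Local Notation B := (B_ m U theta).
Local Notation S := (Sigma m theta).

Let integrable_gM (h : X * Y -> R) :
  mu.-integrable setT (fun z => (fX m z.1 * (f m theta z.1 z.2 * samp m z.1 z.2 * h z))%:E) ->
  mu.-integrable setT (EFin \o (fun z => g z * h z)).
Proof.
by apply: eq_integrable => // z _ /=; rewrite /sampled_density !mulrA.
Qed.

Let Rintegral_gM (h : X * Y -> R) :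
  \int[mu]_z (g z * h z) =
  \int[mu]_z (fX m z.1 * (f m theta z.1 z.2 * samp m z.1 z.2 * h z)).
Proof. by apply: eq_Rintegral => z _; rewrite /sampled_density !mulrA. Qed.

Lemma bform_B a b :
  mu.-integrable setT
    (EFin \o (fun z => g z * (dot a (U theta z.1 z.2) * dot b (U theta z.1 z.2)))) /\
  \int[mu]_z (g z * (dot a (U theta z.1 z.2) * dot b (U theta z.1 z.2))) = bform B a b.
Proof.
apply: (@Rintegral_bform _ _ _ _ mu (fun z => g z) (fun z => U theta z.1 z.2)
  (fun z => U theta z.1 z.2)) => i j.
  by apply: integrable_gM; exact: integrable_UU.
by rewrite Rintegral_gM -B_E.
Qed.

Lemma bform_M a b :
  mu.-integrable setT
    (EFin \o (fun z => g z * (dot a (U theta z.1 z.2) * dot b (score_S m theta z.1 z.2)))) /\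
  \int[mu]_z (g z * (dot a (U theta z.1 z.2) * dot b (score_S m theta z.1 z.2))) =
    bform (- M) a b.
Proof.
apply: (@Rintegral_bform _ _ _ _ mu (fun z => g z) (fun z => U theta z.1 z.2)
  (fun z => score_S m theta z.1 z.2)) => i j.
  by apply: integrable_gM; exact: integrable_U_score_S.
by rewrite Rintegral_gM [RHS]mxE; apply: cross_moment.
Qed.

Lemma bform_Sigma a b :
  mu.-integrable setT
    (EFin \o (fun z => g z * (dot a (score_S m theta z.1 z.2) *
      dot b (score_S m theta z.1 z.2)))) /\
  \int[mu]_z (g z * (dot a (score_S m theta z.1 z.2) * dot b (score_S m theta z.1 z.2))) =
    bform S a b.
Proof.
apply: (@Rintegral_bform _ _ _ _ mu (fun z => g z) (fun z => score_S m theta z.1 z.2)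
  (fun z => score_S m theta z.1 z.2)) => i j.
  exact: integrable_gM (integrable_score_S theta_in U_regular Sigma_finite i j).
by rewrite Rintegral_gM; exact: (score_S_moment theta_in U_regular Sigma_finite i j).
Qed.

Lemma moments_ge0 a b : 0 <= bform B a a - 2 * bform M a b + bform S b b.
Proof.
have [iB eB] := bform_B a a; have [iM eM] := bform_M a b; have [iS eS] := bform_Sigma b b.
have i1 := integrableZl measurableT 2 iM.
have i2 := integrableD measurableT iB i1.
rewrite -eB -eS; move: eM; rewrite bformNm => /eqP; rewrite eq_sym eqr_oppLR => /eqP ->.
rewrite mulrN opprK -RintegralZl // -RintegralD // -RintegralD //.
apply: Rintegral_ge0 => z _; set u := dot a _; set v := dot b _.
have -> : g z * (u * u) + 2 * (g z * (u * v)) + g z * (v * v) = g z * (u + v) ^+ 2 by ring.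
by rewrite mulr_ge0 ?sqr_ge0 // sampled_density_ge0.
Qed.

Lemma B_sym : B^T = B.
Proof.
apply/matrixP => i j; rewrite mxE !B_E; apply: eq_Rintegral => z _.
by congr (_ * (_ * _)); rewrite mulrC.
Qed.

Lemma psd_B : psd B.
Proof.
split; first exact: B_sym.
move=> v; rewrite -/(bform B v v) -(bform_B v v).2; apply: Rintegral_ge0 => z _.
by apply: mulr_ge0; [exact: sampled_density_ge0|rewrite -expr2 sqr_ge0].
Qed.

Lemma loewner_score_bound : M \in unitmx ->
  loewner_ge (invmx M *m B *m (invmx M)^T) (invmx S).
Proof. by move=> uM; apply: loewner_ge_of_moments => //; [exact: B_sym|exact: moments_ge0]. Qed.

(** The linear relation holds only where the density is positive, for almost every [y]; elsewhere
    the weight is zero. Both second moments then have the same inner integrals. *)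
Lemma B_linear_in_score_S (C : 'M[R]_d) : U_linear_in_score_S m U theta C ->
  B = C *m S *m C^T.
Proof.
move=> UC; apply: matrix_bformP => a b; rewrite bform_congr.
have [iB <-] := bform_B a b; have [iS <-] := bform_Sigma (C^T *m a) (C^T *m b).
pose F1 x y := f m theta x y * samp m x y * (dot a (U theta x y) * dot b (U theta x y)).
pose F2 x y := f m theta x y * samp m x y *
  (dot (C^T *m a) (score_S m theta x y) * dot (C^T *m b) (score_S m theta x y)).
transitivity (\int[mu]_z (fX m z.1 * F1 z.1 z.2)); first exact: Rintegral_gM.
transitivity (\int[mu]_z (fX m z.1 * F2 z.1 z.2)); last by rewrite Rintegral_gM.
have j1 : mu.-integrable setT (fun z => (fX m z.1 * F1 z.1 z.2)%:E).
  by apply: eq_integrable iB => // z _ /=; rewrite /sampled_density /F1 !mulrA.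
have j2 : mu.-integrable setT (fun z => (fX m z.1 * F2 z.1 z.2)%:E).
  by apply: eq_integrable iS => // z _ /=; rewrite /sampled_density /F2 !mulrA.
apply: (eq_Rintegral_ae_x j1 j2).
move: (ae_x_section j1) (ae_x_section j2) UC; rewrite /U_linear_in_score_S /ae_x.
apply: filterS3 => x h1 h2 h3 fx0.
apply: ae_eq_Rintegral.
- by apply/measurable_EFinP; exact: (measurable_int _ (h1 fx0)).
- by apply/measurable_EFinP; exact: (measurable_int _ (h2 fx0)).
apply: filterS (h3 fx0) => y UE; rewrite /F1 /F2.
have := f_ge0 x y theta_in; rewrite le_eqVlt => /predU1P[<-|f0]; first by rewrite !mul0r.
by rewrite UE // /dot !trmx_mul !trmxK !mulmxA.
Qed.

(** For the matrix [- (M *m invmx S)] the second moment [B] is [M *m invmx S *m M^T], and the two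
    outer factors cancel [M] and its transpose. *)
Lemma score_bound_attained : M \in unitmx ->
  U_linear_in_score_S m U theta (- (M *m invmx S)) ->
  invmx M *m B *m (invmx M)^T = invmx S.
Proof.
move=> uM /B_linear_in_score_S ->; have uS := pos_def_unitmx Sigma_pd.
have [sS _] := Sigma_pd.
rewrite linearN /= trmx_mul trmx_inv sS !mulNmx !mulmxN opprK.
rewrite !mulmxA mulVmx // mul1mx mulVmx // mul1mx -mulmxA.
by rewrite -trmx_mul mulVmx // trmx1 mulmx1.
Qed.

End loewner_bound.

(** * Asymptotic normality of the estimator *)

Section estimator_clt.
Context {R : realType} {d : nat} {dX dY dO : measure_display}.
Context {X : measurableType dX} {Y : measurableType dY} {Omega : measurableType dO}.
Variables (m : model R d X Y) (U : 'cV[R]_d -> X -> Y -> 'cV[R]_d).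
Variables (theta : 'cV[R]_d) (P : probability Omega R).
Variables (x_ : nat -> Omega -> X) (y_ : nat -> Omega -> Y).
Variables (delta_ : nat -> Omega -> bool) (thetahat : nat -> Omega -> 'cV[R]_d).
Hypothesis theta_in : Theta m theta.
Hypothesis U_regular : regular_at m U theta.
Hypothesis U_unbiased : unbiased m U.
Hypothesis sample : iid_sample m P x_ y_ delta_ theta.
Hypothesis thetahat_rv : forall N, random_vector (thetahat N).
Hypothesis B_exists : expect_exists m theta (deltaUU U theta).
Variable A : 'M[R]_d.
Hypothesis expansion : is_oP P (fun N => (Num.sqrt N%:R)^-1)
  (fun N w => thetahat N w -
     (theta - A *m (N%:R^-1 *: est_sum x_ y_ delta_ U N theta w))).
Local Notation mu := (lam m \x nu m)%E.
Local Notation g z := (sampled_density m theta z.1 z.2).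
Local Notation B := (B_ m U theta).

(** The contribution of the [i]-th triple to the linear expansion. Its scalar product with [t] is a
    fixed measurable function [h t] of the triple, so independence and the common law are inherited
    from the sample. *)
Let xi i w : 'cV[R]_d := - (A *m ((delta_ i w)%:R *: U theta (x_ i w) (y_ i w))).
Let a t : 'cV[R]_d := - (A^T *m t).

Let dot_xi t i w : dot t (xi i w) = (delta_ i w)%:R * dot (a t) (U theta (x_ i w) (y_ i w)).
Proof.
by rewrite /xi /a dotNr -scalemxAr dotZr -mulrN dotNl /dot trmx_mul trmxK !mulmxA.
Qed.

Let h t (z : X * Y * bool) : R := z.2%:R * dot (a t) (U theta z.1.1 z.1.2).

Let measurable_dotU t : measurable_fun setT (fun z : X * Y => dot t (U theta z.1 z.2)).
Proof. by apply: measurable_dot => i; exact: (measurable_U theta_in U_regular). Qed.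

Let measurable_h t : measurable_fun setT (h t).
Proof.
exact: (@measurable_delta_mul R _ _ X Y (fun x y => dot (a t) (U theta x y))).
Qed.

Let preimage_xi t i (S : set R) : (fun w => dot t (xi i w)) @^-1` S =
  (fun w => (x_ i w, y_ i w, delta_ i w)) @^-1` (h t @^-1` S).
Proof. by apply/seteqP; split => w /=; rewrite dot_xi. Qed.

Let indep t n (S : nat -> set R) : (forall i, measurable (S i)) ->
  P (\bigcap_(i in `I_n) ((fun w => dot t (xi i w)) @^-1` S i)) =
  (\prod_(i < n) P ((fun w => dot t (xi i w)) @^-1` S i))%E.
Proof.
move=> mS; have [_ ind _] := sample.
under eq_bigcapr do rewrite preimage_xi.
under [RHS]eq_bigr do rewrite preimage_xi.
apply: (ind n (fun i => h t @^-1` S i)) => i.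
by rewrite -[X in measurable X]setTI; exact: measurable_h.
Qed.

Let ident t n S : measurable S ->
  P ((fun w => dot t (xi n w)) @^-1` S) = P ((fun w => dot t (xi 0%N w)) @^-1` S).
Proof.
move=> mS; have [_ _ law] := sample.
have mh : measurable (h t @^-1` S) by rewrite -[X in measurable X]setTI; exact: measurable_h.
by rewrite !preimage_xi !law.
Qed.

Let moment1 t : mu.-integrable setT (fun z => (g z * dot t (U theta z.1 z.2))%:E) /\
  \int[mu]_z (g z * dot t (U theta z.1 z.2)) = 0.
Proof.
have E z : g z * dot t (U theta z.1 z.2) =
    \sum_i t i 0 * (fX m z.1 * (f m theta z.1 z.2 * samp m z.1 z.2 * U theta z.1 z.2 i 0)).
  rewrite dotE mulr_sumr; apply: eq_bigr => i _; rewrite /sampled_density; ring.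
have iU i := integrable_U_density theta_in U_regular B_exists i.
have [h1 h2] := Rintegral_sum (index_enum 'I_d)
  (fun i => integrableZl measurableT (t i 0) (iU i)).
split; first by apply: eq_integrable h1 => // z _ /=; rewrite E.
under eq_Rintegral do rewrite E.
rewrite [LHS]h2 big1 // => i _.
by rewrite RintegralZl ?(U_mean theta_in U_regular U_unbiased B_exists) ?mulr0 //; exact: iU.
Qed.

Let xi_moment1 t : P.-integrable setT (EFin \o (fun w => dot t (xi 0%N w))) /\
  \int[P]_w dot t (xi 0%N w) = 0.
Proof.
have [i1 e1] := moment1 (a t).
have [i2 e2] := integral_sample (h := fun x y => dot (a t) (U theta x y))
  theta_in sample 0 (measurable_dotU (a t)) i1.
rewrite -e1 -e2; split; last by apply: eq_Rintegral => w _; exact: dot_xi.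
by apply: eq_integrable i2 => // w _ /=; rewrite dot_xi.
Qed.

Let xi_moment2 t : P.-integrable setT (EFin \o (fun w => dot t (xi 0%N w) ^+ 2)) /\
  \int[P]_w dot t (xi 0%N w) ^+ 2 = bform (A *m B *m A^T) t t.
Proof.
have [i1 e1] := bform_B B_exists (a t) (a t).
have mh : measurable_fun setT (fun z : X * Y =>
    dot (a t) (U theta z.1 z.2) * dot (a t) (U theta z.1 z.2)).
  by apply: measurable_funM; exact: measurable_dotU.
have [i2 e2] := integral_sample (h := fun x y =>
  dot (a t) (U theta x y) * dot (a t) (U theta x y)) theta_in sample 0 mh i1.
(* The indicator [delta] equals its square, so the second moment keeps a single factor and fits
   [integral_sample]. *)
have E w : dot t (xi 0 w) ^+ 2 = (delta_ 0 w)%:R *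
    (dot (a t) (U theta (x_ 0 w) (y_ 0 w)) * dot (a t) (U theta (x_ 0 w) (y_ 0 w))).
  by rewrite dot_xi; case: (delta_ 0 w); rewrite ?mul1r ?mul0r ?expr0n // expr2.
split; first by apply: eq_integrable i2 => // w _ /=; rewrite E.
under eq_Rintegral do rewrite E.
rewrite e2 e1 bform_congr /a -scaleN1r bformZl bformZr; ring.
Qed.

Let xi_rv i : random_vector (xi i).
Proof.
move=> k; have [mZ _ _] := sample.
apply: (@eq_measurable_fun _ _ _ _ setT (h (delta_mx k 0) \o
  (fun w => (x_ i w, y_ i w, delta_ i w)))); last exact: measurableT_comp.
by move=> w _; rewrite -[RHS]dot_delta dot_xi.
Qed.

Lemma psd_congr : psd (A *m B *m A^T).
Proof.
have [sB pB] := psd_B theta_in B_exists; split; first by rewrite !trmx_mul trmxK sB mulmxA.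
by move=> v; rewrite -/(bform _ v v) bform_congr; exact: pB.
Qed.

(** Multiplication by [Num.sqrt N%:R] turns the factor [N%:R^-1] of the expansion into
    [(Num.sqrt N%:R)^-1]; at [N = 0] both sides of that identity are 0. *)
Let remainderE N w : Num.sqrt N%:R *: (thetahat N w - theta) -
    (Num.sqrt N%:R)^-1 *: \sum_(i < N) xi i w =
  Num.sqrt N%:R *: (thetahat N w -
    (theta - A *m (N%:R^-1 *: est_sum x_ y_ delta_ U N theta w))).
Proof.
have -> : \sum_(i < N) xi i w = - (A *m est_sum x_ y_ delta_ U N theta w).
  by rewrite /est_sum mulmx_sumr -sumrN.
rewrite scalerN opprK opprB addrA addrAC [RHS]scalerDr; congr (_ + _).
rewrite -scalemxAr scalerA; congr (_ *: _).
have [->|N0] := eqVneq N 0%N; first by rewrite sqrtr0 invr0 mul0r.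
rewrite -[X in _ * X^-1](sqr_sqrtr (ler0n R N)); field.
by rewrite sqrtr_eq0 -ltNge ltr0n lt0n.
Qed.

Lemma asymptotically_normal_estimator :
  asymptotically_normal P (fun N w => Num.sqrt N%:R *: (thetahat N w - theta))
    (A *m B *m A^T).
Proof.
apply: (vector_clt xi_rv _ psd_congr indep ident (fun t => (xi_moment1 t).1)
  (fun t => (xi_moment2 t).1) (fun t => (xi_moment1 t).2) (fun t => (xi_moment2 t).2)).
  by move=> N; apply: random_vectorZ; apply: random_vectorB => // i; exact: measurable_cst.
move=> eps eps0; apply: cvg_trans (expansion eps0); apply: near_eq_cvg.
(* For [N = 0] the rate [(Num.sqrt N%:R)^-1] is 0 by convention and the two events may differ; from
   [N = 1] on, rescaling identifies them. *)
exists 1%N => // N /= N0; congr (P _); apply/seteqP.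
have sN : 0 < Num.sqrt (N%:R : R) by rewrite sqrtr_gt0 ltr0n.
suff E w : (eps * (Num.sqrt N%:R)^-1 < `|thetahat N w -
      (theta - A *m (N%:R^-1 *: est_sum x_ y_ delta_ U N theta w))|) =
    (eps * 1 < `|Num.sqrt N%:R *: (thetahat N w - theta) -
      (Num.sqrt N%:R)^-1 *: \sum_(i < N) xi i w|).
  by split => w /=; rewrite E.
by rewrite remainderE normrZ gtr0_norm // ltr_pdivrMr // mulr1 mulrC.
Qed.

End estimator_clt.

(** * Limiting covariance, Loewner bound and case of equality *)

Theorem theorem2 (R : realType) (d : nat) (dX dY dO : measure_display)
    (X : measurableType dX) (Y : measurableType dY) (Omega : measurableType dO)
    (m : model R d X Y) (U : 'cV[R]_d -> X -> Y -> 'cV[R]_d)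
    (theta : 'cV[R]_d) (P : probability Omega R)
    (x_ : nat -> Omega -> X) (y_ : nat -> Omega -> Y)
    (delta_ : nat -> Omega -> bool) (thetahat : nat -> Omega -> 'cV[R]_d)
    (theta_in : Theta m theta)
    (U_regular : regular_at m U theta)
    (U_unbiased : unbiased m U)
    (U_interchange : derivative_under_integral m U theta)
    (sample : iid_sample m P x_ y_ delta_ theta)
    (thetahat_rv : forall N, random_vector (thetahat N))
    (thetahat_root : solves_estimating_equation m P x_ y_ delta_ U thetahat)
    (M_exists : expect_exists m theta (deltaUdot U theta))
    (M_full_rank : M_ m U theta \in unitmx)
    (expansion : is_oP P (fun N => (Num.sqrt N%:R)^-1)
       (fun N w => thetahat N w -
          (theta - invmx (M_ m U theta) *m
                     (N%:R^-1 *: est_sum x_ y_ delta_ U N theta w))))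
    (B_exists : expect_exists m theta (deltaUU U theta))
    (Sigma_finite : expect_exists m theta (Sigma_integrand m theta))
    (Sigma_pd : pos_def (Sigma m theta)) :
  let V := invmx (M_ m U theta) *m B_ m U theta *m (invmx (M_ m U theta))^T in
  [/\ asymptotically_normal P
        (fun N w => Num.sqrt N%:R *: (thetahat N w - theta)) V,
      loewner_ge V (invmx (Sigma m theta)) &
      U_linear_in_score_S m U theta
        (- (M_ m U theta *m invmx (Sigma m theta))) ->
      V = invmx (Sigma m theta)].
Proof.
move=> V; split.
- exact: (asymptotically_normal_estimator theta_in U_regular U_unbiased sample
    thetahat_rv B_exists expansion).
- exact: loewner_score_bound.
- exact: score_bound_attained.
Qed.
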